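(* Let $t_c=\frac{1}{2\mu}\log\gamma^{-1}$, let $\underline Y_\gamma^{(k)}(\theta)=\underline X_\gamma^{(k)}(t_c\theta)$ be the time-rescaled process, and for $\delta\in(0,1)$ let $T_\delta=\frac{1}{2\mu}\log\delta^{-1}$. Then, for $k=\pm1$, $$\lim_{\delta\to0}\ \liminf_{\gamma\to0}\ \mathbb P\Big(\Big\|\underline Y_\gamma^{(k)}\Big(1-\frac{T_\delta}{t_c}\Big)\Big\|>\delta\Big)=1.$$
   Context: Parameters. Fix $\beta_1\ge\beta_2>0$, $\tau_1,\tau_2>0$, $\lambda>0$. Let $\mathbb T=[0,1)$ be the unit torus, $\gamma^{-1}\in\mathbb N$, $\Lambda_\gamma=\{0,1,\dots,\gamma^{-1}-1\}$ (discrete torus). Let $\phi_i(r,\tilde r)=\sum_{a\in\mathbb Z}\frac{1}{\sqrt{2\pi\tau_i}}e^{-(r-\tilde r-a)^2/(2\tau_i)}$, with Fourier coefficients $\hat\phi_i^{(k)}=e^{-2\pi^2\tau_ik^2}$, and for $\sigma\in\{-1,1\}^{\Lambda_\gamma}$ let $(\sigma*\phi_i)(x)=\gamma\sum_{y\in\Lambda_\gamma}\sigma(y)\phi_i(\gamma x,\gamma y)$. Process. $(\underline\sigma_\gamma(t))_{t\ge0}=((\sigma_{\gamma,1}(t),\sigma_{\gamma,2}(t)))_{t\ge0}$ is the continuous-time Markov chain on $\{-1,1\}^{\Lambda_\gamma}\times\{-1,1\}^{\Lambda_\gamma}$ in which, when the state is $\underline\sigma=(\sigma_1,\sigma_2)$,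 the spin $\sigma_i(x)$ flips sign at rate $R_i(x,\underline\sigma)$, where $$R_1(x,\underline\sigma)=\frac{e^{-\beta_1\sigma_1(x)(\sigma_1*\phi_1)(x)-\beta_1\lambda\sigma_1(x)\sigma_2(x)}}{2\cosh\{\beta_1(\sigma_1*\phi_1)(x)+\beta_1\lambda\sigma_2(x)\}},\qquad R_2(x,\underline\sigma)=\frac{e^{-\beta_2\sigma_2(x)(\sigma_2*\phi_2)(x)+\beta_2\lambda\sigma_2(x)\sigma_1(x)}}{2\cosh\{\beta_2(\sigma_2*\phi_2)(x)-\beta_2\lambda\sigma_1(x)\}}.$$ The initial spins $\{\sigma_{\gamma,i}(0,x):i\in\{1,2\},x\in\Lambda_\gamma\}$ are independent with $\mathbb P(\sigma_{\gamma,i}(0,x)=\pm1)=\frac12$. Fourier modes. $X_{\gamma,i}^{(k)}(t)=\gamma\sum_{x\in\Lambda_\gamma}\sigma_{\gamma,i}(t,x)e^{-2\pi\mathtt ik\gamma x}$ and $\underline X_\gamma^{(k)}(t)=(X_{\gamma,1}^{(k)}(t),X_{\gamma,2}^{(k)}(t))^T\in\mathbb C^2$; $\|\cdot\|$ is the Euclidean norm on $\mathbb C^2$. Linear part. $\alpha_i=\beta_i/[\cosh(\lambda\beta_i)]^2$ and $$A^{(k)}=\begin{pmatrix}-1+\alpha_1\hat\phi_1^{(k)}&\tanh(\beta_1\lambda)\\-\tanh(\beta_2\lambda)&-1+\alpha_2\hat\phi_2^{(k)}\end{pmatrix}.$$ Standing hypotheses. For every $k\in\mathbb Z$, $k\neq\pm1$: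 $\alpha_1\hat\phi_1^{(k)}+\alpha_2\hat\phi_2^{(k)}<2$ and $(\alpha_1\hat\phi_1^{(k)}-1)(1-\alpha_2\hat\phi_2^{(k)})<\tanh(\lambda\beta_1)\tanh(\lambda\beta_2)$. For $k=\pm1$: $(\alpha_1\hat\phi_1^{(k)}-1)(1-\alpha_2\hat\phi_2^{(k)})>\tanh(\lambda\beta_1)\tanh(\lambda\beta_2)$. Under these hypotheses $A^{(1)}=A^{(-1)}$ has real eigenvalues $\mu_2^{(\pm1)}<0<\mu_1^{(\pm1)}$; put $\mu=\mu_1^{(\pm1)}$. For fixed $\delta\in(0,1)$ one has $t_c>T_\delta$ for all $\gamma$ small enough, so the expression is meaningful. *)

(* Defs.v *)
From HB Require Import structures.
From mathcomp Require Import all_boot all_order all_algebra complex.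
From mathcomp Require Import all_classical all_reals all_analysis.
Set Implicit Arguments.
Unset Strict Implicit.
Unset Printing Implicit Defensive.
Import Order.TTheory GRing.Theory Num.Theory.
Import numFieldNormedType.Exports.
Local Open Scope classical_set_scope.
Local Open Scope ring_scope.

Definition coshR (R : realType) (x : R) : R := (expR x + expR (- x)) / 2.
Definition sinhR (R : realType) (x : R) : R := (expR x - expR (- x)) / 2.
Definition tanhR (R : realType) (x : R) : R := sinhR x / coshR x.

(** * Continuous-time Markov chains on a finite state space *)

Section MarkovChain.
Context {R : realType} {S : finType}.

(* [q s u] is the jump rate from [s] to [u]; its diagonal values are unused. *)
Definition Qmatrix (q : S -> S -> R) (s u : S) : R :=
  if s == u then - \sum_(v | v != s) q s v else q s u.

Fixpoint kernel_pow (Q : S -> S -> R) (n : nat) (s u : S) : R :=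
  if n is m.+1 then \sum_v Q s v * kernel_pow Q m v u else (s == u)%:R.

(* The (s, u) entry of the matrix exponential of t Q. *)
Definition transition (Q : S -> S -> R) (t : R) (s u : S) : R :=
  limn (series (fun n => t ^+ n / n`!%:R * kernel_pow Q n s u)).

(* The time index of [X] is R for convenience: only times t >= 0 are
   constrained.  The last field is the Markov property with transition function
   [transition (Qmatrix q)], with conditional probabilities multiplied out. *)
Record markov_chain {d : measure_display} {Omega : measurableType d}
    (P : probability Omega R) (q : S -> S -> R) (X : R -> Omega -> S) : Prop :=
  MarkovChain {
    markov_measurable : forall (t : R) (s : S), 0 <= t ->
      measurable [set w | X t w = s];
    markov_rcont : forall (w : Omega) (t : R), 0 <= t ->
      \forall u \near t^'+, X u w = X t w;
    markov_prop : forall (n : nat) (t : nat -> R) (s : nat -> S),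
      0 <= t 0%N -> (forall j, (j <= n)%N -> t j <= t j.+1) ->
      P [set w | forall j, (j <= n.+1)%N -> X (t j) w = s j] =
      (P [set w | forall j, (j <= n)%N -> X (t j) w = s j] *
       (transition (Qmatrix q) (t n.+1 - t n) (s n) (s n.+1))%:E)%E }.

End MarkovChain.

Definition mutually_independent {R : realType} {d : measure_display}
    {Omega : measurableType d} (P : probability Omega R) {I T : finType}
    (xi : I -> Omega -> T) : Prop :=
  forall (J : {set I}) (B : I -> {set T}),
    P [set w | forall j, j \in J -> xi j w \in B j] =
    (\prod_(j in J) P [set w | xi j w \in B j])%E.

(** * The two-population spin system *)

(* Throughout, N is the inverse of gamma, and a spin is a boolean, with
   [true] for +1 and [false] for -1. *)
Definition config (N : nat) : finType :=
  ({ffun 'I_N -> bool} * {ffun 'I_N -> bool})%type.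

Section Model.
Context {R : realType}.

Definition spin (b : bool) : R := if b then 1 else - 1.

Definition flip (N : nat) (s : {ffun 'I_N -> bool}) (x : 'I_N) :
    {ffun 'I_N -> bool} :=
  [ffun y => if y == x then ~~ s y else s y].

(* The summand is positive and summable over Z, so [fine] loses nothing. *)
Definition phi (tau r r' : R) : R :=
  fine (\esum_(a in [set: int])
    ((Num.sqrt (2 * pi * tau))^-1 *
     expR (- (r - r' - a%:~R) ^+ 2 / (2 * tau)))%:E).

Definition phi_hat (tau : R) (k : int) : R :=
  expR (- (2 * pi ^+ 2 * tau * k%:~R ^+ 2)).

Definition conv (N : nat) (tau : R) (s : {ffun 'I_N -> bool}) (x : 'I_N) : R :=
  N%:R^-1 *
  \sum_(y < N) spin (s y) * phi tau (N%:R^-1 * x%:R) (N%:R^-1 * y%:R).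

Definition rate1 (N : nat) (beta1 tau1 lambda : R) (s : config N) (x : 'I_N)
    : R :=
  expR (- (beta1 * spin (s.1 x) * conv tau1 s.1 x)
        - beta1 * lambda * spin (s.1 x) * spin (s.2 x)) /
  (2 * coshR (beta1 * conv tau1 s.1 x + beta1 * lambda * spin (s.2 x))).

Definition rate2 (N : nat) (beta2 tau2 lambda : R) (s : config N) (x : 'I_N)
    : R :=
  expR (- (beta2 * spin (s.2 x) * conv tau2 s.2 x)
        + beta2 * lambda * spin (s.2 x) * spin (s.1 x)) /
  (2 * coshR (beta2 * conv tau2 s.2 x - beta2 * lambda * spin (s.1 x))).

Definition jump_rate (N : nat) (beta1 beta2 tau1 tau2 lambda : R)
    (s u : config N) : R :=
  \sum_(x < N | u == (flip s.1 x, s.2)) rate1 beta1 tau1 lambda s x +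
  \sum_(x < N | u == (s.1, flip s.2 x)) rate2 beta2 tau2 lambda s x.

(* Spins are indexed by population and site; [true] is the first population. *)
Definition site_spin (N : nat) (s : config N) (i : bool * 'I_N) : bool :=
  if i.1 then s.1 i.2 else s.2 i.2.

Definition fair_initial (N : nat) {d : measure_display}
    {Omega : measurableType d} (P : probability Omega R)
    (sigma0 : Omega -> config N) : Prop :=
  mutually_independent P (fun i w => site_spin (sigma0 w) i) /\
  forall i b, P [set w | site_spin (sigma0 w) i = b] = (2^-1)%:E.

Definition spin_process (N : nat) (beta1 beta2 tau1 tau2 lambda : R)
    {d : measure_display} {Omega : measurableType d} (P : probability Omega R)
    (sigma : R -> Omega -> config N) : Prop :=
  markov_chain P (jump_rate beta1 beta2 tau1 tau2 lambda) sigma /\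
  fair_initial P (sigma 0).

(* exp (i theta) *)
Definition expi (theta : R) : R[i] := (cos theta +i* sin theta)%C.

Definition mode (N : nat) (s : {ffun 'I_N -> bool}) (k : int) : R[i] :=
  (N%:R^-1)%:C%C *
  \sum_(x < N) (spin (s x))%:C%C * expi (- (2 * pi * k%:~R * (x%:R / N%:R))).

Definition modes (N : nat) (s : config N) (k : int) : R[i] * R[i] :=
  (mode s.1 k, mode s.2 k).

(* Euclidean norm on C^2: the library norm on pairs is the sup norm. *)
Definition norm2 (z : R[i] * R[i]) : R :=
  Num.sqrt (Normc.normc z.1 ^+ 2 + Normc.normc z.2 ^+ 2).

Definition alpha (beta lambda : R) : R := beta / coshR (lambda * beta) ^+ 2.

Definition linear_part (beta1 beta2 tau1 tau2 lambda : R) (k : int) :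
    'M[R]_2 :=
  \matrix_(i, j)
    (if i == 0 then
       if j == 0 then - 1 + alpha beta1 lambda * phi_hat tau1 k
       else tanhR (beta1 * lambda)
     else
       if j == 0 then - tanhR (beta2 * lambda)
       else - 1 + alpha beta2 lambda * phi_hat tau2 k).

Definition instability_at_pm1 (beta1 beta2 tau1 tau2 lambda : R) : Prop :=
  let ap1 k := alpha beta1 lambda * phi_hat tau1 k in
  let ap2 k := alpha beta2 lambda * phi_hat tau2 k in
  let tt := tanhR (lambda * beta1) * tanhR (lambda * beta2) in
  (forall k : int, k <> 1 -> k <> - 1 ->
     ap1 k + ap2 k < 2 /\ (ap1 k - 1) * (1 - ap2 k) < tt) /\
  (forall k : int, k = 1 \/ k = - 1 -> (ap1 k - 1) * (1 - ap2 k) > tt).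

Definition crit_time (mu : R) (N : nat) : R := (2 * mu)^-1 * ln (N%:R).

Definition T_ (mu delta : R) : R := (2 * mu)^-1 * ln (delta^-1).

Definition rescaled_modes (N : nat) (mu : R) {Omega : Type}
    (sigma : R -> Omega -> config N) (k : int) (theta : R) (w : Omega) :
    R[i] * R[i] :=
  modes (sigma (crit_time mu N * theta) w) k.

End Model.

(* Main.v *)
Require Import Defs.
From HB Require Import structures.
From mathcomp Require Import all_boot all_order all_algebra complex.
From mathcomp Require Import all_classical all_reals all_analysis.
From mathcomp Require Import ring lra.
Import Order.TTheory GRing.Theory Num.Theory.
Import numFieldNormedType.Exports.
Local Open Scope classical_set_scope.
Local Open Scope ring_scope.
Set Implicit Arguments.
Unset Strict Implicit.
Unset Printing Implicit Defensive.

(** The theorem says that the unstable Fourier modes of frequency 1 and -1, which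
    start at the scale [N^(-1/2)] of the central limit theorem and grow like
    [exp(mu t)], are not smaller than [delta] at the time when their typical size
    is [sqrt delta]. Only the law of the chain at single times matters. This law
    solves the forward equation ([is_derive_transition]), so every estimate is a
    drift inequality for a function of time and state ([mean_drift_le]): there
    are no martingales, stopping times or limit theorems for processes.

    To first order the modes of the two populations at one frequency form an
    autonomous system in the plane, up to an error quadratic in the convolution
    fields ([gen_spin_coef]). Its coefficients are discrete Fourier coefficients
    of the periodized Gaussian. They are within [O(1 / N)] of their limits at
    fixed frequency ([kernel_coef_theta_error]) and uniformly small at high
    frequency ([kernel_coef_theta_decay]).

    The energy of the fields is at most of order [exp(2 mu t) / N] in mean
    ([mean_total_energy]). It is dominated by a weighted sum of quadratic forms in
    the modes, one form per frequency, each growing at rate at most [2 mu] under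
    the linear system: the hypotheses make the system a saddle with eigenvalue
    [mu] at frequency 1 and stable at every other frequency. The quadratic error
    adds a term of order [3 / 2] in the Lyapunov function [V] ([gen_lyap]).
    Replacing [V] by a concave function of [V] removes this term
    ([mean_growth]), and independence of the initial spins gives the initial
    value.

    The leading mode [Y], the cosine coefficient of frequency 1 along a left
    eigenvector, has drift [mu Y] up to an error bounded by [1 / N] plus the
    energy, and its noise has variance of order [1 / N] per unit of time, from
    above and from below. The noise level depends on the state, which rules out a
    comparison with a Gaussian process. Instead a Gaussian function of [Y], with
    a width that solves a differential equation and a prefactor that makes
    allowance for all admissible noise levels, is a supersolution of the backward
    equation up to the drift error ([anticoncentration]). Evaluated at the time
    [T] with [exp(2 mu T) = N delta], it bounds the probability that
    [|Y| <= const * delta], for large [N], by a multiple of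
    [delta^(g / 2) + delta^(1 / 4)] for some [g > 0]
    ([leading_mode_not_small]). The norm of the modes dominates [|Y|] up to a
    constant, and the bound tends to 0 with [delta]. *)

(** * Pointwise calculus *)

Section Calculus.
Context {R : realType}.
Implicit Types (f g : R -> R) (x : R).

(** The rules of differentiation are stated for explicit abstractions over the
    variable so that they compose by unification. *)
Lemma is_derive_add f g x df dg : is_derive x 1 f df -> is_derive x 1 g dg ->
  is_derive x 1 (fun t => f t + g t) (df + dg).
Proof. by move=> hf hg; exact: is_deriveD. Qed.

Lemma is_derive_opp f x df : is_derive x 1 f df ->
  is_derive x 1 (fun t => - f t) (- df).
Proof. by move=> hf; exact: is_deriveN. Qed.

Lemma is_derive_mul f g x df dg : is_derive x 1 f df -> is_derive x 1 g dg ->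
  is_derive x 1 (fun t => f t * g t) (df * g x + f x * dg).
Proof.
move=> hf hg; apply: is_derive_eq (is_deriveM hf hg) _.
by rewrite /GRing.scale /= addrC [g x * _]mulrC.
Qed.

Lemma is_derive_scale (c : R) f x df : is_derive x 1 f df ->
  is_derive x 1 (fun t => c * f t) (c * df).
Proof. by move=> hf; exact: (is_deriveZ c hf). Qed.

Lemma is_derive_const (c : R) x : is_derive x 1 (fun _ => c) 0.
Proof. exact: is_derive_cst. Qed.

Lemma is_derive_var x : is_derive x 1 (fun t : R => t) 1.
Proof. exact: is_derive_id. Qed.

Lemma is_derive_expR_comp f x df : is_derive x 1 f df ->
  is_derive x 1 (fun t => expR (f t)) (expR (f x) * df).
Proof.
move=> hf; have := @is_derive1_comp _ expR f x _ _ (is_derive_expR (f x)) hf.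
by move=> h; apply: is_derive_eq h _; rewrite /GRing.scale /= mulrC.
Qed.

Lemma is_derive_inv f x df : f x != 0 -> is_derive x 1 f df ->
  is_derive x 1 (fun t => (f t)^-1) (- (df / f x ^+ 2)).
Proof.
move=> fx hf; apply: is_derive_eq (is_deriveV fx hf) _.
by rewrite /GRing.scale /= mulNr mulrC.
Qed.

Lemma is_derive_bigsum (I : Type) (r : seq I) (F : I -> R -> R) (dF : I -> R) x :
  (forall i, is_derive x 1 (F i) (dF i)) ->
  is_derive x 1 (fun t => \sum_(i <- r) F i t) (\sum_(i <- r) dF i).
Proof.
move=> h; elim: r => [|i r IH].
  rewrite big_nil; under eq_fun do rewrite big_nil; exact: is_derive_const.
rewrite big_cons; under eq_fun do rewrite big_cons; exact: is_derive_add.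
Qed.

Lemma is_derive_nonincreasing f (df : R -> R) (a b : R) : a <= b ->
  (forall x, is_derive x 1 f (df x)) -> (forall x, a < x < b -> df x <= 0) ->
  f b <= f a.
Proof.
move=> ab hf hd.
have d1 x : derivable f x 1 by case: (hf x).
have d2 x : x \in `]a, b[%R -> derive1 f x <= 0.
  by rewrite in_itv /= derive1E derive_val; exact: hd.
have ct : {within `[a, b], continuous f}.
  by apply: derivable_within_continuous => x _.
apply: (ler0_derive1_le_cc (fun x _ => d1 x) d2 ct) => //;
  by rewrite in_itv /= lexx ab.
Qed.

End Calculus.

(** * Finite continuous-time Markov chains *)

Section MatrixExponential.
Context {R : realType} {S : finType}.
Implicit Types Q : S -> S -> R.

Lemma kernel_powSr Q n s u :
  kernel_pow Q n.+1 s u = \sum_v kernel_pow Q n s v * Q v u.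
Proof.
elim: n s => [|n IH] s.
  rewrite /= (bigD1 u) //= eqxx mulr1 big1 ?addr0; last first.
    by move=> v /negPf vu; rewrite vu mulr0.
  rewrite (bigD1 s) //= eqxx mul1r big1 ?addr0 // => v.
  by rewrite eq_sym => /negPf ->; rewrite mul0r.
rewrite [LHS]/=; under eq_bigr do rewrite -/(kernel_pow Q n.+1 _ u) IH mulr_sumr.
rewrite exchange_big /=; apply: eq_bigr => v _.
by rewrite mulr_suml; apply: eq_bigr => w _; rewrite mulrA.
Qed.

Let entry_sum Q : R := \sum_s \sum_u `|Q s u|.

Lemma kernel_pow_le Q n s u : `|kernel_pow Q n s u| <= entry_sum Q ^+ n.
Proof.
have B0 : 0 <= entry_sum Q by rewrite !sumr_ge0 // => i _; rewrite sumr_ge0.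
elim: n s => [|n IH] s /=.
  by rewrite expr0; case: eqP => _; rewrite ?normr1 ?normr0.
apply: (le_trans (ler_norm_sum _ _ _)).
apply: (@le_trans _ _ (\sum_v `|Q s v| * entry_sum Q ^+ n)).
  by apply: ler_sum => v _; rewrite normrM ler_wpM2l.
rewrite -mulr_suml exprS ler_wpM2r ?exprn_ge0 //.
by rewrite /entry_sum [leRHS](bigD1 s) //= lerDl sumr_ge0 // => i _; rewrite sumr_ge0.
Qed.

(** The three series below, for an entry of the exponential and for its first
    two formal derivatives, are all dominated by a real exponential series. *)
Lemma is_cvg_exp_dominated (c : nat -> R) (A B t : R) : 0 <= A -> 0 <= B ->
  (forall n, `|c n| <= A * B ^+ n / n`!%:R) -> cvgn (pseries c t).
Proof.
move=> A0 B0 cB; apply: normed_cvg.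
apply: (@series_le_cvg _ _ (A *: exp_coeff (B * `|t|))).
- by move=> n; rewrite /= normr_ge0.
- move=> n; rewrite fctE /exp_coeff /=.
  by rewrite mulr_ge0 // divr_ge0 // exprn_ge0 // mulr_ge0.
- move=> n; rewrite /= normrM normrX fctE /exp_coeff /=.
  rewrite [leRHS](_ : _ = (A * B ^+ n / n`!%:R) * `|t| ^+ n).
    by rewrite ler_wpM2r // exprn_ge0.
  by rewrite /GRing.scale /= exprMn; ring.
by apply: is_cvg_seriesZ; exact: is_cvg_series_exp_coeff.
Qed.

Definition exp_coef Q s u n : R := kernel_pow Q n s u / n`!%:R.

Lemma transitionE Q t s u : transition Q t s u = limn (pseries (exp_coef Q s u) t).
Proof.
rewrite /transition /pseries; congr (limn (series _)).
by apply/funext => n; rewrite /exp_coef /=; ring.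
Qed.

Lemma exp_coef_diffs Q s u n :
  pseries_diffs (exp_coef Q s u) n = kernel_pow Q n.+1 s u / n`!%:R.
Proof.
rewrite /pseries_diffs /exp_coef factS natrM invfM.
by rewrite mulrCA !mulrA mulfK // pnatr_eq0.
Qed.

Lemma is_cvg_transition Q s u t : cvgn (pseries (exp_coef Q s u) t).
Proof.
have B0 : 0 <= entry_sum Q by rewrite !sumr_ge0 // => i _; rewrite sumr_ge0.
apply: (@is_cvg_exp_dominated _ 1 (entry_sum Q)) => // n.
rewrite /exp_coef normrM mul1r [X in _ * X]ger0_norm ?invr_ge0 //.
by rewrite ler_wpM2r ?invr_ge0 // kernel_pow_le.
Qed.

(** The exponential series may be differentiated term by term, and
    [kernel_powSr] puts the new factor [Q] on the right: this is the forward
    equation, the one that the law of the chain obeys. *)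
Lemma is_derive_transition Q t s u :
  is_derive t (1 : R) (fun t => transition Q t s u)
    (\sum_v transition Q t s v * Q v u).
Proof.
have B0 : 0 <= entry_sum Q by rewrite !sumr_ge0 // => i _; rewrite sumr_ge0.
have d1 K : cvgn (pseries (pseries_diffs (exp_coef Q s u)) K).
  apply: (@is_cvg_exp_dominated _ (entry_sum Q) (entry_sum Q)) => // n.
  rewrite exp_coef_diffs normrM [X in _ * X]ger0_norm ?invr_ge0 //.
  by rewrite ler_wpM2r ?invr_ge0 // -exprS kernel_pow_le.
have d2 K : cvgn (pseries (pseries_diffs (pseries_diffs (exp_coef Q s u))) K).
  apply: (@is_cvg_exp_dominated _ (entry_sum Q ^+ 2) (entry_sum Q));
    rewrite ?exprn_ge0 // => n.
  rewrite /pseries_diffs -/(pseries_diffs _ _) exp_coef_diffs factS natrM invfM.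
  rewrite mulrCA !mulrA mulfK ?pnatr_eq0 //.
  rewrite normrM [X in _ * X]ger0_norm ?invr_ge0 //.
  by rewrite ler_wpM2r ?invr_ge0 // -exprD addSn addSn add0n kernel_pow_le.
have E : limn (pseries (pseries_diffs (exp_coef Q s u)) t) =
    \sum_v transition Q t s v * Q v u.
  apply: cvg_lim => //.
  have -> : pseries (pseries_diffs (exp_coef Q s u)) t =
      (fun n => \sum_v pseries (exp_coef Q s v) t n * Q v u).
    apply/funext => n; rewrite /pseries /series /=.
    under [RHS]eq_bigr do rewrite mulr_suml.
    rewrite [RHS]exchange_big /=; apply: eq_bigr => i _.
    rewrite exp_coef_diffs kernel_powSr !mulr_suml; apply: eq_bigr => v _.
    by rewrite /exp_coef; ring.
  apply: cvg_big => [|v _]; first exact: add_continuous.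
  apply: cvgMl; rewrite transitionE.
  exact: is_cvg_transition.
rewrite -E.
have -> : (fun t => transition Q t s u) = (fun t => limn (pseries (exp_coef Q s u) t)).
  by apply/funext => x; rewrite transitionE.
apply: (@pseries_snd_diffs _ _ (`|t| + 1)) => //.
  exact: is_cvg_transition.
by rewrite [ltRHS]ger0_norm ?addr_ge0 // ltrDl.
Qed.

End MatrixExponential.

Section FiniteLaw.
Context {R : realType} {d : measure_display} {Omega : measurableType d}
  (P : probability Omega R) {S : finType}.

Lemma measurable_fin_pred (Y : Omega -> S) (B : pred S) :
  (forall s, measurable [set w | Y w = s]) -> measurable [set w | B (Y w)].
Proof.
move=> mY.
have -> : [set w | B (Y w)] = \bigcup_(s in [set s | B s]) [set w | Y w = s].
  apply/seteqP; split=> w /=; first by move=> Bw; exists (Y w).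
  by case=> s /= Bs ->.
exact: fin_bigcup_measurable.
Qed.

Lemma probability_fin_decomp (Y : Omega -> S) (A : set Omega) :
  (forall s, measurable [set w | Y w = s]) -> measurable A ->
  P A = (\sum_s P (A `&` [set w | Y w = s]))%E.
Proof.
move=> mY mA.
have H (r : seq S) : uniq r -> P (A `&` [set w | Y w \in r]) =
    (\sum_(s <- r) P (A `&` [set w | Y w = s]))%E.
  elim: r => [_|s r IH /= /andP[sr ur]].
    by rewrite big_nil (_ : _ `&` _ = set0) ?measure0 // -subset0 => w [].
  rewrite big_cons -IH // -measureU.
  - congr (P _); apply/seteqP; split=> w /=.
      by case=> Aw; rewrite inE => /orP[/eqP ->|Yr]; [left|right].
    by case=> -[Aw]; [move=> ->|move=> Yr]; rewrite inE ?eqxx ?Yr ?orbT.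
  - by apply: measurableI => //; exact: mY.
  - apply: measurableI => //.
    exact: (measurable_fin_pred (fun s => s \in r)).
  - rewrite -subset0 => w [[_ /= Ys] [_ /=]]; rewrite Ys.
    by rewrite (negPf sr).
rewrite -[in RHS]big_enum /= -H ?enum_uniq //; congr (P _).
by apply/seteqP; split=> [w Aw|w []//]; split=> //=; rewrite mem_enum.
Qed.

End FiniteLaw.

Section Dynkin.
Context {R : realType} {S : finType} {d : measure_display}
  {Omega : measurableType d} (P : probability Omega R) (q : S -> S -> R)
  (X : R -> Omega -> S) (mc : markov_chain P q X).

Definition law (t : R) (s : S) : R := fine (P [set w | X t w = s]).
Definition mean (t : R) (f : S -> R) : R := \sum_s law t s * f s.

Lemma law_ge0 t s : 0 <= law t s. Proof. exact: fine_ge0. Qed.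

Lemma lawK t s : 0 <= t -> (law t s)%:E = P [set w | X t w = s].
Proof. by move=> t0; rewrite fineK // fin_num_measure //; exact: (markov_measurable mc). Qed.

(** The Markov property at the two times [0] and [t], summed over the initial
    state. *)
Lemma law_evolution t u : 0 <= t ->
  law t u = \sum_s law 0 s * transition (Qmatrix q) t s u.
Proof.
move=> t0; apply: EFin_inj; rewrite lawK //.
have m0 s : measurable [set w | X 0 w = s] by exact: (markov_measurable mc).
have mt s : measurable [set w | X t w = s] by exact: (markov_measurable mc).
rewrite (probability_fin_decomp P m0 (mt u)) -sumEFin; apply: eq_bigr => s _.
have := @markov_prop _ _ _ _ _ _ _ mc 0%N (fun n => if n is _.+1 then t else 0)
  (fun n => if n is _.+1 then u else s) (lexx 0).
rewrite /= subr0 EFinM (lawK s (lexx 0)) => H.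
rewrite (_ : _ `&` _ = [set w | forall j, (j <= 1)%N ->
  X (if j is _.+1 then t else 0) w = (if j is _.+1 then u else s)]); last first.
  apply/seteqP; split=> w /=; first by case=> Xt X0 [|j].
  by move=> h; split; [exact: (h 1%N)|exact: (h 0%N)].
rewrite H; last by case.
congr (P _ * _)%E; apply/seteqP; split=> w /=; first by move=> h; exact: (h 0%N).
by move=> X0 [|j].
Qed.

Lemma law_sum1 t : 0 <= t -> \sum_s law t s = 1.
Proof.
move=> t0; apply: EFin_inj; rewrite -sumEFin -(probability_setT P).
have mt s : measurable [set w | X t w = s] by exact: (markov_measurable mc).
rewrite (probability_fin_decomp P mt measurableT); apply: eq_bigr => s _.
by rewrite setTI lawK.
Qed.

Lemma probability_law t (B : pred S) : 0 <= t ->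
  P [set w | B (X t w)] = (mean t (fun s => (B s)%:R))%:E.
Proof.
move=> t0.
have mt s : measurable [set w | X t w = s] by exact: (markov_measurable mc).
rewrite (probability_fin_decomp P mt (measurable_fin_pred B mt)).
rewrite /mean -sumEFin; apply: eq_bigr => s _.
rewrite EFinM lawK //; case: (boolP (B s)) => Bs.
  rewrite mule1; congr (P _); apply/seteqP; split=> w /=; first by case.
  by move=> Xs; rewrite Xs.
rewrite mule0 (_ : _ `&` _ = set0) ?measure0 // -subset0 => w [/=] + Xs.
by rewrite Xs (negPf Bs).
Qed.

Lemma mean_le t f g : (forall s, f s <= g s) -> mean t f <= mean t g.
Proof. by move=> fg; apply: ler_sum => s _; rewrite ler_wpM2l // law_ge0. Qed.

Lemma meanD t f g : mean t (fun s => f s + g s) = mean t f + mean t g.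
Proof. by rewrite /mean -big_split /=; apply: eq_bigr => s _; rewrite mulrDr. Qed.

Lemma meanZ t (c : R) f : mean t (fun s => c * f s) = c * mean t f.
Proof. by rewrite /mean mulr_sumr; apply: eq_bigr => s _; rewrite mulrCA. Qed.

Lemma mean_sum (I : Type) (r : seq I) t (F : I -> S -> R) :
  mean t (fun s => \sum_(i <- r) F i s) = \sum_(i <- r) mean t (F i).
Proof.
rewrite /mean exchange_big /=; apply: eq_bigr => s _; exact: mulr_sumr.
Qed.

Lemma mean_cst t (c : R) : 0 <= t -> mean t (fun=> c) = c.
Proof. by move=> t0; rewrite /mean -mulr_suml law_sum1 // mul1r. Qed.

(** A diagonal value of [q] is multiplied by zero here, in accordance with
    [Qmatrix]. *)
Definition generator (f : S -> R) (s : S) : R := \sum_u q s u * (f u - f s).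

Lemma generatorE f s : \sum_u Qmatrix q s u * f u = generator f s.
Proof.
rewrite /generator (bigD1 s) //= [RHS](bigD1 s) //= subrr mulr0 add0r.
rewrite /Qmatrix eqxx mulNr mulr_suml addrC -sumrB.
apply: eq_bigr => u us; rewrite eq_sym (negPf us); ring.
Qed.

(* The law extended to negative times by the flow of the forward equation,
   so that it is differentiable at time 0 as well. *)
Let flow t u := \sum_s law 0 s * transition (Qmatrix q) t s u.

(** By the forward equation the derivative of [mean t (F t)] is the mean of
    [dF t + generator (F t)], which is then compared with the derivative of [b].
    All estimates on the chain come from this inequality, each time with a
    function [F] adapted to the purpose. *)
Lemma mean_drift_le (F dF : R -> S -> R) (b db : R -> R) (T : R) : 0 <= T ->
  (forall s (t : R), is_derive t 1 (F ^~ s) (dF t s)) ->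
  (forall t : R, is_derive t 1 b (db t)) ->
  (forall t, 0 < t < T ->
     mean t (fun s => dF t s + generator (F t) s) <= db t) ->
  mean T (F T) <= mean 0 (F 0) + (b T - b 0).
Proof.
move=> T0 hF hb hd.
have dflow (t : R) u : is_derive t 1 (flow ^~ u) (\sum_v flow t v * Qmatrix q v u).
  have := @is_derive_bigsum _ _ (index_enum S)
    (fun s t => law 0 s * transition (Qmatrix q) t s u) _ t
    (fun s => is_derive_scale (law 0 s) (is_derive_transition (Qmatrix q) t s u)).
  move=> h; apply: is_derive_eq h _; rewrite /flow.
  under [RHS]eq_bigr do rewrite mulr_suml.
  rewrite exchange_big /=; apply: eq_bigr => s _.
  by rewrite mulr_sumr; apply: eq_bigr => v _; rewrite mulrA.
have dm (t : R) : is_derive t 1 (fun t => \sum_u flow t u * F t u - b t)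
    (\sum_u flow t u * (dF t u + generator (F t) u) - db t).
  have h1 := @is_derive_bigsum _ _ (index_enum S) (fun u t => flow t u * F t u)
    _ t (fun u => is_derive_mul (dflow t u) (hF u t)).
  have h2 := is_derive_add h1 (is_derive_opp (hb t)).
  apply: is_derive_eq h2 _; congr (_ - _).
  rewrite big_split /= [RHS](_ : _ = \sum_u flow t u * generator (F t) u +
    \sum_u flow t u * dF t u); last first.
    by rewrite -big_split /=; apply: eq_bigr => u _; ring.
  congr (_ + _); under eq_bigr do rewrite mulr_suml.
  rewrite exchange_big /=; apply: eq_bigr => v _.
  by rewrite -generatorE mulr_sumr; apply: eq_bigr => u _; rewrite mulrA.
have flowE t f : 0 <= t -> \sum_u flow t u * f u = mean t f.
  by move=> t0; apply: eq_bigr => u _; rewrite law_evolution.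
have := is_derive_nonincreasing T0 dm.
rewrite !flowE // => /(_ _)/wrap[t t0T|]; last lra.
have t0 : 0 <= t by case/andP: t0T => /ltW.
by rewrite flowE // subr_le0 hd.
Qed.

End Dynkin.

(** * Discrete Fourier analysis in real form *)

Section DiscreteFourier.
Context {R : realType}.
Implicit Types (f : R -> R) (N k x y : nat).

Lemma cos_2pi_nat n : cos (2 * pi * n%:R) = 1 :> R.
Proof.
rewrite (_ : 2 * pi * n%:R = 0 + pi *+ 2 *+ n); last first.
  by rewrite add0r -[pi *+ 2]mulr_natl mulr_natr.
by rewrite (periodicn (@cosD2pi R)) cos0.
Qed.

Lemma sin_2pi_nat n : sin (2 * pi * n%:R) = 0 :> R.
Proof.
rewrite (_ : 2 * pi * n%:R = 0 + pi *+ 2 *+ n); last first.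
  by rewrite add0r -[pi *+ 2]mulr_natl mulr_natr.
by rewrite (periodicn (@sinD2pi R)) sin0.
Qed.

(** The product of [2 * sin (t / 2)] with each cosine is a difference of two
    consecutive sines. *)
Lemma sum_cos_telescope N (t : R) :
  2 * sin (t / 2) * \sum_(k < N) cos (k%:R * t) =
  sin (N%:R * t - t / 2) + sin (t / 2).
Proof.
elim: N => [|N IH]; first by rewrite big_ord0 mulr0 mul0r sub0r sinN addNr.
rewrite big_ord_recr /= mulrDr IH.
have -> : N.+1%:R * t - t / 2 = N%:R * t + t / 2 :> R by rewrite -natr1; lra.
by rewrite sinB sinD; ring.
Qed.

Lemma sum_cos_eq0 N (t : R) : sin (t / 2) != 0 ->
  cos (N%:R * t) = 1 -> \sum_(k < N) cos (k%:R * t) = 0.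
Proof.
move=> st cN; have := sum_cos_telescope N t.
have sN : sin (N%:R * t) = 0.
  by apply/eqP; rewrite -norm_cos_eq1 cN normr1.
rewrite sinB cN sN mul0r mul1r sub0r addNr => /eqP.
by rewrite !mulf_eq0 pnatr_eq0 /= (negPf st) => /eqP.
Qed.

Definition angle N k x : R := 2 * pi * k%:R * (x%:R / N%:R).

Definition cos_coef N (f : 'I_N -> R) k : R :=
  N%:R^-1 * \sum_(x < N) f x * cos (angle N k x).
Definition sin_coef N (f : 'I_N -> R) k : R :=
  N%:R^-1 * \sum_(x < N) f x * sin (angle N k x).

(** The angle lies in the open interval from [0] to [pi], up to a sign. *)
Lemma sin_pi_ratio_neq0 N x y : (x < N)%N -> (y < N)%N -> x != y ->
  sin (pi * (x%:R - y%:R) / N%:R) != 0 :> R.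
Proof.
move=> xN yN; have N0 : 0 < N%:R :> R by rewrite ltr0n (leq_ltn_trans _ xN).
wlog xy : x y xN yN / (y < x)%N.
  move=> H xy; have [yx|xy'|/eqP e] := ltngtP y x; first exact: H.
    have := H y x yN xN xy'; rewrite eq_sym => /(_ xy); apply: contraNN.
    by rewrite -(opprB y%:R) mulrN mulNr sinN oppr_eq0.
  by rewrite eq_sym e in xy.
move=> _; rewrite gt_eqF // sin_gt0_pi //; apply/andP; split.
  by rewrite divr_gt0 // mulr_gt0 ?pi_gt0 // subr_gt0 ltr_nat.
rewrite ltr_pdivrMr // ltr_pM2l ?pi_gt0 //.
by rewrite (@le_lt_trans _ _ x%:R) ?ltr_nat // lerBlDr lerDl.
Qed.

Lemma cos_orthogonality N (x y : 'I_N) :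
  \sum_(k < N) cos (angle N k x - angle N k y) = if x == y then N%:R else 0.
Proof.
case: eqP => [->|/eqP xy].
  under eq_bigr do rewrite subrr cos0.
  by rewrite sumr_const card_ord.
have N0 : N%:R != 0 :> R by rewrite pnatr_eq0; case: N x {xy y} => [[]|].
pose t : R := 2 * pi * (x%:R - y%:R) / N%:R.
rewrite (eq_bigr (fun k : 'I_N => cos (k%:R * t))); last first.
  by move=> k _; congr cos; rewrite /angle /t; field.
apply: sum_cos_eq0.
  rewrite (_ : t / 2 = pi * (x%:R - y%:R) / N%:R); last by rewrite /t; field.
  exact: sin_pi_ratio_neq0.
have -> : N%:R * t = 2 * pi * x%:R - 2 * pi * y%:R by rewrite /t; field.
by rewrite cosB !cos_2pi_nat !sin_2pi_nat mulr0 addr0 mulr1.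
Qed.

(** Expand the squares and sum over the frequency first: by
    [cos_orthogonality] only the diagonal of the double sum over sites
    survives. *)
Lemma parseval N (f : 'I_N -> R) : (0 < N)%N ->
  \sum_(k < N) (cos_coef f k ^+ 2 + sin_coef f k ^+ 2) =
  N%:R^-1 * \sum_(x < N) f x ^+ 2.
Proof.
move=> N_gt0; have N0 : N%:R != 0 :> R by rewrite pnatr_eq0 -lt0n.
have E k : cos_coef f k ^+ 2 + sin_coef f k ^+ 2 = N%:R^-1 ^+ 2 *
    \sum_(x < N) \sum_(y < N) f x * f y * cos (angle N k x - angle N k y).
  rewrite /cos_coef /sin_coef !exprMn -mulrDr; congr (_ * _).
  rewrite !expr2 !mulr_suml -big_split /=; apply: eq_bigr => x _.
  rewrite !mulr_sumr -big_split /=; apply: eq_bigr => y _.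
  by rewrite cosB; ring.
under eq_bigr do rewrite E.
rewrite -mulr_sumr exchange_big /= expr2 -mulrA; congr (_ * _).
rewrite mulr_sumr; apply: eq_bigr => x _.
rewrite exchange_big /=.
under eq_bigr do rewrite -mulr_sumr cos_orthogonality.
rewrite (bigD1 x) //= eqxx big1 => [|y]; last first.
  by rewrite eq_sym => /negPf ->; rewrite mulr0.
by rewrite addr0; field.
Qed.

(** By the double-angle formula the fluctuating part is a sum of cosines of
    frequency 2, which vanishes because [N] does not divide 2. *)
Lemma sum_sqr_cos N : (3 <= N)%N ->
  \sum_(x < N) cos (angle N 1 x) ^+ 2 = N%:R / 2.
Proof.
move=> N3; have N_gt0 : 0 < N%:R :> R by rewrite ltr0n (leq_trans _ N3).
have N0 : N%:R != 0 :> R by rewrite gt_eqF.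
pose t : R := 4 * pi / N%:R.
have S0 : \sum_(x < N) cos (x%:R * t) = 0.
  apply: sum_cos_eq0.
    rewrite (_ : t / 2 = pi * (2%:R - 0%:R) / N%:R); last by rewrite /t; field.
    by apply: sin_pi_ratio_neq0 => //; apply: leq_trans N3.
  rewrite (_ : _ * t = 2 * pi * 2%:R) ?cos_2pi_nat //.
  by rewrite /t; field.
rewrite (eq_bigr (fun x : 'I_N => (1 + cos (x%:R * t)) / 2)); last first.
  move=> x _; have -> : x%:R * t = angle N 1 x *+ 2.
    by rewrite /t /angle -mulr_natr; field.
  by rewrite cos_mulr2n -mulr_natr; field.
rewrite -mulr_suml big_split /= S0 addr0 sumr_const card_ord.
by rewrite -[1 *+ N]/(N%:R).
Qed.

Section CirculantKernel.
Variables (kappa : R -> R) (N : nat).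
Hypotheses (N_gt0 : (0 < N)%N) (kappa_even : forall r, kappa (- r) = kappa r)
  (kappa_periodic : forall r, kappa (r + 1) = kappa r).

Let N0 : N%:R != 0 :> R. Proof. by rewrite pnatr_eq0 -lt0n. Qed.

Lemma sum_periodic_shift f (y : nat) : (forall r, f (r + 1) = f r) ->
  \sum_(x < N) f (x%:R / N%:R - y%:R / N%:R) = \sum_(x < N) f (x%:R / N%:R).
Proof.
move=> fp; elim: y => [|y <-]; first by under eq_bigr do rewrite mul0r subr0.
pose h (x : nat) := f ((x%:R - y.+1%:R) / N%:R).
have -> : \sum_(x < N) f (x%:R / N%:R - y%:R / N%:R) = \sum_(x < N) h x.+1.
  apply: eq_bigr => x _; rewrite /h; congr f; rewrite -!natr1.
  by rewrite -mulrBl; congr (_ / _); ring.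
have -> : \sum_(x < N) f (x%:R / N%:R - y.+1%:R / N%:R) = \sum_(x < N) h x.
  by apply: eq_bigr => x _; rewrite /h; congr f; rewrite -mulrBl.
have hN : h 0%N = h N by rewrite /h -[LHS]fp; congr f; field.
have tele : \sum_(x < N) h x + h N = h 0%N + \sum_(x < N) h x.+1.
  transitivity (\sum_(x < N.+1) h x); first by rewrite big_ord_recr.
  by rewrite big_ord_recl.
by apply: (addIr (h N)); rewrite tele hN addrC.
Qed.

(** The reflection [x -> N - 1 - x] is the change of sign followed by a shift
    by [N - 1] sites. *)
Lemma sum_odd_periodic_eq0 f : (forall r, f (r + 1) = f r) ->
  (forall r, f (- r) = - f r) -> \sum_(x < N) f (x%:R / N%:R) = 0.
Proof.
move=> fp fo; suff : \sum_(x < N) f (x%:R / N%:R) = - \sum_(x < N) f (x%:R / N%:R) by lra.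
rewrite -[in RHS](sum_periodic_shift N.-1 fp) (reindex_inj rev_ord_inj) /=.
rewrite -sumrN; apply: eq_bigr => x _; rewrite -fo; congr f.
have -> : (N - x.+1)%N = (N.-1 - x)%N by rewrite -subn1 -subnDA add1n.
rewrite natrB; last by rewrite -ltnS prednK.
by rewrite opprB mulrBl.
Qed.

Definition kernel_coef k : R :=
  N%:R^-1 * \sum_(y < N) kappa (y%:R / N%:R) * cos (angle N k y).

Let shifted_cos k (y : 'I_N) :
  \sum_(x < N) kappa (x%:R / N%:R - y%:R / N%:R) *
     cos (2 * pi * k%:R * (x%:R / N%:R - y%:R / N%:R)) = N%:R * kernel_coef k.
Proof.
rewrite (sum_periodic_shift y (f := fun r => kappa r * cos (2 * pi * k%:R * r))).
  by rewrite /kernel_coef mulVKf.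
by move=> r; rewrite kappa_periodic mulrDr mulr1 cosD cos_2pi_nat sin_2pi_nat; ring.
Qed.

Let shifted_sin k (y : 'I_N) :
  \sum_(x < N) kappa (x%:R / N%:R - y%:R / N%:R) *
     sin (2 * pi * k%:R * (x%:R / N%:R - y%:R / N%:R)) = 0.
Proof.
have fp r : kappa (r + 1) * sin (2 * pi * k%:R * (r + 1)) =
    kappa r * sin (2 * pi * k%:R * r).
  by rewrite kappa_periodic mulrDr mulr1 sinD cos_2pi_nat sin_2pi_nat; ring.
rewrite (sum_periodic_shift y (f := fun r => kappa r * sin (2 * pi * k%:R * r))) //.
apply: (sum_odd_periodic_eq0 (f := fun r => kappa r * sin (2 * pi * k%:R * r))) => //.
by move=> r; rewrite kappa_even mulrN sinN mulrN.
Qed.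

Definition circulant (g : 'I_N -> R) (x : 'I_N) : R :=
  N%:R^-1 * \sum_(y < N) g y * kappa (x%:R / N%:R - y%:R / N%:R).

(** After the shift by [y], the cosine splits by the addition formula, and the
    part that pairs the even kernel with a sine vanishes. *)
Lemma kernel_cos k (y : 'I_N) :
  N%:R^-1 * \sum_(x < N) kappa (x%:R / N%:R - y%:R / N%:R) * cos (angle N k x) =
  kernel_coef k * cos (angle N k y).
Proof.
rewrite (eq_bigr (fun x : 'I_N =>
    kappa (x%:R / N%:R - y%:R / N%:R) *
      cos (2 * pi * k%:R * (x%:R / N%:R - y%:R / N%:R)) * cos (angle N k y) -
    kappa (x%:R / N%:R - y%:R / N%:R) *
      sin (2 * pi * k%:R * (x%:R / N%:R - y%:R / N%:R)) * sin (angle N k y))); last first.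
  move=> x _; rewrite -!mulrA -mulrBr -cosD; congr (_ * cos _).
  by rewrite /angle; ring.
by rewrite sumrB -!mulr_suml shifted_cos shifted_sin mul0r subr0 mulrA mulKf.
Qed.

Lemma kernel_sin k (y : 'I_N) :
  N%:R^-1 * \sum_(x < N) kappa (x%:R / N%:R - y%:R / N%:R) * sin (angle N k x) =
  kernel_coef k * sin (angle N k y).
Proof.
rewrite (eq_bigr (fun x : 'I_N =>
    kappa (x%:R / N%:R - y%:R / N%:R) *
      sin (2 * pi * k%:R * (x%:R / N%:R - y%:R / N%:R)) * cos (angle N k y) +
    kappa (x%:R / N%:R - y%:R / N%:R) *
      cos (2 * pi * k%:R * (x%:R / N%:R - y%:R / N%:R)) * sin (angle N k y))); last first.
  move=> x _; rewrite -!mulrA -mulrDr -sinD; congr (_ * sin _).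
  by rewrite /angle; ring.
by rewrite big_split /= -!mulr_suml shifted_cos shifted_sin mul0r add0r mulrA mulKf.
Qed.

Lemma cos_coef_circulant g k :
  cos_coef (circulant g) k = kernel_coef k * cos_coef g k.
Proof.
rewrite /cos_coef mulrCA; congr (_ * _); rewrite mulr_sumr.
rewrite /circulant; under eq_bigr do rewrite -mulrA mulr_suml mulr_sumr.
rewrite exchange_big /=; apply: eq_bigr => y _.
transitivity (g y * (N%:R^-1 * \sum_(x < N)
    kappa (x%:R / N%:R - y%:R / N%:R) * cos (angle N k x))).
  by rewrite mulrA mulr_sumr; apply: eq_bigr => x _; ring.
by rewrite kernel_cos; ring.
Qed.

Lemma sin_coef_circulant g k :
  sin_coef (circulant g) k = kernel_coef k * sin_coef g k.
Proof.
rewrite /sin_coef mulrCA; congr (_ * _); rewrite mulr_sumr.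
rewrite /circulant; under eq_bigr do rewrite -mulrA mulr_suml mulr_sumr.
rewrite exchange_big /=; apply: eq_bigr => y _.
transitivity (g y * (N%:R^-1 * \sum_(x < N)
    kappa (x%:R / N%:R - y%:R / N%:R) * sin (angle N k x))).
  by rewrite mulrA mulr_sumr; apply: eq_bigr => x _; ring.
by rewrite kernel_sin; ring.
Qed.

(** Aliasing: on the lattice the cosines of frequencies [k] and [N - k] agree. *)
Lemma kernel_coef_rev k : (k <= N)%N -> kernel_coef (N - k) = kernel_coef k.
Proof.
move=> kN; congr (_ * _); apply: eq_bigr => y _; congr (_ * _).
have -> : angle N (N - k) y = 2 * pi * y%:R - angle N k y.
  by rewrite /angle natrB //; field.
by rewrite cosB cos_2pi_nat sin_2pi_nat; ring.
Qed.

(** Parseval's identity; the bound is uniform in [N], as each coefficient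
    averages over the lattice. *)
Lemma sum_kernel_coef_sqr (B : R) : (forall x, (x < N)%N -> `|kappa (x%:R / N%:R)| <= B) ->
  \sum_(k < N) kernel_coef k ^+ 2 <= B ^+ 2.
Proof.
move=> kB; pose f (x : 'I_N) := kappa (x%:R / N%:R).
apply: (@le_trans _ _ (\sum_(k < N) (cos_coef f k ^+ 2 + sin_coef f k ^+ 2))).
  by apply: ler_sum => k _; rewrite lerDl sqr_ge0.
rewrite parseval // ler_pdivrMl ?ltr0n // mulr_natl.
apply: (@le_trans _ _ (\sum_(x < N) B ^+ 2)).
  apply: ler_sum => x _; rewrite -real_normK ?num_real //.
  by rewrite ler_sqr ?nnegrE // ?(le_trans _ (kB _ (ltn_ord x))) // kB.
by rewrite sumr_const card_ord.
Qed.

End CirculantKernel.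

End DiscreteFourier.

(** * Lattice sums of the Gaussian *)

Section Gaussian.
Context {R : realType}.
Variable tau : R.
Hypothesis tau_gt0 : 0 < tau.

Definition gauss (x : R) : R :=
  (Num.sqrt (2 * pi * tau))^-1 * expR (- x ^+ 2 / (2 * tau)).

Local Notation sigma := (Num.sqrt tau).

Lemma gauss_normal_pdf : gauss = normal_pdf 0 sigma.
Proof.
have s0 : sigma != 0 by rewrite gt_eqF // sqrtr_gt0.
rewrite normal_pdfE //; apply/funext => x; rewrite /gauss /normal_peak /normal_fun.
rewrite subr0 sqr_sqrtr ?(ltW tau_gt0) //; congr ((Num.sqrt _)^-1 * expR (_ / _)).
  by rewrite -mulr_natl; ring.
by rewrite -[RHS]mulr_natl.
Qed.

(* The identity as a random variable, whose distribution function is [Psi]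
   below. *)
Let idTR : measurableTypeR R -> R := idfun.

#[local] HB.instance Definition _ :=
  @isMeasurableFun.Build _ _ _ _ idTR (@measurable_id _ _ setT).

(** The distribution function of the normal law. *)
Lemma gauss_primitive : exists Psi : R -> R,
  [/\ forall x : R, is_derive x 1 Psi (gauss x), Psi x @[x --> +oo%R] --> (1 : R) &
      Psi x @[x --> -oo%R] --> (0 : R)].
Proof.
have s0 : sigma != 0 by rewrite gt_eqF // sqrtr_gt0.
pose Psi (x : R) : R :=
  (\int[lebesgue_measure]_(t in `]-oo, x]) normal_pdf 0 sigma t)%R.
have E x : (Psi x)%:E = cdf (idTR : {RV (normal_prob 0 sigma) >-> R}) x.
  rewrite /Psi /Rintegral fineK //.
  apply: integrable_fin_num => //.
  apply: (integrableS _ _ (subsetT _)) => //; exact: integrable_normal_pdf.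
exists Psi; split.
- move=> x; rewrite gauss_normal_pdf.
  have [] := @continuous_FTC1 R (normal_pdf 0 sigma) -oo%O x (x + 1).
  + by rewrite ltrDl.
  + apply: (integrableS _ _ (subsetT _)) => //; exact: integrable_normal_pdf.
  + by rewrite ltNyr.
  + exact: continuous_normal_pdf.
  + move=> h1 h2; split; first exact: h1.
    by rewrite -derive1E h2.
- have := @cvg_cdfy1 _ _ R (normal_prob 0 sigma) idTR.
  by under eq_cvg do rewrite -E; move/fine_cvgP => [_].
- have := @cvg_cdfNy0 _ _ R (normal_prob 0 sigma) idTR.
  by under eq_cvg do rewrite -E; move/fine_cvgP => [_].
Qed.
End Gaussian.

Section LatticeSums.
Context {R : realType}.

Lemma mean_value (f df : R -> R) (a b : R) : a <= b ->
  (forall x : R, is_derive x 1 f (df x)) ->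
  exists2 c, a <= c <= b & f b - f a = df c * (b - a).
Proof.
move=> ab hf.
have ct : {within `[a, b], continuous f}.
  by apply: derivable_within_continuous => x _; case: (hf x).
by have [c] := MVT_segment ab (fun x _ => hf x) ct; rewrite in_itv /=; exists c.
Qed.

Lemma mean_value_norm (f df : R -> R) (a b B : R) :
  (forall x : R, is_derive x 1 f (df x)) ->
  (forall x, `|x - a| <= `|b - a| -> `|df x| <= B) ->
  `|f b - f a| <= B * `|b - a|.
Proof.
move=> hf hB; have [ab|/ltW ba] := leP a b.
  have [c /andP[ac cb] ->] := mean_value ab hf; rewrite normrM ler_wpM2r // hB //.
  by rewrite !ger0_norm ?subr_ge0 // lerD2r.
have [c /andP[bc ca]] := mean_value ba hf; rewrite distrC => ->.
rewrite normrM [`|a - b|]distrC ler_wpM2r // hB //.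
by rewrite !ler0_norm ?subr_le0 // lerN2 lerD2r.
Qed.

(** Since [C * atan] is bounded, the increments of [g] over any number of
    consecutive intervals add up to at most [C * pi]. This is what makes the
    lattice sums below comparable with integrals uniformly in their length. *)
Lemma increment_le_atan (g dg : R -> R) (C a b : R) : a <= b ->
  (forall x : R, is_derive x 1 g (dg x)) ->
  (forall x, `|dg x| <= C / (1 + x ^+ 2)) ->
  `|g b - g a| <= C * (atan b - atan a).
Proof.
move=> ab hg hC; rewrite ler_norml; apply/andP; split.
- have H (x : R) : is_derive x 1 (fun x => - g x + - (C * atan x))
      (- dg x + - (C * (1 + x ^+ 2)^-1)).
    exact (is_derive_add (is_derive_opp (hg x))
      (is_derive_opp (is_derive_scale C (is_derive1_atan x)))).
  have := is_derive_nonincreasing ab H; rewrite mulrBr.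
  have H2 x : a < x < b -> - dg x + - (C * (1 + x ^+ 2)^-1) <= 0.
    by move=> _; have := hC x; rewrite ler_norml => /andP[]; lra.
  by move=> /(_ H2); lra.
- have H (x : R) : is_derive x 1 (fun x => g x + - (C * atan x))
      (dg x + - (C * (1 + x ^+ 2)^-1)).
    exact (is_derive_add (hg x)
      (is_derive_opp (is_derive_scale C (is_derive1_atan x)))).
  have := is_derive_nonincreasing ab H; rewrite mulrBr.
  have H2 x : a < x < b -> dg x + - (C * (1 + x ^+ 2)^-1) <= 0.
    by move=> _; have := hC x; rewrite ler_norml => /andP[]; lra.
  by move=> /(_ H2); lra.
Qed.

Lemma atan_increment_le_pi (a b : R) : atan b - atan a <= pi.
Proof. by have := atan_ltpi2 b; have := atan_gtNpi2 a; lra. Qed.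

(** On one cell the error is at most [h] times the oscillation of [u], and by
    comparison with [C * atan] the oscillations telescope. *)
Lemma riemann_sum_error (w u du : R -> R) (C a h : R) (M : nat) : 0 <= h ->
  (forall x : R, is_derive x 1 w (u x)) ->
  (forall x : R, is_derive x 1 u (du x)) ->
  (forall x, `|du x| <= C / (1 + x ^+ 2)) ->
  `|h * \sum_(n < M) u (a + n%:R * h) - (w (a + M%:R * h) - w a)| <=
  C * pi * h.
Proof.
move=> h0 hw hu hC.
have C0 : 0 <= C.
  by have := le_trans (normr_ge0 _) (hC 0); rewrite expr0n addr0 divr1.
have step n : `|h * u (a + n%:R * h) -
    (w (a + n.+1%:R * h) - w (a + n%:R * h))| <=
    h * (C * (atan (a + n.+1%:R * h) - atan (a + n%:R * h))).
  have le1 : a + n%:R * h <= a + n.+1%:R * h by rewrite -natr1; lra.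
  have [c /andP[c1 c2] ->] := mean_value le1 hw.
  have -> : a + n.+1%:R * h - (a + n%:R * h) = h by rewrite -natr1; ring.
  rewrite [u c * h]mulrC -mulrBr normrM ger0_norm // ler_wpM2l // distrC.
  apply: (le_trans (increment_le_atan c1 hu hC)); rewrite ler_wpM2l // lerD2r.
  exact: le_atan.
have tele (f : R -> R) : f (a + M%:R * h) - f a =
    \sum_(n < M) (f (a + n.+1%:R * h) - f (a + n%:R * h)).
  elim: M => [|m IH]; first by rewrite big_ord0 mul0r addr0 subrr.
  by rewrite big_ord_recr /= -IH; ring.
rewrite (tele w) mulr_sumr -sumrB.
apply: (le_trans (ler_norm_sum _ _ _)).
apply: (@le_trans _ _ (\sum_(n < M)
    h * (C * (atan (a + n.+1%:R * h) - atan (a + n%:R * h))))).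
  by apply: ler_sum => n _; exact: step.
rewrite -mulr_sumr -mulr_sumr -(tele atan) [leRHS]mulrC ler_wpM2l //.
by rewrite ler_wpM2l // atan_increment_le_pi.
Qed.

Variable tau : R.
Hypothesis tau_gt0 : 0 < tau.
Local Notation gauss := (gauss tau).

Let tau0 : tau != 0. Proof. by rewrite gt_eqF. Qed.

Lemma gauss_ge0 x : 0 <= gauss x.
Proof. by rewrite mulr_ge0 ?expR_ge0 // invr_ge0 sqrtr_ge0. Qed.

Lemma gaussN x : gauss (- x) = gauss x.
Proof. by rewrite /gauss sqrrN. Qed.

Lemma is_derive_gauss (x : R) : is_derive x 1 gauss (- (x / tau) * gauss x).
Proof.
have h1 := is_derive_mul (is_derive_var x) (is_derive_var x).
have h2 := is_derive_scale (- (2 * tau)^-1) h1.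
have := is_derive_scale (Num.sqrt (2 * pi * tau))^-1 (is_derive_expR_comp h2).
rewrite (_ : (fun t => _) = gauss); last first.
  by apply/funext => t; rewrite /gauss; congr (_ * expR _); rewrite -expr2; ring.
move=> h; apply: is_derive_eq h _; rewrite /gauss.
have -> : - (2 * tau)^-1 * (x * x) = - x ^+ 2 / (2 * tau) by rewrite expr2; ring.
have : Num.sqrt (2 * pi * tau) != 0.
  by rewrite gt_eqF // sqrtr_gt0 !mulr_gt0 ?pi_gt0.
by move=> s0; field; rewrite s0 tau0.
Qed.

Lemma gauss_decay : exists2 C, 0 < C &
  forall x, (1 + x ^+ 2) ^+ 2 * gauss x <= C.
Proof.
have g0 : 0 < (Num.sqrt (2 * pi * tau))^-1.
  by rewrite invr_gt0 sqrtr_gt0 !mulr_gt0 ?pi_gt0.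
exists ((Num.sqrt (2 * pi * tau))^-1 * (1 + 4 * tau) ^+ 2).
  by rewrite mulr_gt0 // exprn_gt0 // addr_gt0 // mulr_gt0.
move=> x; rewrite /gauss mulrCA ler_wpM2l ?(ltW g0) //.
(* With this [y] the exponential is [expR (- y) ^+ 2], and [1 + y <= expR y]. *)
pose y := x ^+ 2 / (4 * tau).
have y0 : 0 <= y by rewrite divr_ge0 ?sqr_ge0 // ltW // mulr_gt0.
have -> : expR (- x ^+ 2 / (2 * tau)) = expR (- y) ^+ 2.
  by rewrite -expRM_natl; congr expR; rewrite /y; field.
rewrite -exprMn ler_sqr ?nnegrE ?mulr_ge0 ?expR_ge0 ?addr_ge0 ?sqr_ge0 //;
  last by rewrite mulr_ge0 // ltW.
rewrite expRN ler_pdivrMr ?expR_gt0 //.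
have -> : x ^+ 2 = 4 * tau * y by rewrite /y; field.
apply: (@le_trans _ _ ((1 + 4 * tau) * (1 + y))).
  rewrite -subr_ge0 (_ : _ - _ = y + 4 * tau); last by ring.
  by rewrite addr_ge0 // mulr_ge0 // ltW.
by rewrite ler_wpM2l ?expR_ge1Dx // addr_ge0 // mulr_ge0 // ltW.
Qed.

(** The product of the Gaussian with a sine and its first two derivatives in
    [x]; [dgsin] is also, up to a factor, the derivative in [xi] that appears in
    [lattice_sum_cos]. *)
Definition gsin xi x := gauss x * sin (xi * x).
Definition dgsin xi x := gauss x * (xi * cos (xi * x) - x / tau * sin (xi * x)).
Definition ddgsin xi x := gauss x *
  ((x ^+ 2 / tau ^+ 2 - tau^-1 - xi ^+ 2) * sin (xi * x) -
   2 * xi * x / tau * cos (xi * x)).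

Let is_derive_sin_scale xi (x : R) :
  is_derive x 1 (fun x => sin (xi * x)) (xi * cos (xi * x)).
Proof.
have h := @is_derive1_comp _ sin (fun x => xi * x) x _ _
  (is_derive_sin (xi * x)) (is_derive_scale xi (is_derive_var x)).
by apply: is_derive_eq h _; rewrite /GRing.scale /=; ring.
Qed.

Let is_derive_cos_scale xi (x : R) :
  is_derive x 1 (fun x => cos (xi * x)) (- (xi * sin (xi * x))).
Proof.
have h := @is_derive1_comp _ cos (fun x => xi * x) x _ _
  (is_derive_cos (xi * x)) (is_derive_scale xi (is_derive_var x)).
by apply: is_derive_eq h _; rewrite /GRing.scale /=; ring.
Qed.

Lemma is_derive_gsin xi (x : R) : is_derive x 1 (gsin xi) (dgsin xi x).
Proof.
apply: is_derive_eq (is_derive_mul (is_derive_gauss x) (is_derive_sin_scale xi x)) _.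
by rewrite /dgsin; ring.
Qed.

Lemma is_derive_dgsin xi (x : R) : is_derive x 1 (dgsin xi) (ddgsin xi x).
Proof.
have h1 := is_derive_scale xi (is_derive_cos_scale xi x).
have h2 := is_derive_mul (is_derive_scale tau^-1 (is_derive_var x))
  (is_derive_sin_scale xi x).
have h := is_derive_mul (is_derive_gauss x) (is_derive_add h1 (is_derive_opp h2)).
rewrite (_ : dgsin xi = (fun t => gauss t *
   (xi * cos (xi * t) + - (tau^-1 * t * sin (xi * t))))); last first.
  by apply/funext => t; rewrite /dgsin [t / tau]mulrC.
apply: is_derive_eq h _.
by rewrite /ddgsin; field.
Qed.

End LatticeSums.

Section LatticeFourier.
Context {R : realType}.
Variable tau : R.
Hypothesis tau_gt0 : 0 < tau.
Local Notation gauss := (gauss tau).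

Let tau0 : tau != 0. Proof. by rewrite gt_eqF. Qed.

Lemma gauss_bounds : exists2 C, 0 < C & forall x,
  gauss x <= C / (1 + x ^+ 2) /\ `|- (x / tau) * gauss x| <= C / (1 + x ^+ 2).
Proof.
have [C C0 hC] := gauss_decay tau_gt0.
exists (C * (1 + tau^-1)); first by rewrite mulr_gt0 // addr_gt0 // invr_gt0.
have ti : 0 <= tau^-1 by rewrite invr_ge0 ltW.
move=> x; have x1 : 1 <= 1 + x ^+ 2 by rewrite lerDl sqr_ge0.
have xp : 0 < 1 + x ^+ 2 by rewrite (lt_le_trans _ x1).
have g0 := gauss_ge0 tau x.
have h1 : gauss x * (1 + x ^+ 2) <= C.
  apply: le_trans (hC x); rewrite mulrC expr2 -mulrA ler_peMl //.
  by rewrite mulr_ge0 // ltW.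
split; rewrite ler_pdivlMr //.
  by apply: (le_trans h1); rewrite ler_peMr ?(ltW C0) // lerDl.
rewrite normrM normrN normrM [`|gauss x|]ger0_norm // [`|tau^-1|]ger0_norm //.
have xx : `|x| <= 1 + x ^+ 2.
  by rewrite -[x ^+ 2]real_normK ?num_real //; have := sqr_ge0 (`|x| - 1); nra.
apply: (@le_trans _ _ ((1 + x ^+ 2) / tau * gauss x * (1 + x ^+ 2))).
  by rewrite !ler_wpM2r // ltW.
apply: (@le_trans _ _ (C * tau^-1)); last first.
  by rewrite ler_wpM2l ?(ltW C0) // lerDr.
have -> : (1 + x ^+ 2) / tau * gauss x * (1 + x ^+ 2) =
  (1 + x ^+ 2) ^+ 2 * gauss x * tau^-1 by ring.
by rewrite ler_wpM2r.
Qed.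

Lemma ddgsin_bound (Xi : R) : 0 <= Xi -> exists2 C, 0 <= C &
  forall xi x, `|xi| <= Xi -> `|ddgsin tau xi x| <= C / (1 + x ^+ 2).
Proof.
move=> Xi0; have [C C0 hC] := gauss_decay tau_gt0.
pose D := tau^-1 ^+ 2 + tau^-1 + Xi ^+ 2 + 2 * Xi / tau.
have ti : 0 <= tau^-1 by rewrite invr_ge0 ltW.
have D0 : 0 <= D by rewrite !addr_ge0 ?exprn_ge0 ?mulr_ge0.
exists (C * D); first by rewrite mulr_ge0 // ltW.
move=> xi x hxi; have x1 : 1 <= 1 + x ^+ 2 by rewrite lerDl sqr_ge0.
have xp : 0 < 1 + x ^+ 2 by rewrite (lt_le_trans _ x1).
have g0 := gauss_ge0 tau x.
have xx : `|x| <= 1 + x ^+ 2.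
  by rewrite -[x ^+ 2]real_normK ?num_real //; have := sqr_ge0 (`|x| - 1); nra.
rewrite /ddgsin normrM ger0_norm // ler_pdivlMr //.
set P := (X in `|X|).
have PD : `|P| <= D * (1 + x ^+ 2).
  have xi2 : xi ^+ 2 <= Xi ^+ 2.
    by rewrite -[xi ^+ 2]real_normK ?num_real // ler_sqr ?nnegrE // (le_trans _ hxi).
  have a1 : `|(x ^+ 2 / tau ^+ 2 - tau^-1 - xi ^+ 2) * sin (xi * x)| <=
      (x ^+ 2) * tau^-1 ^+ 2 + tau^-1 + Xi ^+ 2.
    rewrite normrM -[leRHS]mulr1 ler_pM // ?sin_max //.
    apply: (le_trans (ler_normB _ _)); apply: lerD; last by rewrite ger0_norm ?sqr_ge0.
    apply: (le_trans (ler_normB _ _)); apply: lerD; last by rewrite ger0_norm.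
    by rewrite ger0_norm -?exprVn // mulr_ge0 ?sqr_ge0 // invr_ge0 sqr_ge0.
  have a2 : `|2 * xi * x / tau * cos (xi * x)| <= 2 * Xi / tau * (1 + x ^+ 2).
    rewrite normrM -[leRHS]mulr1 ler_pM // ?cos_max //.
    rewrite !normrM [`|tau^-1|]ger0_norm // normr_nat [leLHS]mulrAC.
    by apply: ler_pM; rewrite ?mulr_ge0 // ler_wpM2r // ler_wpM2l.
  apply: (le_trans (ler_normB _ _)); apply: (le_trans (lerD a1 a2)).
  rewrite -subr_ge0 (_ : _ - _ = tau^-1 ^+ 2 + tau^-1 * x ^+ 2 + Xi ^+ 2 * x ^+ 2).
    by rewrite !addr_ge0 ?sqr_ge0 // mulr_ge0 ?sqr_ge0.
  by rewrite /D; ring.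
apply: (@le_trans _ _ (gauss x * (D * (1 + x ^+ 2)) * (1 + x ^+ 2))).
  by rewrite ler_wpM2r ?ler_wpM2l // ltW.
have -> : gauss x * (D * (1 + x ^+ 2)) * (1 + x ^+ 2) =
  (1 + x ^+ 2) ^+ 2 * gauss x * D by ring.
by rewrite ler_wpM2r.
Qed.

Definition lattice_sum (h a : R) (M : nat) (f : R -> R) : R :=
  h * \sum_(n < M) f (a + n%:R * h).

(** The function [exp(tau xi^2 / 2 - x^2 / (2 tau)) cos(xi x)] is the real part
    of an entire function on a horizontal line, so its derivative in [xi] is an
    [x]-derivative, and the lattice sum of an [x]-derivative consists of boundary
    terms and an error of the size of the mesh. Integrating over [xi] compares
    the frequency [Xi] with the frequency 0, without Poisson summation. *)
Lemma lattice_sum_cos (Xi : R) : 0 <= Xi -> exists2 C, 0 <= C &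
  forall (h a : R) M, 0 <= h ->
  `|expR (tau / 2 * Xi ^+ 2) *
       lattice_sum h a M (fun x => gauss x * cos (Xi * x)) -
    lattice_sum h a M gauss| <= C * (h + gauss a + gauss (a + M%:R * h)).
Proof.
move=> Xi0; have [C C0 hC] := ddgsin_bound Xi0.
have pi0 := @pi_ge0 R.
pose E := tau * expR (tau / 2 * Xi ^+ 2) * (C * pi + 1).
have E0 : 0 <= tau * expR (tau / 2 * Xi ^+ 2).
  by rewrite mulr_ge0 ?expR_ge0 // ltW.
exists (E * Xi); first by rewrite !mulr_ge0 ?addr_ge0 ?mulr_ge0 ?expR_ge0 // ltW.
move=> h a M h0.
pose U xi := expR (tau / 2 * xi ^+ 2) *
  lattice_sum h a M (fun x => gauss x * cos (xi * x)).
pose dU xi := tau * expR (tau / 2 * xi ^+ 2) * lattice_sum h a M (dgsin tau xi).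
have hU (xi : R) : is_derive xi 1 U (dU xi).
  have h1 := is_derive_expR_comp (is_derive_scale (tau / 2)
    (is_derive_mul (is_derive_var xi) (is_derive_var xi))).
  have h2 (n : 'I_M) : is_derive xi 1
      (fun xi => gauss (a + n%:R * h) * cos (xi * (a + n%:R * h)))
      (gauss (a + n%:R * h) *
        - ((a + n%:R * h) * sin (xi * (a + n%:R * h)))).
    apply: is_derive_scale; set x := a + _.
    have := @is_derive1_comp _ cos (fun y => x * y) xi _ _
      (is_derive_cos (x * xi)) (is_derive_scale x (is_derive_var xi)).
    rewrite (_ : _ \o _ = fun y => cos (y * x)); last first.
      by apply/funext => y /=; rewrite mulrC.
    by move=> H; apply: is_derive_eq H _; rewrite /GRing.scale /= [xi * x]mulrC; ring.
  have h3 := is_derive_mul h1 (is_derive_scale h (is_derive_bigsum (index_enum _) h2)).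
  rewrite (_ : U = fun t => expR (tau / 2 * (t * t)) *
    (h * \sum_(n < M) gauss (a + n%:R * h) * cos (t * (a + n%:R * h)))); last first.
    by apply/funext.
  apply: is_derive_eq h3 _; rewrite /dU -expr2.
  rewrite /lattice_sum /dgsin -!mulrA !mulr_sumr -big_split /=.
  by apply: eq_bigr => n _; field.
have hB xi : `|xi - 0| <= `|Xi - 0| ->
    `|dU xi| <= E * (h + gauss a + gauss (a + M%:R * h)).
  rewrite !subr0 [X in _ <= X]ger0_norm // => hxi.
  rewrite /dU normrM /E -[leRHS]mulrA ler_pM // ?normr_ge0 //.
    rewrite ger0_norm ?mulr_ge0 ?expR_ge0 ?(ltW tau_gt0) //.
    rewrite ler_wpM2l ?(ltW tau_gt0) // ler_expR ler_wpM2l //.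
      by rewrite divr_ge0 // ltW.
    by rewrite -[xi ^+ 2]real_normK ?num_real // ler_sqr ?nnegrE.
  have := riemann_sum_error a M h0 (is_derive_gsin tau_gt0 xi)
    (is_derive_dgsin tau_gt0 xi) (fun x => hC xi x hxi).
  rewrite -/(lattice_sum h a M (dgsin tau xi)).
  set S := lattice_sum _ _ _ _ => hS.
  have gs x : `|gsin tau xi x| <= gauss x.
    rewrite /gsin normrM ger0_norm ?gauss_ge0 // ler_piMr ?gauss_ge0 //.
    exact: sin_max.
  have g1 := gs a; have g2 := gs (a + M%:R * h).
  have g3 := gauss_ge0 tau a; have g4 := gauss_ge0 tau (a + M%:R * h).
  move: hS g1 g2 g3 g4; set A := gsin _ _ _; set B := gsin _ _ _.
  set u := gauss _; set v := gauss _ => hS g1 g2 g3 g4.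
  have : `|S| <= C * pi * h + u + v.
    apply: (@le_trans _ _ (`|S - (A - B)| + `|B| + `|A|)); last lra.
    apply: (@le_trans _ _ (`|S - (A - B) - B| + `|A|)).
      rewrite [X in `|X| <= _](_ : S = S - (A - B) - B + A); last by ring.
      exact: ler_normD.
    by rewrite lerD2r ler_normB.
  move/le_trans; apply.
  rewrite -subr_ge0 (_ : _ - _ = h + C * pi * u + C * pi * v); last by ring.
  by rewrite !addr_ge0 ?mulr_ge0.
have := mean_value_norm hU hB; rewrite /U subr0 [`|Xi|]ger0_norm //.
rewrite expr0n mulr0 expR0 mul1r.
rewrite (_ : lattice_sum h a M (fun x => gauss x * cos (0 * x)) =
  lattice_sum h a M gauss); last first.
  by rewrite /lattice_sum; congr (_ * _); apply: eq_bigr => n _;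
    rewrite mul0r cos0 mulr1.
by rewrite [E * _ * Xi]mulrAC.
Qed.

Lemma lattice_sum_gauss (Psi : R -> R) :
  (forall x : R, is_derive x 1 Psi (gauss x)) -> exists2 C, 0 <= C &
  forall (h a : R) M, 0 <= h ->
    `|lattice_sum h a M gauss - (Psi (a + M%:R * h) - Psi a)| <= C * h.
Proof.
move=> hPsi; have [C C0 hC] := gauss_bounds.
exists (C * pi); first by rewrite mulr_ge0 ?pi_ge0 // ltW.
move=> h a M h0.
exact: (riemann_sum_error a M h0 hPsi (is_derive_gauss tau_gt0) (fun x => (hC x).2)).
Qed.

End LatticeFourier.

(** * Fourier coefficients of the periodized Gaussian *)

Section PeriodizedGaussian.
Context {R : realType}.

(* The first [2 L] values are the integers from [- L] to [L - 1]. *)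
Let zigzag (n : nat) : int := if odd n then Negz n./2 else Posz n./2.

Let zigzag_bij : set_bij [set: nat] [set: int] zigzag.
Proof.
split=> //.
- move=> m n _ _; rewrite /zigzag => H.
  suff [oE hE] : odd m = odd n /\ m./2 = n./2.
    by rewrite -(odd_double_half m) -(odd_double_half n) oE hE.
  by move: H; case: (odd m); case: (odd n) => // -[->].
- move=> [n|n] _ /=; [exists n.*2 | exists n.*2.+1] => //;
  by rewrite /zigzag /= ?odd_double /= ?uphalf_double ?doubleK.
Qed.

(** [phi] is an unordered sum over the integers; for nonnegative terms with
    bounded partial sums it is the limit along the windows from [- L] to
    [L - 1], on which estimates can be made. *)
Lemma esum_int_cvg (f : int -> R) (B : R) : (forall a, 0 <= f a) ->
  (forall L, \sum_(j < L) (f (Posz j) + f (Negz j)) <= B) ->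
  \sum_(j < L) (f (Posz j) + f (Negz j)) @[L --> \oo] -->
    fine (\esum_(a in [set: int]) (f a)%:E).
Proof.
move=> f0 fB.
rewrite (reindex_esum _ _ _ _ zigzag_bij) -nneseries_esumT; last first.
  by move=> n; rewrite lee_fin.
pose u := fun n => (\sum_(0 <= i < n) (f (zigzag i))%:E)%E.
have uE L : u L.*2 = (\sum_(j < L) (f (Posz j) + f (Negz j)))%:E.
  rewrite /u big_mkord sumEFin; congr (_%:E).
  elim: L => [|L IH]; first by rewrite !big_ord0.
  rewrite doubleS 2!big_ord_recr big_ord_recr /= IH /zigzag /= odd_double /=.
  by rewrite doubleK uphalf_double addrA.
have cu : u @ \oo --> (\sum_(i <oo) (f (zigzag i))%:E)%E.
  by apply: is_cvg_nneseries => i _ _; rewrite lee_fin.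
have dbl : (fun L : nat => L.*2) @ \oo --> \oo.
  move=> A [m _ hm]; exists m => // L /= mL; apply: hm => /=.
  by rewrite (leq_trans mL) // -addnn leq_addr.
have := cvg_comp _ _ dbl cu.
have -> : u \o (fun L : nat => L.*2) = EFin \o
    (fun L => \sum_(j < L) (f (Posz j) + f (Negz j))).
  by apply/funext => L; rewrite [LHS]uE.
set l := (\sum_(i <oo) _)%E => cl.
have l0 : (0 <= l)%E by apply: nneseries_ge0 => i _ _; rewrite lee_fin.
have lB : (l <= B%:E)%E.
  rewrite -(cvg_lim _ cl) //; apply: lime_le; first by apply/cvg_ex; exists l.
  by apply: nearW => L /=; rewrite lee_fin; exact: fB.
have lfin : l \is a fin_num by rewrite ge0_fin_numE // (le_lt_trans lB) ?ltry.
by move: cl; rewrite -(fineK lfin) => /fine_cvgP[].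
Qed.

Variable tau : R.
Hypothesis tau_gt0 : 0 < tau.
Local Notation gauss := (gauss tau).

(** The heat kernel of the unit circle. *)
Definition theta (r : R) : R := phi tau r 0.

Lemma phiE r r' : phi tau r r' = theta (r - r').
Proof. by rewrite /theta /phi subr0. Qed.

Let summand r (a : int) : R := gauss (r - a%:~R).

Let thetaE r : theta r = fine (\esum_(a in [set: int]) (summand r a)%:E).
Proof. by rewrite /theta /phi subr0. Qed.

Lemma theta_even r : theta (- r) = theta r.
Proof.
rewrite !thetaE; congr fine.
rewrite (@reindex_esum _ _ _ [set: int] [set: int] -%R (fun a => (summand r a)%:E)).
  apply: eq_esum => a _; rewrite /summand -gaussN; congr (gauss _)%:E.
  by rewrite mulrNz; ring.
by split=> // a _; exists (- a) => //; rewrite opprK.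
Qed.

Lemma theta_periodic r : theta (r + 1) = theta r.
Proof.
rewrite !thetaE; congr fine.
rewrite (@reindex_esum _ _ _ [set: int] [set: int] (fun a => a + 1)
  (fun a => (summand (r + 1) a)%:E)).
  apply: eq_esum => a _; rewrite /summand; congr (gauss _)%:E.
  by rewrite mulrzDr; ring.
split=> //; last by move=> a _; exists (a - 1) => //; rewrite subrK.
by move=> a b _ _; exact: addIr.
Qed.

(* The sum over the integers [a] from [- L] to [L - 1] in increasing order of
   [- a], which runs from [1 - L] to [L]; the factor 1 is a mesh. *)
Let partial_theta (L : nat) r : R :=
  \sum_(j < L.*2) gauss (r + (1 - L%:R) + j%:R * 1).

Let partial_thetaE L r :
  \sum_(j < L) (summand r (Posz j) + summand r (Negz j)) = partial_theta L r.
Proof.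
rewrite /partial_theta.
elim: L => [|L IH]; first by rewrite !big_ord0.
rewrite big_ord_recr /= IH doubleS big_ord_recr big_ord_recl /=.
rewrite [RHS](_ : _ = \sum_(i < L.*2) gauss (r + (1 - L%:R) + i%:R * 1) +
  (gauss (r + (1 - L.+1%:R) + 0 * 1) +
   gauss (r + (1 - L.+1%:R) + L.*2.+1%:R * 1))).
  congr (_ + (_ + _)); rewrite /summand; congr gauss.
    by rewrite -natr1; ring.
  have -> : L.*2.+1%:R = 2 * L%:R + 1 :> R by rewrite -natr1 -mul2n natrM.
  by rewrite NegzE mulrNz -pmulrn -natr1; ring.
rewrite [LHS]addrAC [RHS]addrC; congr (_ + _).
by apply: eq_bigr => i _; congr gauss; rewrite /bump /= add1n -!natr1; ring.
Qed.

Lemma primitive_bounds (Psi : R -> R) :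
  (forall x : R, is_derive x 1 Psi (gauss x)) ->
  Psi x @[x --> +oo%R] --> (1 : R) -> Psi x @[x --> -oo%R] --> (0 : R) ->
  forall a b, Psi b - Psi a <= 1.
Proof.
move=> hPsi P1 P0.
have nd : {homo Psi : x y / x <= y}.
  move=> x y xy; rewrite -lerN2.
  apply: (is_derive_nonincreasing xy (fun z => is_derive_opp (hPsi z))) => z _.
  by rewrite oppr_le0 gauss_ge0.
move=> a b; have : Psi b <= 1.
  apply: (cvgr_to_ge P1).
  by near=> x; apply: nd; near: x; apply: nbhs_pinfty_ge; exact: num_real.
have : 0 <= Psi a; last lra.
apply: (cvgr_to_le P0).
by near=> x; apply: nd; near: x; apply: nbhs_ninfty_le; exact: num_real.
Unshelve. all: by end_near. Qed.

Let partial_theta_bounded : exists B, forall L r, partial_theta L r <= B.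
Proof.
have [Psi [hPsi P1 P0]] := gauss_primitive tau_gt0.
have [C C0 hC] := lattice_sum_gauss tau_gt0 hPsi.
exists (1 + C) => L r.
have := hC 1 (r + (1 - L%:R)) L.*2 ler01; rewrite /lattice_sum mul1r [C * 1]mulr1.
rewrite -/(partial_theta L r) ler_norml => /andP[_].
have := primitive_bounds hPsi P1 P0 (r + (1 - L%:R))
  (r + (1 - L%:R) + L.*2%:R * 1).
by lra.
Qed.

Let partial_theta_cvg r : partial_theta L r @[L --> \oo] --> theta r.
Proof.
have [B hB] := partial_theta_bounded.
have := @esum_int_cvg (summand r) B (fun a => gauss_ge0 tau _).
rewrite -thetaE => H.
rewrite (_ : partial_theta ^~ r = fun L =>
    \sum_(j < L) (summand r (Posz j) + summand r (Negz j))).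
  by apply: H => L; rewrite partial_thetaE.
by apply/funext => L; rewrite partial_thetaE.
Qed.

(** A lattice sum of the Gaussian with mesh 1 differs from its integral, which
    is at most 1, by a bounded amount. *)
Lemma theta_bounded : exists2 B, 0 <= B & forall r, 0 <= theta r <= B.
Proof.
have [B hB] := partial_theta_bounded.
have t0 r L : 0 <= partial_theta L r.
  by rewrite sumr_ge0 // => i _; exact: gauss_ge0.
have H r : 0 <= theta r <= B.
  apply/andP; split.
    apply: (cvgr_to_ge (partial_theta_cvg (r := r))).
    by apply: nearW => L /=.
  apply: (cvgr_to_le (partial_theta_cvg (r := r))).
  by apply: nearW => L /=.
by exists B => //; have /andP[h1 h2] := H 0; exact: le_trans h2.
Qed.

(** Unfolding the period turns the discrete Fourier coefficients of the heat
    kernel into lattice sums of the Gaussian over the line. *)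
Lemma kernel_coef_theta_cvg N k : (0 < N)%N ->
  lattice_sum N%:R^-1 (1 - L%:R) (L.*2 * N)
    (fun x => gauss x * cos (2 * pi * k%:R * x)) @[L --> \oo] -->
  kernel_coef theta N k.
Proof.
move=> N_gt0; have N0 : N%:R != 0 :> R by rewrite pnatr_eq0 -lt0n.
rewrite (_ : (fun L : nat => _) = fun L => N%:R^-1 *
    \sum_(y < N) partial_theta L (y%:R / N%:R) * cos (angle N k y)).
  apply: cvgMr; apply: cvg_big => [|y _]; first exact: add_continuous.
  by apply: cvgMl; exact: partial_theta_cvg.
apply/funext => L; rewrite /lattice_sum; congr (_ * _).
rewrite /partial_theta; under [RHS]eq_bigr do rewrite mulr_suml.
rewrite exchange_big /=.
have blocks (F : nat -> R) M : \sum_(n < M * N) F n =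
    \sum_(i < M) \sum_(y < N) F (i * N + y)%N.
  elim: M => [|M IH]; first by rewrite mul0n !big_ord0.
  rewrite big_ord_recr /= -IH mulSnr big_split_ord /=.
  by congr (_ + _).
rewrite (blocks (fun n => gauss (1 - L%:R + n%:R * N%:R^-1) *
  cos (2 * pi * k%:R * (1 - L%:R + n%:R * N%:R^-1)))).
apply: eq_bigr => i _; apply: eq_bigr => y _.
have E : 1 - L%:R + (i * N + y)%:R * N%:R^-1 =
    y%:R / N%:R + (1 - L%:R) + i%:R * 1 :> R.
  by rewrite natrD natrM; field.
rewrite E; congr (_ * _).
have -> : 2 * pi * k%:R * (y%:R / N%:R + (1 - L%:R) + i%:R * 1) =
    angle N k y + 2 * pi * (k * i.+1)%:R - 2 * pi * (k * L)%:R :> R.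
  by rewrite /angle !natrM -natr1; ring.
rewrite cosB !cos_2pi_nat sin_2pi_nat cosD !cos_2pi_nat sin_2pi_nat.
by ring.
Qed.

End PeriodizedGaussian.

Section HeatKernelCoefficients.
Context {R : realType}.
Variable tau : R.
Hypothesis tau_gt0 : 0 < tau.
Local Notation gauss := (gauss tau).
Local Notation theta := (theta tau).

Let gauss_endpoint_cvg C : gauss (1 - L%:R) * C + gauss (1 + L%:R) * C
  @[L --> \oo] --> (0 : R).
Proof.
have [B B0 hB] := gauss_bounds tau_gt0.
have hL L : gauss (1 - L%:R) <= B * 4 * harmonic L /\ gauss (1 + L%:R) <= B * 4 * harmonic L.
  have L0 : 0 <= L%:R :> R by [].
  have Lp : 0 < L.+1%:R :> R by [].
  split; apply: (le_trans (hB _).1); rewrite -mulrA ler_wpM2l ?(ltW B0) //=;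
  (have xp x : 0 < 1 + x ^+ 2 :> R by rewrite ltr_pwDl ?sqr_ge0);
  rewrite -[_^-1]mul1r ler_pdivrMr ?xp // mulrAC ler_pdivlMr // mul1r -natr1.
    (* Completing the square in [4 (1 + (1 - L)^2) - (L + 1)]. *)
    rewrite -subr_ge0 (_ : _ - _ = (2 * L%:R - 9 / 4) ^+ 2 + 31 / 16); last by field.
    by rewrite addr_ge0 ?sqr_ge0.
  rewrite -subr_ge0 (_ : _ - _ = 4 * L%:R ^+ 2 + 7 * L%:R + 7); last by ring.
  by rewrite !addr_ge0 ?mulr_ge0 ?sqr_ge0.
have c0 : B * 4 * harmonic L @[L --> \oo] --> (0 : R).
  by rewrite -[X in _ --> X](mulr0 (B * 4)); apply: cvgMr; exact: cvg_harmonic.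
have g1 : gauss (1 - L%:R) @[L --> \oo] --> (0 : R).
  apply: (@squeeze_cvgr _ _ _ _ (cst 0) (fun L => B * 4 * harmonic L)) => //.
    by apply: nearW => L; rewrite gauss_ge0 (hL L).1.
  exact: cvg_cst.
have g2 : gauss (1 + L%:R) @[L --> \oo] --> (0 : R).
  apply: (@squeeze_cvgr _ _ _ _ (cst 0) (fun L => B * 4 * harmonic L)) => //.
    by apply: nearW => L; rewrite gauss_ge0 (hL L).2.
  exact: cvg_cst.
rewrite -[X in _ --> X](addr0 0) -[X in _ --> X + _](mul0r C).
by rewrite -[X in _ --> _ + X](mul0r C); apply: cvgD; apply: cvgMl.
Qed.

(** By [lattice_sum_cos] the coefficient times [E = exp(tau Xi^2 / 2)] is close
    to the total mass of the Gaussian, and [E^-1] is the limit. The rate matters: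
    an error of order [1 / N] in the drift of a bounded mode contributes to its
    second moment no more than the noise does, even over times of order
    [ln N]. *)
Lemma kernel_coef_theta_error (k : nat) : exists2 C, 0 <= C &
  forall N, (0 < N)%N ->
  `|kernel_coef theta N k - expR (- (2 * pi ^+ 2 * tau * k%:R ^+ 2))| <= C / N%:R.
Proof.
have Xi0 : 0 <= 2 * pi * k%:R :> R by rewrite !mulr_ge0 ?pi_ge0.
have [Psi [hPsi P1 P0]] := gauss_primitive tau_gt0.
have [C1 C10 hC1] := lattice_sum_cos tau_gt0 Xi0.
have [C2 C20 hC2] := lattice_sum_gauss tau_gt0 hPsi.
exists (C1 + C2) => [|N N_gt0]; first exact: addr_ge0.
have N0 : N%:R != 0 :> R by rewrite pnatr_eq0 -lt0n.
set E := expR (tau / 2 * (2 * pi * k%:R) ^+ 2) in hC1.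
have E1 : 1 <= E.
  by rewrite -expR0 ler_expR mulr_ge0 ?sqr_ge0 // divr_ge0 // ltW.
have -> : expR (- (2 * pi ^+ 2 * tau * k%:R ^+ 2)) = E^-1.
  by rewrite -expRN; congr expR; field.
set c := kernel_coef _ _ _.
pose S L := lattice_sum N%:R^-1 (1 - L%:R) (L.*2 * N)
  (fun x => gauss x * cos (2 * pi * k%:R * x)).
have Sc : S L @[L --> \oo] --> c by exact: kernel_coef_theta_cvg.
have endE L : 1 - L%:R + (L.*2 * N)%:R * N%:R^-1 = 1 + L%:R :> R.
  by rewrite natrM mulfK // -mul2n natrM; ring.
pose err L := (C1 + C2) / N%:R + (gauss (1 - L%:R) * C1 + gauss (1 + L%:R) * C1) +
  `|Psi (1 + L%:R) - Psi (1 - L%:R) - 1|.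
have hS L : `|E * S L - 1| <= err L.
  have h0 : 0 <= N%:R^-1 :> R by [].
  have := hC1 _ (1 - L%:R) (L.*2 * N)%N h0; rewrite endE -/(S L) => a1.
  have := hC2 _ (1 - L%:R) (L.*2 * N)%N h0; rewrite endE => a2.
  move: a1 a2; rewrite /err; set T := lattice_sum _ _ _ _.
  set p := Psi _ - Psi _ => a1 a2.
  rewrite (_ : E * S L - 1 = (E * S L - T) + (T - p) + (p - 1)); last by ring.
  apply: (le_trans (ler_normD _ _)); rewrite lerD2r.
  apply: (le_trans (ler_normD _ _)); apply: (le_trans (lerD a1 a2)).
  by rewrite le_eqVlt; apply/orP; left; apply/eqP; ring.
have toy : (1 + L%:R : R) @[L --> \oo] --> +oo%R.
  apply/cvgryPge => A; near=> L.
  apply: (@le_trans _ _ (L%:R)); last by rewrite lerDr.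
  by near: L; apply: nbhs_infty_ger.
have toNy : (1 - L%:R : R) @[L --> \oo] --> -oo%R.
  apply/cvgrNyPle => A; near=> L.
  rewrite lerBlDr -lerBlDl.
  by near: L; apply: nbhs_infty_ger.
have err_cvg : err L @[L --> \oo] --> (C1 + C2) / N%:R.
  rewrite -[X in _ --> X]addr0; apply: cvgD.
    rewrite -[X in _ --> X]addr0; apply: cvgD; first exact: cvg_cst.
    exact: gauss_endpoint_cvg.
  rewrite -(normr0 R) -(subrr 1) -[X in `|X - _|](subr0 1).
  apply: cvg_norm; apply: cvgB; last exact: cvg_cst.
  by apply: cvgB; [exact: (cvg_comp _ _ toy P1)|exact: (cvg_comp _ _ toNy P0)].
have Ec : `|E * c - 1| <= (C1 + C2) / N%:R.
  have ES : `|E * S L - 1| @[L --> \oo] --> `|E * c - 1|.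
    by apply: cvg_norm; apply: cvgB; [exact: cvgMr|exact: cvg_cst].
  by apply: (ler_cvg_to ES err_cvg); apply: nearW.
have E0 : E != 0 by rewrite gt_eqF // expR_gt0.
rewrite (_ : c - E^-1 = (E * c - 1) * E^-1); last by field.
rewrite normrM -[leRHS]mulr1 ler_pM //.
by rewrite ger0_norm ?invr_ge0 ?expR_ge0 // invf_le1 // expR_gt0.
Unshelve. all: by end_near. Qed.

(** Summation by parts: the Gaussian has bounded variation, and
    [2 sin (xi h / 2) cos (xi x)] is a difference of sines. *)
Let lattice_sum_by_parts : exists2 B, 0 <= B & forall (h a : R) (M : nat) (xi : R), 0 <= h ->
  `|2 * sin (xi * h / 2) * lattice_sum h a M (fun x => gauss x * cos (xi * x))|
    <= B * h.
Proof.
have [C C0 hC] := gauss_bounds tau_gt0.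
exists (C * (2 + pi)) => [|h a M xi h0].
  by rewrite mulr_ge0 ?(ltW C0) // addr_ge0 // pi_ge0.
pose x n : R := a + n%:R * h.
pose b n := sin (xi * x n - xi * h / 2).
have abel : 2 * sin (xi * h / 2) * \sum_(n < M) gauss (x n) * cos (xi * x n) =
    gauss (x M) * b M - gauss (x 0%N) * b 0%N -
    \sum_(n < M) (gauss (x n.+1) - gauss (x n)) * b n.+1.
  elim: (M) => [|m IH]; first by rewrite !big_ord0; ring.
  rewrite !big_ord_recr /= mulrDr IH.
  have : b m.+1 = b m + 2 * sin (xi * h / 2) * cos (xi * x m).
    rewrite /b.
    have -> : xi * x m.+1 - xi * h / 2 = xi * x m + xi * h / 2.
      by rewrite /x -natr1; field.
    by rewrite sinB sinD; ring.
  by move=> ->; ring.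
have b1 n : `|b n| <= 1 by exact: sin_max.
have gC y : gauss y <= C.
  apply: (le_trans (hC y).1); rewrite ler_piMr ?(ltW C0) //.
  by rewrite invf_le1 ?ltr_pwDl ?sqr_ge0 // lerDl sqr_ge0.
have gb n m : `|gauss (x n) * b m| <= C.
  by rewrite normrM ger0_norm ?gauss_ge0 // -[C]mulr1 ler_pM // gauss_ge0.
have step n : `|(gauss (x n.+1) - gauss (x n)) * b n.+1| <=
    C * (atan (x n.+1) - atan (x n)).
  rewrite normrM -[leRHS]mulr1 ler_pM //.
  apply: (increment_le_atan _ (is_derive_gauss tau_gt0) (fun x => (hC x).2)).
  by rewrite /x -natr1; lra.
have tele : \sum_(n < M) C * (atan (x n.+1) - atan (x n)) =
    C * (atan (x M) - atan (x 0%N)).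
  by elim: (M) => [|m IH]; rewrite ?big_ord0 ?big_ord_recr /= ?IH; ring.
rewrite /lattice_sum mulrCA normrM ger0_norm // mulrC ler_wpM2r //.
rewrite -/(x _) abel.
apply: (le_trans (ler_normB _ _)).
apply: (@le_trans _ _ (C + C + C * pi));
  last by rewrite (_ : C * (2 + pi) = C + C + C * pi) //; ring.
apply: lerD; first by apply: (le_trans (ler_normB _ _)); exact: lerD.
apply: (le_trans (ler_norm_sum _ _ _)).
apply: (@le_trans _ _ (\sum_(n < M) C * (atan (x n.+1) - atan (x n)))).
  by apply: ler_sum => n _; exact: step.
by rewrite tele ler_wpM2l ?(ltW C0) // atan_increment_le_pi.
Qed.

Lemma sin_ge_linear : exists2 c : R, 0 < c &
  forall x, 0 <= x <= pi / 2 -> c * x <= sin x.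
Proof.
have c1 := @cos1_gt0 R.
have s1 : 0 < sin 1 :> R by apply: sin2_gt0; rewrite ltr01 ltr1n.
have pil := @pihalf_lt2 R; have pig := @pihalf_ge1 R.
exists (Num.min (cos 1) (sin 1 / 2)); first by rewrite lt_min c1 divr_gt0.
move=> x /andP[x0 xpi]; have [x1|x1] := leP x 1.
  apply: (@le_trans _ _ (cos 1 * x)); first by rewrite ler_wpM2r // ge_min lexx.
  have [y /andP[y0 yx]] := mean_value x0 (@is_derive_sin R).
  rewrite sin0 !subr0 => ->; rewrite ler_wpM2r //.
  have [->//|ne] := eqVneq y 1.
  by apply/ltW; rewrite ltr_cos ?in_itv /=; lra.
apply: (@le_trans _ _ (sin 1 / 2 * x)); first by rewrite ler_wpM2r // ge_min lexx orbT.
apply: (@le_trans _ _ (sin 1)); first by rewrite mulrAC ler_pdivrMr // ler_pM2l //; lra.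
by apply/ltW; rewrite ltr_sin ?in_itv /=; lra.
Qed.

(** In contrast to the error at a fixed frequency, this is uniform in the
    frequency, and it controls all frequencies beyond a threshold at once. The
    factor [sin (pi k / N)] of the summation by parts is small at both ends of
    the range, whence the minimum, the distance from [k] to the multiples of
    [N]. *)
Lemma kernel_coef_theta_decay : exists2 B, 0 <= B & forall N k, (k < N)%N ->
  `|kernel_coef theta N k| * (minn k (N - k))%:R <= B.
Proof.
have [B B0 hB] := lattice_sum_by_parts; have [c c0 hc] := sin_ge_linear.
exists (B / (2 * c * pi)).
  by rewrite divr_ge0 // mulr_ge0 ?pi_ge0 // mulr_ge0 // ltW.
move=> N k kN; have N_gt0 : (0 < N)%N by rewrite (leq_ltn_trans _ kN).
have Np : 0 < N%:R :> R by rewrite ltr0n.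
have N0 : N%:R != 0 :> R by rewrite gt_eqF.
set K := kernel_coef _ _ _; set m := minn _ _.
have pi0 := @pi_gt0 R.
have h1 : `|2 * sin (pi * k%:R / N%:R) * K| <= B / N%:R.
  have E : 2 * pi * k%:R * N%:R^-1 / 2 = pi * k%:R / N%:R :> R by field.
  have cv : `|2 * sin (pi * k%:R / N%:R) * lattice_sum N%:R^-1 (1 - L%:R) (L.*2 * N)
      (fun x => gauss x * cos (2 * pi * k%:R * x))| @[L --> \oo] -->
      `|2 * sin (pi * k%:R / N%:R) * K|.
    by apply: cvg_norm; apply: cvgMr; exact: kernel_coef_theta_cvg.
  apply: (cvgr_to_le cv); apply: nearW => L.
  by rewrite -E; apply: hB; rewrite invr_ge0 ltW.
have sm : sin (pi * k%:R / N%:R) = sin (pi * m%:R / N%:R) :> R.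
  rewrite /m; have [//|_] := leqP k (N - k)%N.
  rewrite natrB ?(ltnW kN) // (_ : pi * (N%:R - k%:R) / N%:R = pi - pi * k%:R / N%:R);
    last by field.
  by rewrite sinB sinpi cospi; ring.
have m2 : m%:R * 2 <= N%:R :> R.
  rewrite -natrM ler_nat muln2 -addnn /m.
  by rewrite (leq_trans (leq_add (geq_minl _ _) (geq_minr _ _))) // subnKC // ltnW.
have hm : c * (pi * m%:R / N%:R) <= sin (pi * m%:R / N%:R).
  apply: hc; rewrite divr_ge0 ?mulr_ge0 ?(ltW pi0) //=.
  by rewrite ler_pdivrMr // mulrAC ler_pdivlMr // -mulrA ler_wpM2l // ltW.
have s0 : (0 : R) <= sin (pi * m%:R / N%:R).
  apply: le_trans hm.
  by rewrite mulr_ge0 ?(ltW c0) // divr_ge0 // mulr_ge0 // ltW.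
move: h1; rewrite sm 2!normrM normr_nat [`|sin _|]ger0_norm // => h1.
rewrite ler_pdivlMr ?mulr_gt0 //.
have : 2 * (c * (pi * m%:R / N%:R)) * `|K| <= B / N%:R.
  apply: le_trans h1.
  by rewrite ler_wpM2r // ler_wpM2l.
rewrite ler_pdivlMr //; apply: le_trans.
by rewrite le_eqVlt; apply/orP; left; apply/eqP; field.
Qed.

End HeatKernelCoefficients.

(** * The hyperbolic tangent *)

Section Tanh.
Context {R : realType}.
Implicit Types x y : R.

Lemma coshR_gt0 x : 0 < coshR x.
Proof. by rewrite divr_gt0 // addr_gt0 // expR_gt0. Qed.

Lemma coshR_neq0 x : coshR x != 0.
Proof. by rewrite gt_eqF // coshR_gt0. Qed.

Lemma tanhRN x : tanhR (- x) = - tanhR x.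
Proof.
rewrite /tanhR; have -> : coshR (- x) = coshR x by rewrite /coshR opprK addrC.
by rewrite -mulNr; congr (_ / _); rewrite /sinhR opprK; ring.
Qed.

Lemma coshR_sqr_sub x : coshR x ^+ 2 - sinhR x ^+ 2 = 1.
Proof.
transitivity (expR x * expR (- x)); first by rewrite /coshR /sinhR; field.
by rewrite -expRD subrr expR0.
Qed.

Lemma one_sub_tanhR_sqr x : 1 - tanhR x ^+ 2 = (coshR x ^+ 2)^-1.
Proof.
have c0 := coshR_neq0 x; apply: (mulIf (expf_neq0 2 c0)).
rewrite mulVf ?expf_neq0 // -[RHS](coshR_sqr_sub x) /tanhR.
by field.
Qed.

Lemma tanhR_lt1 x : tanhR x < 1.
Proof.
rewrite ltr_pdivrMr ?coshR_gt0 // mul1r /sinhR /coshR ltr_pM2r ?invr_gt0 //.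
by have := expR_gt0 (- x); lra.
Qed.

Lemma tanhR_norm_lt1 x : `|tanhR x| < 1.
Proof.
rewrite ltr_norml tanhR_lt1 andbT -subr_gt0 opprK addrC.
by have := tanhR_lt1 (- x); rewrite tanhRN; lra.
Qed.

Lemma tanhR_gt0 x : 0 < x -> 0 < tanhR x.
Proof.
move=> x0; rewrite divr_gt0 ?coshR_gt0 // divr_gt0 // subr_gt0 ltr_expR.
by rewrite (lt_trans _ x0) // oppr_lt0.
Qed.

Lemma is_derive_tanhR x : is_derive x (1 : R) (@tanhR R) (1 - tanhR x ^+ 2).
Proof.
have hN := is_derive_expR_comp (is_derive_opp (is_derive_var x)).
have hE := is_derive_expR_comp (is_derive_var x).
have hs := is_derive_scale (2^-1) (is_derive_add hE (is_derive_opp hN)).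
have hc := is_derive_scale (2^-1) (is_derive_add hE hN).
have c0 : 2^-1 * (expR x + expR (- x)) != 0.
  by rewrite mulrC; exact: coshR_neq0.
have h := is_derive_mul hs (@is_derive_inv _ (fun t => 2^-1 * (expR t + expR (- t))) x _ c0 hc).
rewrite (_ : @tanhR R = (fun t => 2^-1 * (expR t + - expR (- t)) *
    (2^-1 * (expR t + expR (- t)))^-1)); last first.
  by apply/funext => t; rewrite /tanhR /sinhR /coshR; congr (_ / _); exact: mulrC.
apply: is_derive_eq h _; rewrite /tanhR /sinhR /coshR; move: c0.
set u := expR x; set v := expR (- x) => c0.
have uv : u + v != 0 by apply: contraNneq c0 => ->; rewrite mulr0.
by field.
Qed.

Lemma tanhR_nondecreasing x y : x <= y -> tanhR x <= tanhR y.
Proof.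
move=> xy; rewrite -lerN2.
apply: (is_derive_nonincreasing xy (fun z => is_derive_opp (is_derive_tanhR z))) => z _.
by rewrite one_sub_tanhR_sqr oppr_le0 invr_ge0 sqr_ge0.
Qed.

Lemma tanhR_lipschitz x y : `|tanhR x - tanhR y| <= `|x - y|.
Proof.
rewrite -[leRHS]mul1r.
apply: (@mean_value_norm _ (@tanhR R) _ _ _ _ is_derive_tanhR) => z _.
have := tanhR_norm_lt1 z; rewrite ltr_norml => /andP[z1 z2].
by rewrite ger0_norm; nra.
Qed.

(** The derivative [1 - tanhR ^+ 2] moves at most twice as fast as [tanhR],
    which is 1-Lipschitz. *)
Lemma tanhR_taylor (b a : R) :
  `|tanhR (b + a) - tanhR b - a * (1 - tanhR b ^+ 2)| <= 2 * a ^+ 2.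
Proof.
pose f x := tanhR (b + x) + - ((1 - tanhR b ^+ 2) * x).
have hf (x : R) : is_derive x (1 : R) f
    ((1 - tanhR (b + x) ^+ 2) * 1 + - ((1 - tanhR b ^+ 2) * 1)).
  have h1 := is_derive_opp (is_derive_scale (1 - tanhR b ^+ 2) (is_derive_var x)).
  have hs := is_derive_add (is_derive_const b x) (is_derive_var x).
  have h2 := @is_derive1_comp _ (@tanhR R) (fun t => b + t) x _ _
    (is_derive_tanhR (b + x)) hs.
  by apply: is_derive_eq (is_derive_add h2 h1) _; rewrite add0r /GRing.scale /=; ring.
have := @mean_value_norm _ f _ 0 a (2 * `|a|) hf.
rewrite /f addr0 mulr0 oppr0 !addr0 -mulrA -expr2 real_normK ?num_real //.
rewrite (_ : tanhR (b + a) - tanhR b - a * (1 - tanhR b ^+ 2) =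
  tanhR (b + a) + - ((1 - tanhR b ^+ 2) * a) - tanhR b); last by ring.
apply=> x; rewrite addr0 => xa.
have lip := tanhR_lipschitz (b + x) b; rewrite [b + x - b]addrAC subrr add0r in lip.
have h1 := tanhR_norm_lt1 (b + x); have h2 := tanhR_norm_lt1 b.
rewrite (_ : _ + _ = (tanhR b - tanhR (b + x)) * (tanhR b + tanhR (b + x))); last by ring.
rewrite normrM [leRHS]mulrC; apply: ler_pM => //.
  by rewrite distrC; exact: le_trans xa.
by apply: (le_trans (ler_normD _ _)); lra.
Qed.

(** On signs the rate is affine in [s]: in a constant field [y] the mean of a
    spin relaxes linearly towards [tanhR y]. *)
Lemma heat_bath_rate (s y : R) : s = 1 \/ s = -1 ->
  expR (- (s * y)) / (2 * coshR y) = (1 - s * tanhR y) / 2.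
Proof.
have c0 := coshR_neq0 y.
case=> ->; rewrite /tanhR; move: c0; rewrite /sinhR /coshR.
  rewrite mul1r; set u := expR y; set v := expR (- y) => c0.
  have uv : u + v != 0 by apply: contraNneq c0 => ->; rewrite mul0r.
  by field.
rewrite mulN1r opprK; set u := expR y; set v := expR (- y) => c0.
have uv : u + v != 0 by apply: contraNneq c0 => ->; rewrite mul0r.
by field.
Qed.

End Tanh.

(** * The two-population dynamics *)

Section SpinSystem.
Context {R : realType}.
Variables (beta1 beta2 tau1 tau2 lambda : R) (N : nat).
Implicit Types (s : config N) (i : bool) (x : 'I_N) (f : config N -> R).

(** As for [site_spin], the first population is [true]. *)
Definition pop s i : {ffun 'I_N -> bool} := if i then s.1 else s.2.
Definition betaf i : R := if i then beta1 else beta2.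
Definition tauf i : R := if i then tau1 else tau2.
(** The first population imitates the second, which opposes the first. *)
Definition signf i : R := if i then 1 else -1.
Definition couplingf i : R := tanhR (betaf i * lambda).

Definition field s i x : R := Defs.conv (tauf i) (pop s i) x.

Definition local_arg s i x : R :=
  betaf i * field s i x + signf i * (betaf i * lambda) * spin (pop s (~~ i) x).

(** Both rates of the model in the affine form of [heat_bath_rate]. *)
Definition rate s i x : R :=
  (1 - spin (pop s i x) * tanhR (local_arg s i x)) / 2.

Definition flip_at s i x : config N :=
  if i then (flip s.1 x, s.2) else (s.1, flip s.2 x).

Lemma spin_cases b : (spin b : R) = 1 \/ (spin b : R) = - 1.
Proof. by case: b; [left|right]. Qed.

Lemma spin_sqr b : spin b ^+ 2 = 1 :> R.
Proof. by case: b; rewrite /= ?sqrrN expr1n. Qed.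

Lemma spin_negb b : spin (~~ b) = - spin b :> R.
Proof. by case: b; rewrite /= ?opprK. Qed.

Lemma norm_spin b : `|spin b : R| = 1.
Proof. by case: b; rewrite /= ?normrN normr1. Qed.

Lemma rate1E s x : rate1 beta1 tau1 lambda s x = rate s true x.
Proof.
rewrite /rate1 /rate -heat_bath_rate; last exact: spin_cases.
congr (expR _ / (2 * coshR _)); rewrite /local_arg /field /=; ring.
Qed.

Lemma rate2E s x : rate2 beta2 tau2 lambda s x = rate s false x.
Proof.
rewrite /rate2 /rate -heat_bath_rate; last exact: spin_cases.
congr (expR _ / (2 * coshR _)); rewrite /local_arg /field /=; ring.
Qed.

Lemma rate_ge0 s i x : 0 <= rate s i x.
Proof.
rewrite divr_ge0 // subr_ge0 (le_trans (ler_norm _)) // normrM norm_spin mul1r.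
exact/ltW/tanhR_norm_lt1.
Qed.

Lemma rate_le1 s i x : rate s i x <= 1.
Proof.
rewrite ler_pdivrMr // mul1r -lerBrDl lerNl.
have : `|spin (pop s i x) * tanhR (local_arg s i x)| <= 1.
  by rewrite normrM norm_spin mul1r; exact/ltW/tanhR_norm_lt1.
by rewrite ler_norml => /andP[]; lra.
Qed.

(** Jumps are indexed by the flipped spin, not by the target configuration. *)
Definition local_generator f s : R :=
  \sum_(i : bool) \sum_x rate s i x * (f (flip_at s i x) - f s).

Lemma generator_local f s :
  generator (jump_rate beta1 beta2 tau1 tau2 lambda) f s = local_generator f s.
Proof.
have collect (r : 'I_N -> R) (g : 'I_N -> config N) (F : config N -> R) :
    \sum_u (\sum_(x < N | u == g x) r x) * F u = \sum_x r x * F (g x).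
  under eq_bigr do rewrite mulr_suml big_mkcond.
  rewrite exchange_big /=; apply: eq_bigr => x _.
  by rewrite -big_mkcond big_pred1_eq.
rewrite /generator /local_generator big_bool /jump_rate.
under eq_bigr do rewrite mulrDl.
rewrite big_split /= !collect.
by congr (_ + _); apply: eq_bigr => x _; rewrite ?rate1E ?rate2E.
Qed.

Lemma local_generator_sum (I : Type) (r : seq I) (F : I -> config N -> R) s :
  local_generator (fun s => \sum_(j <- r) F j s) s =
  \sum_(j <- r) local_generator (F j) s.
Proof.
rewrite /local_generator [RHS]exchange_big /=; apply: eq_bigr => i _.
rewrite [RHS]exchange_big /=; apply: eq_bigr => x _.
by rewrite -sumrB mulr_sumr.
Qed.

Lemma local_generatorD f g s : local_generator (fun s => f s + g s) s =
  local_generator f s + local_generator g s.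
Proof.
rewrite /local_generator -big_split /=; apply: eq_bigr => i _.
by rewrite -big_split /=; apply: eq_bigr => x _; ring.
Qed.

Lemma local_generatorZ (c : R) f s :
  local_generator (fun s => c * f s) s = c * local_generator f s.
Proof.
rewrite /local_generator mulr_sumr; apply: eq_bigr => i _.
by rewrite mulr_sumr; apply: eq_bigr => x _; ring.
Qed.

Definition carre_du_champ f g s : R := \sum_(i : bool) \sum_x
  rate s i x * ((f (flip_at s i x) - f s) * (g (flip_at s i x) - g s)).

Lemma local_generatorM f g s : local_generator (fun s => f s * g s) s =
  f s * local_generator g s + g s * local_generator f s + carre_du_champ f g s.
Proof.
rewrite /local_generator /carre_du_champ !mulr_sumr -!big_split /=.
apply: eq_bigr => i _; rewrite !mulr_sumr -!big_split /=.
by apply: eq_bigr => x _; ring.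
Qed.

(** * Fourier coefficients of the spins *)

(** Cosine and sine coefficients are treated by the same lemmas, in real form
    so that all estimates take place in an ordered field. *)
Definition trig (b : bool) (y : R) : R := if b then cos y else sin y.

Lemma trig_le1 b y : `|trig b y| <= 1.
Proof. by case: b; [exact: cos_max|exact: sin_max]. Qed.

Definition tcoef (b : bool) (f : 'I_N -> R) (k : nat) : R :=
  N%:R^-1 * \sum_(x < N) f x * trig b (angle N k x).

Definition spin_coef (b i : bool) (k : nat) s : R :=
  tcoef b (fun x => spin (pop s i x)) k.

Lemma eq_tcoef b (f g : 'I_N -> R) k : f =1 g -> tcoef b f k = tcoef b g k.
Proof. by move=> fg; congr (_ * _); apply: eq_bigr => x _; rewrite fg. Qed.

Lemma tcoefD b (f g : 'I_N -> R) k : tcoef b (fun x => f x + g x) k = tcoef b f k + tcoef b g k.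
Proof.
rewrite /tcoef -mulrDr -big_split /=; congr (_ * _).
by apply: eq_bigr => x _; rewrite mulrDl.
Qed.

Lemma tcoefZ b (c : R) (f : 'I_N -> R) k : tcoef b (fun x => c * f x) k = c * tcoef b f k.
Proof.
rewrite /tcoef [RHS]mulrCA; congr (_ * _); rewrite mulr_sumr.
by apply: eq_bigr => x _; rewrite mulrA.
Qed.

Lemma tcoef_le b (f : 'I_N -> R) k : `|tcoef b f k| <= N%:R^-1 * \sum_(x < N) `|f x|.
Proof.
rewrite /tcoef normrM ger0_norm ?invr_ge0 // ler_wpM2l ?invr_ge0 //.
apply: (le_trans (ler_norm_sum _ _ _)); apply: ler_sum => x _.
by rewrite normrM ler_piMr // trig_le1.
Qed.

Lemma spin_coef_le1 b i k s : `|spin_coef b i k s| <= 1.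
Proof.
apply: (le_trans (tcoef_le _ _ _)).
under eq_bigr do rewrite norm_spin.
rewrite sumr_const card_ord -[1 *+ N]/(N%:R).
have [->|N0] := eqVneq N 0%N; first by rewrite mulr0.
by rewrite mulVf // pnatr_eq0.
Qed.

Lemma spin_coef_flip b i j k s x :
  spin_coef b i k (flip_at s j x) - spin_coef b i k s =
  if i == j then - (2 * N%:R^-1 * spin (pop s i x) * trig b (angle N k x)) else 0.
Proof.
rewrite /spin_coef; case: eqVneq => [<-|ij]; last first.
  have -> : pop (flip_at s j x) i = pop s i by move: ij; case: i; case: j.
  exact: subrr.
have popE y : pop (flip_at s i x) i y = if y == x then ~~ pop s i y else pop s i y.
  by case: i; rewrite ffunE.
rewrite /tcoef -mulrBr -sumrB (bigD1 x) //= big1 => [|y yx]; last first.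
  by rewrite popE (negPf yx) subrr.
by rewrite popE eqxx spin_negb; ring.
Qed.

(** A flip changes [s] by [- 2 s], so with the affine rate and [s ^+ 2 = 1] the
    drift of a spin is [tanhR] of its field minus [s]. *)
Lemma local_generator_spin_coef b i k s :
  local_generator (spin_coef b i k) s =
  - spin_coef b i k s + tcoef b (fun x => tanhR (local_arg s i x)) k.
Proof.
rewrite /local_generator (bigD1 i) //= [X in _ + X]big1 ?addr0; last first.
  by move=> j ji; rewrite big1 // => x _; rewrite spin_coef_flip eq_sym (negPf ji) mulr0.
transitivity (\sum_x N%:R^-1 * (- (spin (pop s i x) * trig b (angle N k x)) +
    tanhR (local_arg s i x) * trig b (angle N k x))); last first.
  by rewrite -mulr_sumr big_split /= sumrN mulrDr mulrN.
apply: eq_bigr => x _; rewrite spin_coef_flip eqxx.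
have := spin_sqr (pop s i x); rewrite /rate.
set a := spin _; set t := tanhR _.
set T := trig _ _; set n := N%:R^-1 => aa.
transitivity (n * T * (a ^+ 2 * t - a)); first by field.
by rewrite aa; ring.
Qed.

End SpinSystem.

(** * Quadratic Lyapunov functions for two-dimensional linear systems *)

Section PlanarForms.
Context {R : realType}.
Implicit Types a d t mu p q r c u v : R.

Definition qf p q r u v : R := p * (u * u) + 2 * q * (u * v) + r * (v * v).

(** Half the derivative of [qf] along the flow of
    [(u, v)' = (a u + t1 v, - t2 u + d v)]. *)
Definition qf_flow a d t1 t2 p q r u v : R :=
  (p * u + q * v) * (a * u + t1 * v) + (q * u + r * v) * (- t2 * u + d * v).

(** The ratio of determinant to trace is below the smallest eigenvalue. *)
Lemma qf_coercive p q r : 0 < p -> 0 < r -> 0 < p * r - q ^+ 2 ->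
  exists2 c, 0 < c & forall u v, c * (u ^+ 2 + v ^+ 2) <= qf p q r u v.
Proof.
move=> p0 r0 det0; have pr : 0 < p + r by rewrite addr_gt0.
exists ((p * r - q ^+ 2) / (p + r)); first by rewrite divr_gt0.
move=> u v; set c := _ / _.
have prn : p + r != 0 by rewrite gt_eqF.
have pcE : p - c = (p ^+ 2 + q ^+ 2) / (p + r) by rewrite /c; field.
have pc : 0 < p - c.
  by rewrite pcE divr_gt0 // ltr_pwDl ?sqr_ge0 // exprn_gt0.
have dE : (p - c) * (r - c) - q ^+ 2 = c ^+ 2 by rewrite /c; field.
rewrite -subr_ge0 -(pmulr_rge0 _ pc) /qf.
have -> : (p - c) * (p * (u * u) + 2 * q * (u * v) + r * (v * v) -
    c * (u ^+ 2 + v ^+ 2)) =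
  ((p - c) * u + q * v) ^+ 2 + ((p - c) * (r - c) - q ^+ 2) * v ^+ 2 by ring.
rewrite dE; apply: addr_ge0; first exact: sqr_ge0.
by apply: mulr_ge0; exact: sqr_ge0.
Qed.

Definition growth_form a d t1 t2 mu p q r c : Prop :=
  [/\ 0 < c, forall u v, c * (u ^+ 2 + v ^+ 2) <= qf p q r u v &
      forall u v, qf_flow a d t1 t2 p q r u v <= mu * qf p q r u v].

(** For a stable matrix [A], the form [det A + adj A^T adj A] decreases, because
    [A + adj A] is scalar. *)
Lemma stable_growth_form a d t1 t2 mu : 0 < mu -> a + d < 0 ->
  0 < a * d + t1 * t2 -> exists p q r c, growth_form a d t1 t2 mu p q r c.
Proof.
move=> mu0 tr det; set D := a * d + t1 * t2 in det.
exists (D + d ^+ 2 + t2 ^+ 2), (a * t2 - d * t1), (D + t1 ^+ 2 + a ^+ 2), D.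
have pos u v : D * (u ^+ 2 + v ^+ 2) <=
    qf (D + d ^+ 2 + t2 ^+ 2) (a * t2 - d * t1) (D + t1 ^+ 2 + a ^+ 2) u v.
  rewrite -subr_ge0 /qf (_ : _ - _ = (d * u - t1 * v) ^+ 2 + (t2 * u + a * v) ^+ 2).
    by rewrite addr_ge0 ?sqr_ge0.
  by ring.
split=> // u v; apply: (@le_trans _ _ 0); last first.
  apply: mulr_ge0; first exact: ltW.
  by apply: le_trans (pos u v); rewrite mulr_ge0 ?(ltW det) // addr_ge0 ?sqr_ge0.
rewrite /qf_flow /D (_ : _ + _ = (a * d + t1 * t2) * (a + d) * (u ^+ 2 + v ^+ 2)).
  by rewrite mulr_le0_ge0 ?addr_ge0 ?sqr_ge0 // mulr_ge0_le0 // ltW.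
by ring.
Qed.

(** For a saddle, the sum of the squares of two left eigenvectors: one square
    grows at rate [2 mu], the other one at twice the
    negative eigenvalue. *)
Lemma saddle_growth_form a d t1 t2 mu : 0 < mu -> t2 != 0 ->
  (mu - a) * (mu - d) = - (t1 * t2) -> a * d + t1 * t2 < 0 ->
  exists p q r c, growth_form a d t1 t2 mu p q r c.
Proof.
move=> mu0 t20 charE det.
have sub : 0 < 2 * mu - (a + d).
  have E : mu * (mu - (a + d)) = - (a * d + t1 * t2).
    have : mu * (mu - (a + d)) + a * d = (mu - a) * (mu - d) by ring.
    by rewrite charE; lra.
  have : 0 < mu * (mu - (a + d)) by rewrite E oppr_gt0.
  by rewrite pmulr_rgt0 //; lra.
pose e := a - mu; pose f := mu - d.
have t22 : 0 < t2 ^+ 2 by rewrite exprn_even_gt0.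
have det2 : 0 < 2 * t2 ^+ 2 * (e ^+ 2 + f ^+ 2) - (t2 * (e + f)) ^+ 2.
  rewrite (_ : _ - _ = t2 ^+ 2 * (2 * mu - (a + d)) ^+ 2); last by rewrite /e /f; ring.
  by rewrite mulr_gt0 // exprn_gt0.
have r0 : 0 < e ^+ 2 + f ^+ 2.
  have : 0 < (f - e) ^+ 2 by rewrite exprn_gt0 // /f /e; lra.
  have -> : (f - e) ^+ 2 = 2 * (e ^+ 2 + f ^+ 2) - (e + f) ^+ 2 by ring.
  by have := sqr_ge0 (e + f); lra.
have [c c0 hc] := @qf_coercive (2 * t2 ^+ 2) (t2 * (e + f)) (e ^+ 2 + f ^+ 2)
  (mulr_gt0 (ltr0n R 2) t22) r0 det2.
exists (2 * t2 ^+ 2), (t2 * (e + f)), (e ^+ 2 + f ^+ 2), c; split=> // u v.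
rewrite -subr_ge0 /qf_flow /qf.
have eE : t1 * t2 = e * f by rewrite -[LHS]opprK -charE /e /f; ring.
rewrite (_ : _ - _ = (2 * mu - (a + d)) * (t2 * u + f * v) ^+ 2).
  by rewrite mulr_ge0 ?sqr_ge0 // ltW.
have t1E : t1 = e * f / t2 by rewrite -eE mulfK.
by rewrite t1E /e /f; field.
Qed.

(** With the weights [t2] and [t1] the antisymmetric coupling cancels. *)
Lemma diagonal_growth_form a d t1 t2 mu u v : 0 < mu -> 0 < t1 -> 0 < t2 ->
  a <= 0 -> d <= 0 -> qf_flow a d t1 t2 t2 0 t1 u v <= 0 <= mu * qf t2 0 t1 u v.
Proof.
move=> mu0 t10 t20 a0 d0; apply/andP; split.
  rewrite /qf_flow (_ : _ + _ = a * (t2 * u ^+ 2) + d * (t1 * v ^+ 2)); last by ring.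
  by rewrite -oppr_ge0 opprD -!mulNr addr_ge0 // mulr_ge0 ?oppr_ge0 // mulr_ge0 ?sqr_ge0 // ltW.
rewrite /qf mulr0 mul0r addr0 -!expr2 mulr_ge0 ?(ltW mu0) //.
by rewrite addr_ge0 // mulr_ge0 ?sqr_ge0 // ltW.
Qed.

(** The constants are extrema over finitely many forms, since beyond the
    threshold [K] the same diagonal form, that of [diagonal_growth_form], is
    used. *)
Lemma uniform_growth_forms (a d : nat -> R) t1 t2 mu (K : nat) :
  0 < t1 -> 0 < t2 ->
  (forall m, exists p q r c, growth_form (a m) (d m) t1 t2 mu p q r c) ->
  exists (p q r : nat -> R) (B c : R), [/\ 0 <= B, 0 < c,
    forall m, [/\ `|p m| <= B, `|q m| <= B & `|r m| <= B],
    forall m u v, c * (u ^+ 2 + v ^+ 2) <= qf (p m) (q m) (r m) u v &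
    (forall m u v, (m < K)%N ->
       qf_flow (a m) (d m) t1 t2 (p m) (q m) (r m) u v <=
         mu * qf (p m) (q m) (r m) u v) /\
    (forall m, (K <= m)%N -> [/\ p m = t2, q m = 0 & r m = t1])].
Proof.
move=> t10 t20 H; elim: K => [|K [p [q [r [B [c [B0 c0 hB hc [hf hd]]]]]]]].
  exists (fun=> t2), (fun=> 0), (fun=> t1), (t1 + t2), (Num.min t1 t2); split=> //.
  - by rewrite addr_ge0 // ltW.
  - by rewrite lt_min t10.
  - move=> _; rewrite normr0 !gtr0_norm //; split; rewrite ?lerDl ?lerDr ?ltW //.
    by rewrite addr_gt0.
  - move=> _ u v; rewrite /qf mulr0 mul0r addr0 -!expr2 mulrDr.
    by apply: lerD; rewrite ler_wpM2r ?sqr_ge0 // ge_min lexx ?orbT.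
have [p' [q' [r' [c' [c'0 pos' flow']]]]] := H K.
pose ov (f : nat -> R) (x : R) m := if m == K then x else f m.
exists (ov p p'), (ov q q'), (ov r r'), (B + (`|p'| + `|q'| + `|r'|)), (Num.min c c').
have n0 : 0 <= `|p'| + `|q'| + `|r'| by rewrite !addr_ge0.
split.
- by rewrite addr_ge0.
- by rewrite lt_min c0.
- move=> m; rewrite /ov; case: eqP => _.
    by have := normr_ge0 p'; have := normr_ge0 q'; have := normr_ge0 r';
      split; lra.
  by have [h1 h2 h3] := hB m; split; lra.
- move=> m u v; have s0 : 0 <= u ^+ 2 + v ^+ 2 by rewrite addr_ge0 ?sqr_ge0.
  rewrite /ov; case: eqP => _.
    by apply: le_trans (pos' u v); rewrite ler_wpM2r // ge_min lexx orbT.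
  by apply: le_trans (hc m u v); rewrite ler_wpM2r // ge_min lexx.
- split=> [m u v|m]; rewrite /ov; case: eqP => [->|/eqP mK] //.
  + by rewrite ltnS leq_eqVlt (negPf mK) /=; exact: hf.
  + by rewrite ltnn.
  + by move=> Km; exact: hd (ltnW Km).
Qed.

End PlanarForms.

Section Linearization.
Context {R : realType}.
Variables (beta1 beta2 tau1 tau2 lambda : R) (N : nat).
Hypothesis N_gt0 : (0 < N)%N.
Implicit Types (s : config N) (b i : bool) (x : 'I_N) (k : nat).

Local Notation betaf := (betaf beta1 beta2).
Local Notation couplingf := (couplingf beta1 beta2 lambda).
Local Notation field := (@field R tau1 tau2 N).
Local Notation local_arg := (@local_arg R beta1 beta2 tau1 tau2 lambda N).
Local Notation gen := (@local_generator R beta1 beta2 tau1 tau2 lambda N).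
Local Notation cdc := (@carre_du_champ R beta1 beta2 tau1 tau2 lambda N).
Local Notation X := (@spin_coef R N).

Definition kcoef i k : R := kernel_coef (theta (tauf tau1 tau2 i)) N k.

Lemma field_circulant s i x :
  field s i x = circulant (theta (tauf tau1 tau2 i)) (fun y => spin (pop s i y)) x.
Proof.
rewrite /field /Defs.conv /circulant; congr (_ * _); apply: eq_bigr => y _.
by rewrite phiE ![N%:R^-1 * _]mulrC.
Qed.

Lemma tcoef_field b i k s : tcoef b (field s i) k = kcoef i k * X b i k s.
Proof.
rewrite (eq_tcoef _ _ (field_circulant s i)) /spin_coef.
set g := fun y => spin (pop s i y); rewrite /kcoef.
have he := theta_even (tauf tau1 tau2 i).
have hp := theta_periodic (tauf tau1 tau2 i).
move: g; case: b => g; rewrite /tcoef /trig.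
  exact: (cos_coef_circulant N_gt0 he hp g k).
exact: (sin_coef_circulant N_gt0 he hp g k).
Qed.

Definition field_energy s i : R := N%:R^-1 * \sum_(x < N) field s i x ^+ 2.

Lemma field_energy_ge0 s i : 0 <= field_energy s i.
Proof. by rewrite mulr_ge0 ?invr_ge0 // sumr_ge0 // => x _; exact: sqr_ge0. Qed.

Lemma field_energyE s i :
  field_energy s i = \sum_(b : bool) \sum_(k < N) (kcoef i k * X b i k s) ^+ 2.
Proof.
rewrite /field_energy -parseval // big_bool -big_split /=; apply: eq_bigr => k _.
by rewrite -!tcoef_field.
Qed.

Lemma alphaE i : alpha (betaf i) lambda = betaf i * (1 - couplingf i ^+ 2).
Proof. by rewrite /couplingf one_sub_tanhR_sqr /alpha [lambda * _]mulrC. Qed.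

(** Only the field is expanded, around the influence of the other spin. Because
    that spin is a sign and [tanhR] is odd, the value of [tanhR] there is linear
    in the spin and the slope [1 - tanhR ^+ 2] does not depend on it. *)
Lemma tanh_local_arg s i x :
  `|tanhR (local_arg s i x) - (signf i * couplingf i * spin (pop s (~~ i) x) +
     alpha (betaf i) lambda * field s i x)| <= 2 * betaf i ^+ 2 * field s i x ^+ 2.
Proof.
set sg := spin _; pose b := signf i * (betaf i * lambda) * sg.
have tb : tanhR b = signf i * couplingf i * sg.
  rewrite /b /signf /couplingf.
  have [->|->] : sg = 1 \/ sg = -1 by exact: spin_cases.
    by case: (i); rewrite ?mulr1 ?mul1r ?mulN1r ?tanhRN.
  by case: (i); rewrite ?mulrN1 ?mul1r ?mulN1r ?opprK ?tanhRN.
have tb2 : tanhR b ^+ 2 = couplingf i ^+ 2.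
  have [sgE|sgE] : sg = 1 \/ sg = -1 by exact: spin_cases.
    by rewrite tb sgE /signf; case: (i); rewrite ?mulr1 ?mul1r ?mulN1r ?sqrrN.
  by rewrite tb sgE /signf; case: (i); rewrite ?mulrN1 ?mul1r ?mulN1r ?opprK ?sqrrN.
have := tanhR_taylor b (betaf i * field s i x); rewrite tb2 [(_ * field s i x) ^+ 2]exprMn => h.
rewrite alphaE -tb; rewrite (_ : local_arg s i x = b + betaf i * field s i x); last first.
  by rewrite /local_arg addrC.
apply: (@le_trans _ _ (2 * (betaf i ^+ 2 * field s i x ^+ 2)));
  last by rewrite mulrA.
apply: le_trans h.
by rewrite le_eqVlt; apply/orP; left; apply/eqP; congr `|_|; ring.
Qed.

Definition drift_error b i k s : R := tcoef b (fun x =>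
  tanhR (local_arg s i x) - (signf i * couplingf i * spin (pop s (~~ i) x) +
     alpha (betaf i) lambda * field s i x)) k.

Lemma drift_error_le b i k s :
  `|drift_error b i k s| <= 2 * betaf i ^+ 2 * field_energy s i.
Proof.
apply: (le_trans (tcoef_le _ _ _)).
rewrite /field_energy [leRHS]mulrCA ler_wpM2l ?invr_ge0 // mulr_sumr.
by apply: ler_sum => x _; exact: tanh_local_arg.
Qed.

(** Convolution is diagonal in the Fourier basis, so to first order the two
    populations at one frequency form a closed linear system. It is the linear
    part with [phi_hat] replaced by a discrete coefficient; the error is
    quadratic in the fields. *)
Lemma gen_spin_coef b i k s :
  gen (X b i k) s = (-1 + alpha (betaf i) lambda * kcoef i k) * X b i k s +
    signf i * couplingf i * X b (~~ i) k s + drift_error b i k s.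
Proof.
rewrite local_generator_spin_coef.
have -> : tcoef b (fun x => tanhR (local_arg s i x)) k = drift_error b i k s +
    (signf i * couplingf i * X b (~~ i) k s +
     alpha (betaf i) lambda * (kcoef i k * X b i k s)).
  rewrite -tcoef_field /drift_error /spin_coef.
  rewrite -(tcoefZ b (signf i * couplingf i)) -(tcoefZ b (alpha _ _)) -!tcoefD.
  by apply: eq_tcoef => x; rewrite subrK.
by ring.
Qed.

(** A flip changes the coefficient by at most [2 / N], and [N] spins flip at
    rate at most 1. *)
Lemma cdc_spin_coef_diag b i k s : 0 <= cdc (X b i k) (X b i k) s <= 4 / N%:R.
Proof.
apply/andP; split.
  do 2!(apply: sumr_ge0 => ? _); apply: mulr_ge0; first exact: rate_ge0.
  by rewrite -expr2 sqr_ge0.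
rewrite /carre_du_champ (bigD1 i) //= [Y in _ + Y]big1 ?addr0; last first.
  move=> j ji; rewrite big1 // => x _.
  by rewrite spin_coef_flip eq_sym (negPf ji) !mulr0.
apply: (@le_trans _ _ (\sum_(x < N) 4 * (N%:R^-1) ^+ 2)).
  apply: ler_sum => x _; rewrite spin_coef_flip eqxx -expr2 sqrrN.
  rewrite -[leRHS]mul1r ler_pM ?rate_ge0 ?sqr_ge0 ?rate_le1 //.
  rewrite !exprMn spin_sqr mulr1 -[leRHS]mulr1 ler_pM ?sqr_ge0 ?mulr_ge0 ?sqr_ge0 //.
    by rewrite -natrX.
  by rewrite -real_normK ?num_real // expr_le1 // trig_le1.
rewrite sumr_const card_ord -mulr_natr.
have N0 : N%:R != 0 :> R by rewrite pnatr_eq0 -lt0n.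
by rewrite le_eqVlt; apply/orP; left; apply/eqP; field.
Qed.

(** Every jump changes one population only. *)
Lemma cdc_spin_coef_cross b k s : cdc (X b true k) (X b false k) s = 0.
Proof.
rewrite /carre_du_champ big1 // => j _; rewrite big1 // => x _.
by rewrite !spin_coef_flip; case: j; rewrite /= ?mulr0 ?mul0r ?mulr0.
Qed.

(** * A quadratic Lyapunov function *)

Variables (mu B c0 D W : R) (p q r : nat -> R).
Hypotheses (B_ge0 : 0 <= B) (c0_gt0 : 0 < c0) (D_ge0 : 0 <= D)
  (W_ge0 : 0 <= W).

Definition qform k (u v : R) : R := qf (p k) (q k) (r k) u v.

(** Squared kernel coefficients as weights make [lyap] dominate the energy of
    the fields, by Parseval's identity, and keep it bounded in [N]. *)
Definition weight k : R := kcoef true k ^+ 2 + kcoef false k ^+ 2.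

Definition lyap s : R := \sum_(b : bool) \sum_(k < N)
  weight k * qform k (X b true k s) (X b false k s).

(* The modes are bounded by 1, and [D / N] leaves room for replacing the kernel
   coefficients by their limits. *)
Hypotheses
  (coef_bound : forall k, (k < N)%N -> [/\ `|p k| <= B, `|q k| <= B & `|r k| <= B])
  (qform_pos : forall k u v, (k < N)%N -> c0 * (u ^+ 2 + v ^+ 2) <= qform k u v)
  (qform_dissip : forall k u v, (k < N)%N -> `|u| <= 1 -> `|v| <= 1 ->
    qf_flow (-1 + alpha beta1 lambda * kcoef true k)
      (-1 + alpha beta2 lambda * kcoef false k)
      (couplingf true) (couplingf false) (p k) (q k) (r k) u v <=
    mu * qform k u v + D / N%:R)
  (weight_sum : \sum_(k < N) weight k <= W).

Lemma weight_ge0 k : 0 <= weight k.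
Proof. by rewrite addr_ge0 ?sqr_ge0. Qed.

Lemma lyap_ge0 s : 0 <= lyap s.
Proof.
apply: sumr_ge0 => b _; apply: sumr_ge0 => k _; rewrite mulr_ge0 ?weight_ge0 //.
apply: le_trans (qform_pos _ _ (ltn_ord k)).
by rewrite mulr_ge0 ?(ltW c0_gt0) // addr_ge0 ?sqr_ge0.
Qed.

Let modes_energy s := \sum_(b : bool) \sum_(k < N)
  weight k * (X b true k s ^+ 2 + X b false k s ^+ 2).

Let modes_energy_le s : c0 * modes_energy s <= lyap s.
Proof.
rewrite /modes_energy mulr_sumr; apply: ler_sum => b _.
rewrite mulr_sumr; apply: ler_sum => k _.
by rewrite mulrCA ler_wpM2l ?weight_ge0 // qform_pos.
Qed.

Lemma field_energy_le_lyap s i : field_energy s i <= lyap s / c0.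
Proof.
rewrite ler_pdivlMr // mulrC; apply: le_trans (modes_energy_le s).
rewrite ler_wpM2l ?(ltW c0_gt0) // field_energyE.
apply: ler_sum => b _; apply: ler_sum => k _.
rewrite /weight exprMn.
have a1 := sqr_ge0 (kcoef true k); have a2 := sqr_ge0 (kcoef false k).
have a3 := sqr_ge0 (X b true k s); have a4 := sqr_ge0 (X b false k s).
set Kt := kcoef true k ^+ 2 in a1 *; set Kf := kcoef false k ^+ 2 in a2 *.
set Xt := X b true k s ^+ 2 in a3 *; set Xf := X b false k s ^+ 2 in a4 *.
apply: (@le_trans _ _ (if i then Kt * Xt else Kf * Xf)); first by case: (i).
have e1 := mulr_ge0 a1 a3; have e2 := mulr_ge0 a1 a4.
have e3 := mulr_ge0 a2 a3; have e4 := mulr_ge0 a2 a4.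
by rewrite mulrDl !mulrDr; case: (i); lra.
Qed.

Let err_total s := 2 * (beta1 ^+ 2 + beta2 ^+ 2) * (lyap s / c0).

Let err_total_le b k s :
  `|drift_error b true k s| + `|drift_error b false k s| <= err_total s.
Proof.
have h i : `|drift_error b i k s| <= 2 * betaf i ^+ 2 * (lyap s / c0).
  apply: (le_trans (drift_error_le _ _ _ _)).
  by rewrite ler_wpM2l ?field_energy_le_lyap // mulr_ge0 ?sqr_ge0.
apply: (le_trans (lerD (h true) (h false))).
by rewrite /err_total le_eqVlt; apply/orP; left; apply/eqP => /=; ring.
Qed.

Let gen_qform b (k : 'I_N) s :
  gen (fun s => qform k (X b true k s) (X b false k s)) s <=
  2 * mu * qform k (X b true k s) (X b false k s) + (2 * D + 8 * B) / N%:R +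
  2 * B * (`|X b true k s| + `|X b false k s|) * err_total s.
Proof.
have kN := ltn_ord k; have [pB qB rB] := coef_bound kN.
have genM i j : gen (fun s0 => X b i k s0 * X b j k s0) s =
    X b i k s * gen (X b j k) s + X b j k s * gen (X b i k) s +
    cdc (X b i k) (X b j k) s by exact: local_generatorM.
rewrite /qform /qf !local_generatorD !local_generatorZ !genM.
rewrite cdc_spin_coef_cross !gen_spin_coef /=.
set G1 := carre_du_champ _ _ _ _ _ _ _ s; set G2 := carre_du_champ _ _ _ _ _ _ _ s.
have /andP[G10 G1N] : 0 <= G1 <= 4 / N%:R by exact: cdc_spin_coef_diag.
have /andP[G20 G2N] : 0 <= G2 <= 4 / N%:R by exact: cdc_spin_coef_diag.
have := qform_dissip kN (spin_coef_le1 b true k s) (spin_coef_le1 b false k s).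
have := err_total_le b k s.
set u := X b true k s; set v := X b false k s.
set e1 := drift_error b true k s; set e2 := drift_error b false k s.
set E := err_total s; rewrite /qform /qf /qf_flow => eE dis.
have lin : 2 * ((p k * u + q k * v) * e1 + (q k * u + r k * v) * e2) <=
    2 * B * (`|u| + `|v|) * E.
  rewrite -[leRHS]mulrA -[leRHS]mulrA ler_pM2l //.
  apply: (@le_trans _ _ ((B * (`|u| + `|v|)) * (`|e1| + `|e2|))); last first.
    by rewrite mulrA ler_wpM2l // mulr_ge0 // addr_ge0.
  have bnd (c d : R) : `|c| <= B -> `|d| <= B -> `|c * u + d * v| <= B * (`|u| + `|v|).
    move=> hc hd; apply: (le_trans (ler_normD _ _)); rewrite !normrM mulrDr.
    by apply: lerD; rewrite ler_wpM2r.
  rewrite [leRHS]mulrDr; apply: lerD; apply: (le_trans (ler_norm _));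
    by rewrite normrM ler_wpM2r // bnd.
have g1 : p k * G1 <= B * (4 / N%:R).
  by apply: (le_trans (ler_norm _)); rewrite normrM [`|G1|]ger0_norm // ler_pM.
have g2 : r k * G2 <= B * (4 / N%:R).
  by apply: (le_trans (ler_norm _)); rewrite normrM [`|G2|]ger0_norm // ler_pM.
move: dis lin g1 g2; rewrite /signf.
have -> : (2 * D + 8 * B) / N%:R = 2 * (D / N%:R) + 2 * (B * (4 / N%:R)) by ring.
set DN := D / _; set BN := B * _.
set a := -1 + _; set d := -1 + _; set t1 := couplingf true; set t2 := couplingf false.
set RHS2 := 2 * B * _ * _ => dis lin g1 g2.
apply: (@le_trans _ _ (2 * ((p k * u + q k * v) * (a * u + t1 * v) +
    (q k * u + r k * v) * (- t2 * u + d * v)) +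
  2 * ((p k * u + q k * v) * e1 + (q k * u + r k * v) * e2) + (p k * G1 + r k * G2))).
  by rewrite le_eqVlt; apply/orP; left; apply/eqP; ring.
lra.
Qed.

Definition lyap_const : R := 4 * D * W + 16 * B * W.
Definition lyap_nonlin : R :=
  4 * B * ((beta1 ^+ 2 + beta2 ^+ 2) / c0) * (c0^-1 + 4 * W).

Lemma lyap_nonlin_ge0 : 0 <= lyap_nonlin.
Proof.
have c0i : 0 <= c0^-1 by rewrite invr_ge0 ltW.
apply: mulr_ge0; last by rewrite addr_ge0 // mulr_ge0.
by apply: mulr_ge0; [exact: mulr_ge0|rewrite mulr_ge0 // addr_ge0 ?sqr_ge0].
Qed.

(* The Cauchy-Schwarz inequality, by means of [|y| <= y^2 / rho + rho] with
   [rho] the square root of [lyap s]. *)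
Let sum_norm_modes s : \sum_(b : bool) \sum_(k < N)
    weight k * (`|X b true k s| + `|X b false k s|) <=
  (c0^-1 + 4 * W) * Num.sqrt (lyap s).
Proof.
set rho := Num.sqrt _.
have rho0 : 0 <= rho by exact: sqrtr_ge0.
have V0 := lyap_ge0 s.
have E0 : modes_energy s <= c0^-1 * lyap s.
  by rewrite mulrC ler_pdivlMr // mulrC modes_energy_le.
have [rz|rp] := eqVneq rho 0.
  have Vz : lyap s = 0 by apply/eqP; rewrite eq_le V0 andbT -sqrtr_eq0 -/rho rz eqxx.
  rewrite rz mulr0 big1 // => b _; rewrite big1 // => k _.
  have e0 : modes_energy s = 0.
    apply/eqP; rewrite eq_le; apply/andP; split; first by rewrite Vz mulr0 in E0.
    do 2!(apply: sumr_ge0 => ? _); rewrite mulr_ge0 ?weight_ge0 // addr_ge0 ?sqr_ge0 //.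
  move/eqP: e0; rewrite /modes_energy psumr_eq0 => [/allP/(_ b (mem_index_enum _))|b' _];
    last by apply: sumr_ge0 => ? _; rewrite mulr_ge0 ?weight_ge0 // addr_ge0 ?sqr_ge0.
  rewrite /= psumr_eq0 => [/allP/(_ k (mem_index_enum _))|k' _];
    last by rewrite mulr_ge0 ?weight_ge0 // addr_ge0 ?sqr_ge0.
  rewrite /= mulf_eq0 => /orP[/eqP ->|]; first by rewrite mul0r.
  rewrite paddr_eq0 ?sqr_ge0 // !sqrf_eq0 => /andP[/eqP -> /eqP ->].
  by rewrite normr0 addr0 mulr0.
have rpos : 0 < rho by rewrite lt_def rp.
have amgm (y : R) : `|y| <= y ^+ 2 / rho + rho.
  have := sqr_ge0 (`|y| - rho); rewrite -[y ^+ 2]real_normK ?num_real // => h.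
  rewrite -subr_ge0 (_ : _ - _ = ((`|y| - rho) ^+ 2 + `|y| * rho) / rho); last by field.
  by rewrite divr_ge0 // addr_ge0 // mulr_ge0.
apply: (@le_trans _ _ (modes_energy s / rho + 4 * W * rho)).
  apply: (@le_trans _ _ (\sum_(b : bool) \sum_(k < N)
     (weight k * (X b true k s ^+ 2 + X b false k s ^+ 2) / rho + weight k * (2 * rho)))).
    apply: ler_sum => b _; apply: ler_sum => k _.
    rewrite -mulrA -mulrDr ler_wpM2l ?weight_ge0 //.
    apply: (le_trans (lerD (amgm _) (amgm _))).
    by rewrite le_eqVlt; apply/orP; left; apply/eqP; ring.
  under eq_bigr do rewrite big_split /= -!mulr_suml.
  rewrite big_split /= -mulr_suml lerD2l big_bool /=.
  rewrite (_ : _ + _ = (\sum_(k < N) weight k) * (4 * rho)); last by ring.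
  by rewrite (_ : 4 * W * rho = W * (4 * rho)); [rewrite ler_wpM2r // mulr_ge0|ring].
rewrite [leRHS]mulrDl lerD2r ler_pdivrMr // -mulrA -expr2 sqr_sqrtr //.
Qed.

(** The nonlinear error is a product of modes, of order [1 / 2] in [lyap], with
    the energy of the fields, of order 1. *)
Lemma gen_lyap s : gen lyap s <=
  2 * mu * lyap s + lyap_const / N%:R + lyap_nonlin * (lyap s * Num.sqrt (lyap s)).
Proof.
rewrite /lyap local_generator_sum.
under eq_bigr do rewrite local_generator_sum.
under eq_bigr do under eq_bigr do rewrite local_generatorZ.
rewrite -/(lyap s).
apply: (@le_trans _ _ (\sum_(b : bool) \sum_(k < N) (
   2 * mu * (weight k * qform k (X b true k s) (X b false k s)) +
   weight k * ((2 * D + 8 * B) / N%:R) +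
   weight k * (`|X b true k s| + `|X b false k s|) * (2 * B * err_total s)))).
  apply: ler_sum => b _; apply: ler_sum => k _.
  apply: (le_trans (ler_wpM2l (weight_ge0 k) (gen_qform b k s))).
  by rewrite le_eqVlt; apply/orP; left; apply/eqP; ring.
have -> : \sum_(b : bool) \sum_(k < N) (
   2 * mu * (weight k * qform k (X b true k s) (X b false k s)) +
   weight k * ((2 * D + 8 * B) / N%:R) +
   weight k * (`|X b true k s| + `|X b false k s|) * (2 * B * err_total s)) =
   2 * mu * lyap s + (\sum_(b : bool) \sum_(k < N) weight k) * ((2 * D + 8 * B) / N%:R) +
   (\sum_(b : bool) \sum_(k < N) weight k * (`|X b true k s| + `|X b false k s|)) *
     (2 * B * err_total s).
  rewrite /lyap mulr_sumr !mulr_suml -!big_split /=; apply: eq_bigr => b _.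
  by rewrite mulr_sumr !mulr_suml -!big_split.
apply: lerD; first (apply: lerD => //).
  apply: (@le_trans _ _ (2 * W * ((2 * D + 8 * B) / N%:R))).
    rewrite ler_wpM2r ?divr_ge0 ?addr_ge0 ?mulr_ge0 // big_bool /=.
    by have := weight_sum; lra.
  by rewrite le_eqVlt; apply/orP; left; apply/eqP; rewrite /lyap_const; ring.
have E0 : 0 <= 2 * B * err_total s.
  by rewrite /err_total !mulr_ge0 ?addr_ge0 ?sqr_ge0 ?invr_ge0 ?lyap_ge0 // ltW.
apply: (le_trans (ler_wpM2r E0 (sum_norm_modes s))).
by rewrite le_eqVlt; apply/orP; left; apply/eqP; rewrite /lyap_nonlin /err_total; ring.
Qed.

Lemma qform_le k u v : (k < N)%N -> qform k u v <= 2 * B * (u ^+ 2 + v ^+ 2).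
Proof.
move=> kN; have [pB qB rB] := coef_bound kN.
have h (c z y : R) : `|c| <= B -> `|z| <= y -> c * z <= B * y.
  by move=> hc hz; apply: (le_trans (ler_norm _)); rewrite normrM ler_pM.
have a1 : p k * (u * u) <= B * u ^+ 2 by apply: h => //; rewrite -expr2 ger0_norm ?sqr_ge0.
have a2 : r k * (v * v) <= B * v ^+ 2 by apply: h => //; rewrite -expr2 ger0_norm ?sqr_ge0.
have a3 : q k * (2 * (u * v)) <= B * (u ^+ 2 + v ^+ 2).
  apply: h => //; rewrite ler_norml; have := sqr_ge0 (u - v); have := sqr_ge0 (u + v).
  by move=> ? ?; apply/andP; split; nra.
by rewrite /qform /qf; lra.
Qed.

Lemma lyap_le s : lyap s <= 8 * B * W.
Proof.
apply: (@le_trans _ _ (\sum_(b : bool) \sum_(k < N) weight k * (4 * B))).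
  apply: ler_sum => b _; apply: ler_sum => k _; rewrite ler_wpM2l ?weight_ge0 //.
  apply: (le_trans (qform_le _ _ (ltn_ord k))).
  have sq i : X b i k s ^+ 2 <= 1.
    by rewrite -real_normK ?num_real // expr_le1 // spin_coef_le1.
  apply: (@le_trans _ _ (2 * B * (1 + 1))); last lra.
  by rewrite ler_wpM2l ?mulr_ge0 // lerD.
rewrite big_bool /= -!mulr_suml.
have := ler_wpM2r (mulr_ge0 (ler0n R 4) B_ge0) weight_sum; lra.
Qed.

End Linearization.

(** * Linear growth in spite of a superlinear error *)

Section ConcaveDamping.
Context {R : realType}.
Variable c : R.
Hypothesis c_ge0 : 0 <= c.

(** The change of variable that linearizes [v' = 2 mu v + C v^(3/2)], with
    [c = C / (2 mu)]: along this flow, [damp v] grows exactly at rate [2 mu]. *)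
Definition damp (v : R) : R := v / (1 + c * Num.sqrt v) ^+ 2.

Let den_gt0 (v : R) : 0 < 1 + c * Num.sqrt v.
Proof. by rewrite ltr_pwDl // mulr_ge0 // sqrtr_ge0. Qed.

(** Concavity with an explicit slope: the jumps of [v], whatever their size,
    contribute to the generator of [damp v] at most their first-order effect. *)
Lemma damp_concave (v v' : R) : 0 <= v -> 0 <= v' ->
  damp v' - damp v <= (1 + c * Num.sqrt v) ^- 3 * (v' - v).
Proof.
move=> v0 v'0; rewrite /damp.
have := den_gt0 v; have := den_gt0 v'.
have := sqrtr_ge0 v; have := sqrtr_ge0 v'.
have := sqr_sqrtr v0; have := sqr_sqrtr v'0.
move: (Num.sqrt v) (Num.sqrt v') => r r' <- <- r'0 r0 d'0 d0.
rewrite -subr_ge0.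
have -> : (1 + c * r) ^- 3 * (r' ^+ 2 - r ^+ 2) -
    (r' ^+ 2 / (1 + c * r') ^+ 2 - r ^+ 2 / (1 + c * r) ^+ 2) =
  c * (r' - r) ^+ 2 * (r' * ((1 + c * r') + (1 + c * r)) + r * (1 + c * r')) /
    ((1 + c * r) ^+ 3 * (1 + c * r') ^+ 2).
  by field; rewrite !gt_eqF.
apply: divr_ge0; last by rewrite mulr_ge0 // exprn_ge0 // ltW.
apply: mulr_ge0; first by rewrite mulr_ge0 // sqr_ge0.
apply: addr_ge0; apply: mulr_ge0 => //; last exact: ltW.
by apply: addr_ge0; exact: ltW.
Qed.

Lemma damp_le (v : R) : 0 <= v -> damp v <= v.
Proof.
move=> v0; rewrite ler_pdivrMr ?exprn_gt0 // ler_peMr // exprn_ege1 //.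
by rewrite lerDl mulr_ge0 // sqrtr_ge0.
Qed.

Lemma le_damp (v vm : R) : 0 <= v -> v <= vm ->
  v <= (1 + c * Num.sqrt vm) ^+ 2 * damp v.
Proof.
move=> v0 vvm; rewrite /damp mulrCA ler_peMr // ler_pdivlMr ?exprn_gt0 // mul1r.
rewrite ler_sqr ?nnegrE ?(ltW (den_gt0 _)) // lerD2l ler_wpM2l //.
exact: ler_wsqrtr.
Qed.

End ConcaveDamping.

Section GrowthBound.
Context {R : realType} {S : finType} {d : measure_display}
  {Omega : measurableType d} (P : probability Omega R) (q : S -> S -> R)
  (X : R -> Omega -> S) (mc : markov_chain P q X).
Hypothesis q_ge0 : forall s u, 0 <= q s u.

(** The mean of [damp V] grows at most exponentially, and as [V] is bounded it
    is recovered from [damp V] up to a constant factor. In this way the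
    superlinear error is absorbed without stopping the chain when [V] becomes
    large. *)
Lemma mean_growth (V : S -> R) (mu K1 K2 Vm e : R) :
  0 < mu -> 0 <= K1 -> 0 <= K2 -> 0 <= e ->
  (forall s, 0 <= V s <= Vm) ->
  (forall s, generator q V s <= 2 * mu * V s + K1 * e +
     K2 * (V s * Num.sqrt (V s))) ->
  forall t, 0 <= t ->
  mean P X t V <= (1 + K2 / (2 * mu) * Num.sqrt Vm) ^+ 2 *
     (mean P X 0 V + K1 / (2 * mu) * e) * expR (2 * mu * t).
Proof.
move=> mu0 K10 K20 e0 hV hgen T T0.
have mu2 : 0 < 2 * mu by rewrite mulr_gt0.
pose c := K2 / (2 * mu); have c0 : 0 <= c by rewrite divr_ge0 // ltW.
have V0 s : 0 <= V s by case/andP: (hV s).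
have gendamp s : generator q (fun u => damp c (V u)) s <=
    2 * mu * damp c (V s) + K1 * e.
  set a := 1 + c * Num.sqrt (V s).
  have a1 : 1 <= a by rewrite lerDl mulr_ge0 // sqrtr_ge0.
  have a0 : 0 < a by rewrite (lt_le_trans _ a1).
  have ai : 0 <= a ^- 3 by rewrite invr_ge0 exprn_ge0 // ltW.
  apply: (@le_trans _ _ (a ^- 3 * generator q V s)).
    rewrite /generator mulr_sumr; apply: ler_sum => u _.
    by rewrite mulrCA ler_wpM2l // damp_concave.
  apply: (le_trans (ler_wpM2l ai (hgen s))).
  rewrite (_ : _ + _ = 2 * mu * V s * a + K1 * e); last first.
    by rewrite /a /c; field; rewrite gt_eqF.
  rewrite mulrDr; apply: lerD; last first.
    by rewrite ler_piMl ?mulr_ge0 // invf_le1 ?exprn_gt0 // exprn_ege1.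
  rewrite /damp -/a le_eqVlt; apply/orP; left; apply/eqP.
  by field; rewrite gt_eqF.
pose F t (s : S) := expR (- (2 * mu) * t) * damp c (V s).
have hF s (t : R) : is_derive t 1 (F ^~ s) (- (2 * mu) * F t s).
  have h1 := is_derive_expR_comp (is_derive_scale (- (2 * mu)) (is_derive_var t)).
  have h2 := is_derive_mul h1 (is_derive_const (damp c (V s)) t).
  by apply: is_derive_eq h2 _; rewrite /F; ring.
pose b t := - (K1 * e / (2 * mu)) * expR (- (2 * mu) * t).
have hb (t : R) : is_derive t 1 b (K1 * e * expR (- (2 * mu) * t)).
  have h1 := is_derive_expR_comp (is_derive_scale (- (2 * mu)) (is_derive_var t)).
  apply: is_derive_eq (is_derive_scale _ h1) _.
  by field; rewrite gt_eqF.
have hd x : 0 < x < T -> mean P X x (fun s => - (2 * mu) * F x s +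
    generator q (F x) s) <= K1 * e * expR (- (2 * mu) * x).
  move=> /andP[x0 _].
  rewrite -(@mean_cst _ _ _ _ _ _ _ mc x (K1 * e * expR (- (2 * mu) * x)) (ltW x0)).
  apply: mean_le => s.
  have -> : generator q (F x) s = expR (- (2 * mu) * x) *
      generator q (fun u => damp c (V u)) s.
    by rewrite /generator mulr_sumr; apply: eq_bigr => u _; rewrite /F; ring.
  have := ler_wpM2l (expR_ge0 (- (2 * mu) * x)) (gendamp s).
  by rewrite /F mulrDr; lra.
have := mean_drift_le mc T0 hF hb hd.
rewrite /b mulr0 expR0 mulr1.
have -> : mean P X T (F T) = expR (- (2 * mu) * T) * mean P X T (fun s => damp c (V s)).
  exact: meanZ.
have h0 : mean P X 0 (F 0) <= mean P X 0 V.
  by apply: mean_le => s; rewrite /F mulr0 expR0 mul1r damp_le.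
set E := expR (- (2 * mu) * T) => h1.
have E0 : 0 < E by exact: expR_gt0.
have EE : expR (2 * mu * T) = E^-1 by rewrite /E mulNr expRN invrK.
have h2 : E * mean P X T (fun s => damp c (V s)) <=
    mean P X 0 V + K1 / (2 * mu) * e.
  have : 0 <= K1 * e / (2 * mu) * E by rewrite !mulr_ge0 ?invr_ge0 // ltW.
  rewrite [K1 / _ * e]mulrAC; lra.
apply: (@le_trans _ _ ((1 + c * Num.sqrt Vm) ^+ 2 * mean P X T (fun s => damp c (V s)))).
  rewrite -meanZ; apply: mean_le => s.
  by case/andP: (hV s) => h3 h4; exact: le_damp.
rewrite -mulrA ler_wpM2l ?sqr_ge0 // EE ler_pdivlMr // mulrC //.
Qed.

End GrowthBound.

(** * Small values of an unstable noisy coordinate *)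

Section Anticoncentration.
Context {R : realType}.

Lemma expR_le_quadratic (w : R) : w <= 1 -> expR w <= 1 + w + w ^+ 2.
Proof.
move=> w1.
have [w0|w0] := leP 0 w.
  pose f x : R := (1 + x + x ^+ 2) * expR (- x).
  have hf (x : R) : is_derive x 1 (fun x => - ((1 + x + x * x) * expR (- x)))
      (- (((0 + 1) + (1 * x + x * 1)) * expR (- x) +
          (1 + x + x * x) * (expR (- x) * (- 1)))).
    have h1 := is_derive_add (is_derive_add (is_derive_const 1 x) (is_derive_var x))
      (is_derive_mul (is_derive_var x) (is_derive_var x)).
    have h2 := is_derive_expR_comp (is_derive_opp (is_derive_var x)).
    exact: is_derive_opp (is_derive_mul h1 h2).
  have := is_derive_nonincreasing w0 hf.
  rewrite !addr0 mulr0 oppr0 addr0 expR0 mulr1 lerN2 => /(_ _)/wrap[x /andP[x0 xw]|].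
    rewrite (_ : - _ = - (expR (- x) * (x * (1 - x)))); last by ring.
    by rewrite oppr_le0 mulr_ge0 ?expR_ge0 // mulr_ge0 // ltW // subr_gt0; lra.
  by rewrite expRN ler_pdivlMr ?expR_gt0 // mul1r expr2.
have wn : 0 <= - w by rewrite oppr_ge0 ltW.
have h1 : 1 - w <= expR (- w) by apply: expR_ge1Dx.
have wp : 0 < 1 - w by lra.
rewrite -[w in expR w]opprK expRN.
apply: (@le_trans _ _ (1 - w)^-1); first by rewrite lef_pV2 ?posrE ?expR_gt0.
rewrite -[_^-1]mul1r ler_pdivrMr //.
rewrite -subr_ge0 (_ : _ - _ = - w * w ^+ 2); last by ring.
by rewrite mulr_ge0 ?sqr_ge0.
Qed.

Context {S : finType} {d : measure_display}
  {Omega : measurableType d} (P : probability Omega R) (q : S -> S -> R)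
  (X : R -> Omega -> S) (mc : markov_chain P q X).
Hypothesis q_ge0 : forall s u, 0 <= q s u.

Variables (Y V : S -> R) (mu n A v0 v1 E KV M K T : R).
Hypotheses (mu_gt0 : 0 < mu) (n_ge1 : 1 <= n) (A_ge0 : 0 <= A) (v0_ge0 : 0 <= v0)
  (E_ge0 : 0 <= E) (KV_ge0 : 0 <= KV) (M_gt0 : 0 < M) (K_gt0 : 0 < K) (T_ge0 : 0 <= T).
(* The chain has about [n] small components: [Y] is an observable that grows at
   rate [mu], with noise of order [1 / n] in variance and with a drift error
   controlled by [V]. *)
Hypotheses
  (Y_bound : forall s, `|Y s| <= A)
  (Y_jump : forall s u, q s u != 0 -> `|Y u - Y s| <= A / n)
  (Y_var_ge : forall s, v0 / n <= \sum_u q s u * (Y u - Y s) ^+ 2)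
  (Y_var_le : forall s, \sum_u q s u * (Y u - Y s) ^+ 2 <= v1 / n)
  (Y_drift : forall s, `|generator q Y s - mu * Y s| <= E * (n^-1 + V s))
  (V_mean : forall t, 0 <= t -> mean P X t V <= KV / n * expR (2 * mu * t))
  (M_A : 4 * A ^+ 2 * mu <= M) (M_v1 : 4 * v1 <= M).

Let n_gt0 : 0 < n. Proof. exact: lt_le_trans n_ge1. Qed.
Let n0 : n != 0. Proof. by rewrite gt_eqF. Qed.
Let mu0 : mu != 0. Proof. by rewrite gt_eqF. Qed.

(** The test function [gtest] is a Gaussian in [Y] whose expected value can
    increase only because of the drift error, for every noise level that
    [Y_var_ge] and [Y_var_le] allow. Its squared width solves
    [r' = 2 mu r - 2 M / n], so that the term in [Y ^+ 2] produced by the largest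
    noise is compensated; the power [- gexp] of [gscale], which is proportional
    to [r] in the coordinate [exp(- mu t) Y], grows as fast as the smallest noise
    lets the mass at the origin decrease. With a single noise level and no margin
    for jumps, [gexp] would be [1 / 2] and [gtest] the heat kernel. *)
Definition gexp : R := v0 / (4 * M).
Definition gwidth (t : R) : R := (M / mu + K * expR (2 * mu * t)) / n.
Definition gscale (t : R) : R := M / mu * expR (- (2 * mu) * t) + K.
Definition gtest (t : R) (s : S) : R :=
  expR (- gexp * ln (gscale t) - Y s ^+ 2 / gwidth t).

Let gexp_ge0 : 0 <= gexp. Proof. by rewrite divr_ge0 // mulr_ge0 // ltW. Qed.

Let gwidth_gt0 t : 0 < gwidth t.
Proof. by rewrite divr_gt0 // addr_gt0 ?(divr_gt0 M_gt0) // mulr_gt0 ?expR_gt0. Qed.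

Let gscale_gt0 t : 0 < gscale t.
Proof. by rewrite addr_gt0 // mulr_gt0 ?(divr_gt0 M_gt0) ?expR_gt0. Qed.

Definition dgtest t s : R := gtest t s *
  (2 * gexp * M / n / gwidth t +
   Y s ^+ 2 * (2 * mu / gwidth t - 2 * M / n / gwidth t ^+ 2)).

Lemma is_derive_gtest s (t : R) : is_derive t 1 (gtest ^~ s) (dgtest t s).
Proof.
have r0 := gwidth_gt0 t; have c0 := gscale_gt0 t.
have e1 := is_derive_expR_comp (is_derive_scale (2 * mu) (is_derive_var t)).
have e2 := is_derive_expR_comp (is_derive_scale (- (2 * mu)) (is_derive_var t)).
have hw : is_derive t 1 gwidth ((0 + K * (expR (2 * mu * t) * (2 * mu * 1))) * n^-1).
  have h := is_derive_mul (is_derive_add (is_derive_const (M / mu) t)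
    (is_derive_scale K e1)) (is_derive_const n^-1 t).
  by apply: is_derive_eq h _; ring.
have hc : is_derive t 1 gscale (M / mu * (expR (- (2 * mu) * t) * (- (2 * mu) * 1)) + 0).
  exact: is_derive_add (is_derive_scale (M / mu) e2) (is_derive_const K t).
have hl := is_derive1_comp (is_derive1_ln c0) hc.
have h1 := is_derive_scale (- gexp) hl.
have h2 := is_derive_scale (Y s ^+ 2) (@is_derive_inv _ gwidth t _ (lt0r_neq0 r0) hw).
have h := is_derive_expR_comp (is_derive_add h1 (is_derive_opp h2)).
apply: is_derive_eq h _; rewrite /dgtest /=; congr (_ * _).
have EE : expR (2 * mu * t) * expR (- (2 * mu) * t) = 1.
  by rewrite -expRD mulNr subrr expR0.
rewrite /GRing.scale /=.
have -> : expR (- (2 * mu) * t) = (expR (2 * mu * t))^-1 by rewrite mulNr expRN.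
move: r0 c0; rewrite /gwidth /gscale.
have -> : expR (- (2 * mu) * t) = (expR (2 * mu * t))^-1 by rewrite mulNr expRN.
have x0 := expR_gt0 (2 * mu * t); move: x0.
set x := expR (2 * mu * t) => x0 r0 c0.
have z1 : M + K * x * mu != 0 by rewrite gt_eqF // addr_gt0 // !mulr_gt0.
by field; rewrite n0 mu0 z1 gt_eqF.
Qed.

Let gwidth_inv_le t : (gwidth t)^-1 <= mu * n / M.
Proof.
have h : 0 < M / mu / n by rewrite !divr_gt0.
rewrite [leRHS](_ : _ = (M / mu / n)^-1); last by field; rewrite n0 mu0 gt_eqF.
rewrite lef_pV2 ?posrE //.
by rewrite ler_wpM2r ?invr_ge0 ?(ltW n_gt0) // lerDl mulr_ge0 ?expR_ge0 // ltW.
Qed.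

(* The second-order expansion of the Gaussian weight at a jump [h]; the lower
   bound [M_A] keeps the exponent below 1. *)
Let jump_exponent (t y h : R) : `|y| <= A -> `|h| <= A / n ->
  expR (- ((y + h) ^+ 2 - y ^+ 2) / gwidth t) - 1 <= - (2 * y / gwidth t) * h - h ^+ 2 / (2 * gwidth t) +
    8 * y ^+ 2 / gwidth t ^+ 2 * h ^+ 2.
Proof.
move=> hy hh; have r0 := gwidth_gt0 t; have ri := gwidth_inv_le t.
set r := gwidth t in r0 ri *; set w := - _ / r.
have rn : r != 0 by rewrite gt_eqF.
have ri0 : 0 <= r^-1 by rewrite invr_ge0 ltW.
have An : A / n <= A by rewrite ler_pdivrMr // ler_peMr.
have AM : A ^+ 2 * (mu / M) <= 4^-1.
  rewrite mulrA ler_pdivrMr // [leRHS]mulrC ler_pdivlMr //.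
  by rewrite mulrC mulrA.
have h2r : h ^+ 2 * r^-1 <= 4^-1.
  apply: (@le_trans _ _ ((A / n) * A * (mu * n / M))).
    rewrite ler_pM ?sqr_ge0 // -[h ^+ 2]real_normK ?num_real // expr2.
    by rewrite ler_pM // (le_trans hh).
  by apply: le_trans AM; rewrite le_eqVlt; apply/orP; left; apply/eqP; field;
    rewrite n0 gt_eqF.
have yhr : `|y * h| * r^-1 <= 4^-1.
  apply: (@le_trans _ _ (A * (A / n) * (mu * n / M))).
    by rewrite ler_pM // normrM ler_pM.
  by apply: le_trans AM; rewrite le_eqVlt; apply/orP; left; apply/eqP; field;
    rewrite n0 gt_eqF.
have h20 : 0 <= h ^+ 2 * r^-1 by rewrite mulr_ge0 ?sqr_ge0.
have wE : w = - (2 * (y * h * r^-1) + h ^+ 2 * r^-1) by rewrite /w; ring.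
have yh1 : `|y * h * r^-1| <= 4^-1 by rewrite normrM [`|r^-1|]ger0_norm.
have w1 : w <= 1.
  by move: yh1; rewrite wE ler_norml => /andP[]; lra.
have := expR_le_quadratic w1.
rewrite wE; set a := y * h * r^-1; set b := h ^+ 2 * r^-1 => hw.
have b4 : b <= 4^-1 by [].
have -> : - (2 * y / r) * h = - 2 * a by rewrite /a; ring.
have -> : h ^+ 2 / (2 * r) = b / 2 by rewrite /b; field.
have -> : 8 * y ^+ 2 / r ^+ 2 * h ^+ 2 = 8 * a ^+ 2 by rewrite /a; field.
have bb : b * b <= 4^-1 * b by rewrite ler_wpM2r.
have := sqr_ge0 (2 * a - b); nra.
Qed.

Let gtest_drift t s : dgtest t s + generator q (gtest t) s <=
  gtest t s * (2 * (`|Y s| / gwidth t) * (E * (n^-1 + V s))).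
Proof.
have r0 := gwidth_gt0 t; have rn : gwidth t != 0 by rewrite gt_eqF.
have F0 : 0 <= gtest t s by exact: expR_ge0.
pose v := \sum_u q s u * (Y u - Y s) ^+ 2.
have genF : generator q (gtest t) s <= gtest t s *
    (- (2 * Y s / gwidth t) * generator q Y s - v / (2 * gwidth t) +
     8 * Y s ^+ 2 / gwidth t ^+ 2 * v).
  rewrite /generator /v !mulr_sumr mulr_suml -sumrB -big_split /= mulr_sumr.
  apply: ler_sum => u _.
  have [->|qsu] := eqVneq (q s u) 0; first by rewrite !(mul0r, mulr0, subrr, addr0, oppr0).
  have := jump_exponent t (Y_bound s) (Y_jump qsu); rewrite [Y s + (Y u - Y s)]addrC subrK.
  set w := _ / gwidth t => hw.
  have -> : gtest t u = gtest t s * expR w.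
    by rewrite /gtest -expRD; congr expR; rewrite /w; ring.
  rewrite (_ : q s u * (gtest t s * expR w - gtest t s) =
    gtest t s * (q s u * (expR w - 1))); last by ring.
  rewrite ler_wpM2l //; apply: (le_trans (ler_wpM2l (q_ge0 s u) hw)).
  by rewrite le_eqVlt; apply/orP; left; apply/eqP; ring.
have hv0 : v0 / n <= v by exact: Y_var_ge.
have hv1 : v <= v1 / n by exact: Y_var_le.
apply: (le_trans (lerD (lexx _) genF)); rewrite /dgtest -mulrDr ler_wpM2l //.
set r := gwidth t in r0 rn *.
have yd : - (Y s / r) * (generator q Y s - mu * Y s) <=
    (`|Y s| / r) * (E * (n^-1 + V s)).
  apply: (le_trans (ler_norm _)); rewrite normrM normrN normrM.
  by rewrite [`|r^-1|]gtr0_norm ?invr_gt0 // ler_wpM2l // divr_ge0 // ltW.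
have t1 : 2 * gexp * M / n / r <= v / (2 * r).
  rewrite ler_pdivrMr //.
  have -> : v / (2 * r) * r = v / 2 by field.
  have -> : 2 * gexp * M / n = (v0 / n) / 2.
    by rewrite /gexp; field; rewrite n0 gt_eqF.
  lra.
have t2 : 8 * Y s ^+ 2 / r ^+ 2 * v <= Y s ^+ 2 * (2 * M / n / r ^+ 2).
  have -> : 8 * Y s ^+ 2 / r ^+ 2 * v = Y s ^+ 2 * (8 * v / r ^+ 2) by ring.
  rewrite ler_wpM2l ?sqr_ge0 // ler_wpM2r ?invr_ge0 ?sqr_ge0 //.
  have : 4 * v1 / n <= M / n by rewrite ler_wpM2r // invr_ge0 ltW.
  lra.
have -> : 2 * gexp * M / n / r +
   Y s ^+ 2 * (2 * mu / r - 2 * M / n / r ^+ 2) +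
   (- (2 * Y s / r) * generator q Y s - v / (2 * r) + 8 * Y s ^+ 2 / r ^+ 2 * v) =
   (2 * gexp * M / n / r - v / (2 * r)) +
   (8 * Y s ^+ 2 / r ^+ 2 * v - Y s ^+ 2 * (2 * M / n / r ^+ 2)) +
   2 * (- (Y s / r) * (generator q Y s - mu * Y s)) by ring.
have -> : 2 * (`|Y s| / r) * (E * (n^-1 + V s)) =
  2 * (`|Y s| / r * (E * (n^-1 + V s))) by ring.
lra.
Qed.

(* With [z^2 r >= 1], the bound [x <= z (1 + x^2 r)] for [x = |Y| / r] follows
   from [1 + u <= expR u]. *)
Let gtest_slope t s :
  gtest t s * (`|Y s| / gwidth t) <=
  expR (- gexp * ln K) * (Num.sqrt (n / K) * expR (- (mu * t))).
Proof.
have r0 := gwidth_gt0 t; have rn : gwidth t != 0 by rewrite gt_eqF.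
set z := Num.sqrt (n / K) * expR (- (mu * t)).
have z0 : 0 < z by rewrite mulr_gt0 ?expR_gt0 // sqrtr_gt0 divr_gt0.
have zr : 1 <= z ^+ 2 * gwidth t.
  rewrite /z exprMn sqr_sqrtr ?divr_ge0 ?(ltW n_gt0) ?(ltW K_gt0) // -expRM_natl.
  apply: (@le_trans _ _ (n / K * expR (2 * - (mu * t)) * (K * expR (2 * mu * t) / n))).
    rewrite (_ : _ * _ = expR (2 * - (mu * t)) * expR (2 * mu * t)); last first.
      by field; rewrite n0 gt_eqF.
    by rewrite -expRD (_ : _ + _ = 0) ?expR0 //; ring.
  rewrite ler_wpM2l ?mulr_ge0 ?expR_ge0 ?invr_ge0 ?(ltW n_gt0) ?(ltW K_gt0) //.
  rewrite ler_wpM2r ?invr_ge0 ?(ltW n_gt0) // lerDr divr_ge0 // ltW //.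
rewrite /gtest expRD -mulrA ler_pM ?expR_ge0 ?mulr_ge0 ?invr_ge0 ?(ltW r0) //.
  rewrite ler_expR !mulNr lerN2 ler_wpM2l // ler_ln ?posrE //.
  by rewrite lerDr mulr_ge0 ?expR_ge0 // divr_ge0 // ltW.
rewrite expRN mulrC ler_pdivrMr ?expR_gt0 //.
apply: (@le_trans _ _ (z * (1 + Y s ^+ 2 / gwidth t))); last first.
  by rewrite ler_wpM2l ?(ltW z0) // expR_ge1Dx // divr_ge0 ?sqr_ge0 // ltW.
rewrite -[Y s ^+ 2]real_normK ?num_real //.
set a := `|Y s|; set r := gwidth t in r0 rn zr *.
have -> : a ^+ 2 / r = (a / r) ^+ 2 * r by field.
have a0 : 0 <= a / r by apply: divr_ge0; [exact: normr_ge0|exact: ltW].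
move: (a / r) a0 => x x0.
rewrite -(ler_pM2l z0) -subr_ge0.
have -> : z * (z * (1 + x ^+ 2 * r)) - z * x =
  x ^+ 2 * (z ^+ 2 * r - 1) + ((z - x / 2) ^+ 2 + 3 / 4 * x ^+ 2) by field.
apply: addr_ge0; first by apply: mulr_ge0; [exact: sqr_ge0|rewrite subr_ge0].
apply: addr_ge0; first exact: sqr_ge0.
by apply: mulr_ge0; [exact: divr_ge0|exact: sqr_ge0].
Qed.

(** On the event [gtest T] is bounded below, and its mean is at most its initial
    value plus the accumulated drift error. That error is weighted by the slope
    [gtest * |Y| / gwidth] of the test function, which decreases like
    [exp(- mu t)] while the mean of [V] grows like [exp(2 mu t)]. *)
Lemma anticoncentration :
  mean P X T (fun s => (Y s ^+ 2 <= gwidth T)%R%:R) <=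
  expR (1 + gexp * ln (gscale T)) *
  (expR (- gexp * ln (M / mu)) + 2 * E * (1 + KV) / mu *
   expR (- gexp * ln K) * (Num.sqrt (n / K) / n) * expR (mu * T)).
Proof.
pose C := expR (- gexp * ln K) * Num.sqrt (n / K).
have C0 : 0 <= C by rewrite mulr_ge0 ?expR_ge0 // sqrtr_ge0.
have hV s : 0 <= E * (n^-1 + V s) by apply: le_trans (Y_drift s).
pose D := 2 * C * E * (1 + KV) / n.
have hb (t : R) : is_derive t 1 (fun t => D / mu * expR (mu * t)) (D * expR (mu * t)).
  have h1 := is_derive_expR_comp (is_derive_scale mu (is_derive_var t)).
  by apply: is_derive_eq (is_derive_scale (D / mu) h1) _; field.
have hd t : 0 < t < T ->
    mean P X t (fun s => dgtest t s + generator q (gtest t) s) <= D * expR (mu * t).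
  move=> /andP[t0 _].
  apply: (@le_trans _ _ (mean P X t (fun s =>
      2 * C * expR (- (mu * t)) * E * (n^-1 + V s)))).
    apply: mean_le => s; apply: (le_trans (gtest_drift t s)).
    rewrite (_ : _ * _ = 2 * (gtest t s * (`|Y s| / gwidth t)) * (E * (n^-1 + V s)));
      last by ring.
    rewrite -[leRHS]mulrA ler_wpM2r // -[leRHS]mulrA ler_wpM2l //.
    by apply: (le_trans (gtest_slope t s)); rewrite mulrA.
  rewrite meanZ meanD (mean_cst mc _ (ltW t0)).
  have tv := V_mean (ltW t0).
  have e0 := expR_gt0 (mu * t).
  have e1 : 1 <= expR (mu * t) by rewrite -expR0 ler_expR mulr_ge0 // ltW.
  have e2 : expR (2 * mu * t) = expR (mu * t) ^+ 2 by rewrite -expRM_natl mulrA.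
  apply: (@le_trans _ _ (2 * C * expR (- (mu * t)) * E *
      (n^-1 * ((1 + KV) * expR (mu * t) ^+ 2)))).
    rewrite ler_wpM2l //; first by rewrite !mulr_ge0 ?expR_ge0.
    rewrite mulrDl mul1r mulrDr; apply: lerD.
      by rewrite ler_peMr ?invr_ge0 ?(ltW n_gt0) // exprn_ege1.
    by apply: (le_trans tv); rewrite e2 le_eqVlt; apply/orP; left; apply/eqP; ring.
  rewrite expRN /D le_eqVlt; apply/orP; left; apply/eqP; field.
  by rewrite n0 gt_eqF.
have := mean_drift_le mc T_ge0 is_derive_gtest hb hd.
set m := mean P X T (gtest T) => hm.
have m0 : mean P X 0 (gtest 0) <= expR (- gexp * ln (M / mu)).
  rewrite -[leRHS](@mean_cst _ _ _ _ _ _ _ mc 0) //; apply: mean_le => s.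
  rewrite ler_expR -[leRHS]subr0; apply: lerB; last by rewrite divr_ge0 ?sqr_ge0 // ltW.
  rewrite !mulNr lerN2 ler_wpM2l // ler_ln ?posrE ?divr_gt0 //.
  by rewrite /gscale mulr0 expR0 mulr1 lerDl ltW.
apply: (@le_trans _ _ (expR (1 + gexp * ln (gscale T)) * m)).
  rewrite /m -meanZ; apply: mean_le => s.
  rewrite /gtest -expRD.
  have [hs|_] := boolP (Y s ^+ 2 <= gwidth T); last exact: expR_ge0.
  rewrite -[leLHS]expR0 ler_expR.
  have : Y s ^+ 2 / gwidth T <= 1 by rewrite ler_pdivrMr // mul1r.
  lra.
rewrite ler_wpM2l ?expR_ge0 //.
apply: (le_trans hm); apply: lerD => //.
rewrite mulr0 expR0 mulr1.
have D0 : 0 <= D / mu.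
  by rewrite /D !mulr_ge0 ?invr_ge0 ?(ltW n_gt0) ?(ltW mu_gt0) // addr_ge0.
apply: (@le_trans _ _ (D / mu * expR (mu * T))); first by lra.
by rewrite le_eqVlt; apply/orP; left; apply/eqP; rewrite /D /C; ring.
Qed.

End Anticoncentration.

(** * The size of the fields *)

Section InitialLaw.
Context {R : realType}.
Variables (N : nat) (d : measure_display) (Omega : measurableType d)
  (P : probability Omega R) (q : config N -> config N -> R)
  (sigma : R -> Omega -> config N).
Hypotheses (mc : markov_chain P q sigma) (fair : fair_initial P (sigma 0))
  (N_gt0 : (0 < N)%N).

Let both (i : bool) (x y : 'I_N) (b : bool) : pred (config N) :=
  fun s => (pop s i x == b) && (pop s i y == b).

Lemma initial_both i x y b : x != y ->
  mean P sigma 0 (fun s => (both i x y b s)%:R) = 4^-1.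
Proof.
move=> xy; apply: EFin_inj; rewrite -(probability_law mc _ (lexx 0)).
case: fair => indep half.
have := indep [set (i, x); (i, y)]%SET (fun _ => [set b]%SET).
rewrite big_setU1 /= ?big_set1; last first.
  by rewrite finset.in_set1 xpair_eqE eqxx.
have halfE z : P [set w | site_spin (sigma 0 w) (i, z) \in [set b]%SET] = (2^-1)%:E.
  rewrite -(half (i, z) b); congr (P _); apply/seteqP; split=> w /=;
    by rewrite finset.in_set1 => /eqP.
rewrite !halfE -EFinM (_ : 2^-1 * 2^-1 = 4^-1 :> R); last by field.
move=> <-; congr (P _); apply/seteqP; split=> w /=.
  move=> /andP[/eqP hx /eqP hy] j; rewrite finset.in_set2 finset.in_set1 => /orP[] /eqP ->;
    by rewrite /site_spin /=; move: hx hy; rewrite /pop; case: (i) => /= h1 h2; rewrite ?h1 ?h2.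
move=> h; have := h (i, x); have := h (i, y); rewrite !finset.in_set2 !eqxx orbT /= !finset.in_set1.
by move=> /(_ isT) h1 /(_ isT) h2; move: h1 h2; rewrite /both /pop /site_spin /=;
  case: (i) => -> ->.
Qed.

Lemma initial_uncorrelated i (x y : 'I_N) :
  mean P sigma 0 (fun s => spin (pop s i x) * spin (pop s i y)) = (x == y)%:R.
Proof.
case: eqVneq => [<-|xy].
  rewrite -(mean_cst mc 1 (lexx 0)).
  by apply: eq_bigr => s _; rewrite -expr2 spin_sqr.
transitivity (mean P sigma 0 (fun s =>
    2 * ((both i x y true s)%:R + (both i x y false s)%:R) + -1)).
  apply: eq_bigr => s _; congr (_ * _).
  by rewrite /both; case: (pop s i x); case: (pop s i y); rewrite /=; ring.
rewrite meanD meanZ meanD !initial_both // (mean_cst mc _ (lexx 0)).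
by rewrite mulr0n; field.
Qed.

(** By pairwise independence the double sum reduces to its diagonal, which has
    [N] terms of order [1 / N^2]. *)
Lemma initial_spin_coef b i k :
  mean P sigma 0 (fun s => spin_coef b i k s ^+ 2) <= N%:R^-1.
Proof.
have N0 : N%:R != 0 :> R by rewrite pnatr_eq0 -lt0n.
have -> : mean P sigma 0 (fun s => spin_coef b i k s ^+ 2) =
    mean P sigma 0 (fun s => N%:R^-1 ^+ 2 * \sum_(x < N) \sum_(y < N)
      (trig b (angle N k x) * trig b (angle N k y)) *
      (spin (pop s i x) * spin (pop s i y))).
  apply: eq_bigr => s _; congr (_ * _).
  rewrite /spin_coef /tcoef exprMn; congr (_ * _).
  rewrite expr2 mulr_suml; apply: eq_bigr => x _; rewrite mulr_sumr.
  by apply: eq_bigr => y _; ring.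
rewrite meanZ mean_sum.
rewrite (eq_bigr (fun x : 'I_N => trig b (angle N k x) ^+ 2)); last first.
  move=> x _; rewrite mean_sum (bigD1 x) //= big1 => [|y yx]; last first.
    by rewrite meanZ initial_uncorrelated eq_sym (negPf yx) mulr0.
  by rewrite meanZ initial_uncorrelated eqxx mulr1 addr0 expr2.
apply: (@le_trans _ _ (N%:R^-1 ^+ 2 * \sum_(x < N) 1)).
  rewrite ler_wpM2l ?sqr_ge0 //; apply: ler_sum => x _.
  by rewrite -real_normK ?num_real // expr_le1 // trig_le1.
rewrite sumr_const card_ord -[1 *+ N]/(N%:R).
by rewrite le_eqVlt; apply/orP; left; apply/eqP; field.
Qed.

End InitialLaw.

Section EnergyBound.
Context {R : realType}.
Variables (beta1 beta2 tau1 tau2 lambda mu : R).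
Hypotheses (beta1_gt0 : 0 < beta1) (beta2_gt0 : 0 < beta2)
  (tau1_gt0 : 0 < tau1) (tau2_gt0 : 0 < tau2) (lambda_gt0 : 0 < lambda)
  (mu_gt0 : 0 < mu).

Local Notation betaf := (betaf beta1 beta2).
Local Notation tauf := (tauf tau1 tau2).
Local Notation t1 := (couplingf beta1 beta2 lambda true).
Local Notation t2 := (couplingf beta1 beta2 lambda false).
Local Notation kc N i k := (@kcoef R tau1 tau2 N i k).

Let tauf_gt0 i : 0 < tauf i. Proof. by case: i. Qed.

Definition phi_coef i (m : nat) : R := phi_hat (tauf i) (Posz m).

Lemma kcoef_error (K : nat) : exists2 C, 0 <= C & forall i m N, (m < K)%N ->
  (0 < N)%N -> `|kc N i m - phi_coef i m| <= C / N%:R.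
Proof.
elim: K => [|K [C C0 hC]]; first by exists 0.
have [D D0 hD] := kernel_coef_theta_error (tauf_gt0 true) K.
have [E E0 hE] := kernel_coef_theta_error (tauf_gt0 false) K.
exists (C + D + E) => [|i m N]; first by rewrite !addr_ge0.
rewrite ltnS leq_eqVlt => /orP[/eqP ->|mK] N0.
  case: i; [apply: (le_trans (hD N N0))|apply: (le_trans (hE N N0))];
    by rewrite ler_wpM2r ?invr_ge0 //; lra.
by apply: (le_trans (hC i m N mK N0)); rewrite ler_wpM2r ?invr_ge0 //; lra.
Qed.

Lemma kcoef_decay : exists2 B, 0 <= B & forall i N k, (k < N)%N ->
  `|kc N i k| * (minn k (N - k))%:R <= B.
Proof.
have [B B0 hB] := kernel_coef_theta_decay (tauf_gt0 true).
have [C C0 hC] := kernel_coef_theta_decay (tauf_gt0 false).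
exists (B + C) => [|i N k kN]; first by rewrite addr_ge0.
by case: i; [apply: (le_trans (hB N k kN))|apply: (le_trans (hC N k kN))]; lra.
Qed.

(** Folding sends each frequency to its distance to the multiples of [N], in
    which the coefficients decay. *)
Lemma kcoef_fold i N k : (k < N)%N -> kc N i (minn k (N - k)) = kc N i k.
Proof.
move=> kN; have [//|_] := leqP k (N - k)%N.
by apply: kernel_coef_rev; rewrite ?(leq_ltn_trans _ kN) // ltnW.
Qed.

Lemma weight_sum_bounded : exists2 W, 0 <= W & forall N, (0 < N)%N ->
  \sum_(k < N) weight tau1 tau2 N k <= W.
Proof.
have [B B0 hB] := theta_bounded (tauf_gt0 true).
have [C C0 hC] := theta_bounded (tauf_gt0 false).
exists (B ^+ 2 + C ^+ 2) => [|N N0]; first by rewrite addr_ge0 ?sqr_ge0.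
rewrite /weight big_split /=; apply: lerD.
  apply: sum_kernel_coef_sqr => // x _.
  by have /andP[h1 h2] := hB (x%:R / N%:R); rewrite ger0_norm.
apply: sum_kernel_coef_sqr => // x _.
by have /andP[h1 h2] := hC (x%:R / N%:R); rewrite ger0_norm.
Qed.

Definition total_energy N (s : config N) : R :=
  field_energy tau1 tau2 s true + field_energy tau1 tau2 s false.

Lemma jump_rate_ge0 N (s u : config N) :
  0 <= jump_rate beta1 beta2 tau1 tau2 lambda s u.
Proof.
apply: addr_ge0; apply: sumr_ge0 => x _.
  by rewrite (@rate1E _ beta1 beta2 tau1 tau2 lambda); exact: rate_ge0.
by rewrite (@rate2E _ beta1 beta2 tau1 tau2 lambda); exact: rate_ge0.
Qed.

Let a_ (m : nat) : R := -1 + alpha beta1 lambda * phi_coef true m.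
Let d_ (m : nat) : R := -1 + alpha beta2 lambda * phi_coef false m.

Hypothesis growth : forall m : nat, exists p q r c,
  growth_form (a_ m) (d_ m) t1 t2 mu p q r c.

(** Frequencies whose distance to the multiples of [N] is below a threshold [K]
    get the Lyapunov form of their limiting system, and the discretization error
    costs a multiple of [1 / N]. Beyond [K] the kernel is too weak to overcome
    the relaxation of the spins, and the diagonal form does not grow. The
    initial value is of order [1 / N] by independence, and [mean_growth]
    concludes. *)
Lemma mean_total_energy : exists2 KV, 0 <= KV & forall (N : nat)
    (d : measure_display) (Omega : measurableType d) (P : probability Omega R)
    (sigma : R -> Omega -> config N), (0 < N)%N ->
  spin_process beta1 beta2 tau1 tau2 lambda P sigma -> forall t, 0 <= t ->
  mean P sigma t (@total_energy N) <= KV / N%:R * expR (2 * mu * t).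
Proof.
have t10 : 0 < t1 by apply: tanhR_gt0; rewrite mulr_gt0.
have t20 : 0 < t2 by apply: tanhR_gt0; rewrite mulr_gt0.
have [Bd Bd0 hBd] := kcoef_decay.
have [W W0 hW] := weight_sum_bounded.
have al0 i : 0 < alpha (betaf i) lambda.
  by rewrite divr_gt0 ?exprn_gt0 ?coshR_gt0 //; case: i.
pose am := alpha beta1 lambda + alpha beta2 lambda.
have am0 : 0 < am by rewrite addr_gt0 //; [exact: (al0 true)|exact: (al0 false)].
(* Beyond [K], the decay of the coefficients makes both diagonal entries of the
   linear part nonpositive. *)
pose K := (Num.truncn (Bd * am)).+1.
have [C C0 hC] := kcoef_error K.
have [p [q [r [B [c [B0 c0 hB hc [hf hd]]]]]]] := uniform_growth_forms K t10 t20 growth.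
pose D := 2 * B * am * C.
have D0 : 0 <= D.
  by apply: mulr_ge0 => //; apply: mulr_ge0; [exact: mulr_ge0|exact: ltW].
pose K2 := lyap_nonlin beta1 beta2 B c W.
pose K1 := lyap_const B D W.
have K10 : 0 <= K1.
  by apply: addr_ge0; (apply: mulr_ge0; last by []); apply: mulr_ge0.
have K20 : 0 <= K2 by exact: lyap_nonlin_ge0.
pose KV := 2 / c * ((1 + K2 / (2 * mu) * Num.sqrt (8 * B * W)) ^+ 2 *
  (8 * B * W + K1 / (2 * mu))).
have mu2 : 0 < 2 * mu by rewrite mulr_gt0.
exists KV => [|N d Omega P sigma N0 [mc fair] t t0].
  rewrite mulr_ge0 ?divr_ge0 ?(ltW c0) // mulr_ge0 ?sqr_ge0 //.
  by rewrite addr_ge0 ?mulr_ge0 // invr_ge0 ltW.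
have Np : 0 < N%:R :> R by rewrite ltr0n.
pose fold k := minn k (N - k).
pose V := @lyap R tau1 tau2 N (p \o fold) (q \o fold) (r \o fold).
have cb k : (k < N)%N -> [/\ `|(p \o fold) k| <= B, `|(q \o fold) k| <= B &
    `|(r \o fold) k| <= B] by move=> _; exact: hB.
have pos k u v : (k < N)%N -> c * (u ^+ 2 + v ^+ 2) <=
    qform (p \o fold) (q \o fold) (r \o fold) k u v by move=> _; exact: hc.
have dis k u v : (k < N)%N -> `|u| <= 1 -> `|v| <= 1 ->
    qf_flow (-1 + alpha beta1 lambda * kc N true k)
      (-1 + alpha beta2 lambda * kc N false k) t1 t2
      ((p \o fold) k) ((q \o fold) k) ((r \o fold) k) u v <=
    mu * qform (p \o fold) (q \o fold) (r \o fold) k u v + D / N%:R.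
  move=> kN u1 v1; rewrite -!(kcoef_fold _ kN) /qform /qf_flow /qf /= -/(fold k).
  have DN : 0 <= D / N%:R by rewrite divr_ge0.
  have [mK|Km] := ltnP (fold k) K; last first.
    have [pE qE rE] := hd _ Km.
    have small i : alpha (betaf i) lambda * kc N i (fold k) <= 1.
      have := hBd i N k kN; rewrite -(kcoef_fold i kN) -/(fold k) => hk.
      have fk : Bd * am <= (fold k)%:R.
        apply/ltW; apply: (lt_le_trans (truncnS_gt _)).
        by rewrite ler_nat.
      have aam : alpha (betaf i) lambda <= am.
        by move: (al0 true) (al0 false) => /= /ltW h1 /ltW h2; case: (i);
          rewrite /am /= ?lerDl ?lerDr.
      have fp : 0 < (fold k)%:R :> R by rewrite ltr0n (leq_trans _ Km).
      have k1 : kc N i (fold k) <= Bd / (fold k)%:R.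
        by rewrite ler_pdivlMr //; apply: le_trans hk; rewrite ler_wpM2r // ler_norm.
      apply: (@le_trans _ _ (am * (Bd / (fold k)%:R))).
        apply: (@le_trans _ _ (alpha (betaf i) lambda * (Bd / (fold k)%:R))).
          by rewrite ler_wpM2l // ltW.
        by rewrite ler_wpM2r // divr_ge0.
      by rewrite mulrA ler_pdivrMr // mul1r mulrC.
    have s1 := small true; have s2 := small false.
    have := @diagonal_growth_form _ (-1 + alpha beta1 lambda * kc N true (fold k))
      (-1 + alpha beta2 lambda * kc N false (fold k)) t1 t2 mu u v mu_gt0 t10 t20.
    rewrite /qf_flow /qf pE qE rE => /(_ _ _)/andP[| |h1 h2].
    - by rewrite /= in s1; lra.
    - by rewrite /= in s2; lra.
    - by apply: (le_trans h1); rewrite addr_ge0.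
  have [pB qB rB] := hB (fold k).
  have := hf (fold k) u v mK; rewrite /qf_flow /qf /a_ /d_.
  have e1 := hC true _ N mK N0; have e2 := hC false _ N mK N0.
  move: e1 e2; set x1 := kc _ _ _; set x2 := kc _ _ _.
  set f1 := phi_coef _ _; set f2 := phi_coef _ _ => e1 e2 h.
  rewrite -subr_ge0.
  set P1 := p (fold k); set Q1 := q (fold k); set R1 := r (fold k).
  rewrite -/P1 -/Q1 -/R1 in h pB qB rB.
  have bnd (x y al g : R) : `|x| <= B -> `|y| <= B -> 0 <= al -> `|g| <= C / N%:R ->
      forall w, `|w| <= 1 -> (x * u + y * v) * (al * g * w) <= 2 * B * (al * (C / N%:R)).
    move=> hx hy hal hg w w1; apply: (le_trans (ler_norm _)); rewrite normrM.
    apply: ler_pM => //.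
      apply: (le_trans (ler_normD _ _)); rewrite !normrM (_ : 2 * B = B * 1 + B * 1); last by ring.
      by apply: lerD; apply: ler_pM.
    rewrite !normrM (ger0_norm hal) -[leRHS]mulr1; apply: ler_pM => //.
      by rewrite mulr_ge0.
    by apply: ler_wpM2l.
  have b1 := bnd _ _ _ _ pB qB (ltW (al0 true)) e1 u u1.
  have b2 := bnd _ _ _ _ qB rB (ltW (al0 false)) e2 v v1.
  have DE : D / N%:R = 2 * B * (alpha (betaf true) lambda * (C / N%:R)) +
      2 * B * (alpha (betaf false) lambda * (C / N%:R)) by rewrite /D /am /=; ring.
  rewrite DE /= in b1 b2 *.
  set DN1 := 2 * B * (alpha beta1 _ * _) in b1 *.
  set DN2 := 2 * B * (alpha beta2 _ * _) in b2 *.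
  rewrite (_ : _ - _ = (mu * (P1 * (u * u) + 2 * Q1 * (u * v) + R1 * (v * v)) -
    ((P1 * u + Q1 * v) * ((-1 + alpha beta1 lambda * f1) * u + t1 * v) +
     (Q1 * u + R1 * v) * (- t2 * u + (-1 + alpha beta2 lambda * f2) * v))) +
    (DN1 - (P1 * u + Q1 * v) * (alpha beta1 lambda * (x1 - f1) * u)) +
    (DN2 - (Q1 * u + R1 * v) * (alpha beta2 lambda * (x2 - f2) * v))); last by ring.
  by apply: addr_ge0; [apply: addr_ge0|]; rewrite subr_ge0.
have V0 s : 0 <= V s by exact: (lyap_ge0 tau1 tau2 c0 pos s).
have VM s : V s <= 8 * B * W by exact: (lyap_le B0 cb (hW N N0) s).
have Vgen s : generator (jump_rate beta1 beta2 tau1 tau2 lambda) V s <=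
    2 * mu * V s + K1 * N%:R^-1 + K2 * (V s * Num.sqrt (V s)).
  rewrite generator_local.
  exact: (gen_lyap N0 B0 c0 D0 cb pos dis (hW N N0) s).
have V00 : mean P sigma 0 V <= 8 * B * W / N%:R.
  apply: (@le_trans _ _ (mean P sigma 0 (fun s => \sum_(b : bool) \sum_(k < N)
      weight tau1 tau2 N k * (2 * B * (spin_coef b true k s ^+ 2 + spin_coef b false k s ^+ 2))))).
    apply: mean_le => s; apply: ler_sum => b _; apply: ler_sum => k _.
    by rewrite ler_wpM2l ?weight_ge0 // (qform_le cb).
  rewrite mean_sum.
  apply: (@le_trans _ _ (\sum_(b : bool) \sum_(k < N) weight tau1 tau2 N k * (4 * B / N%:R))).
    apply: ler_sum => b _; rewrite mean_sum; apply: ler_sum => k _.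
    rewrite meanZ ler_wpM2l ?weight_ge0 // meanZ meanD.
    have h1 := initial_spin_coef mc fair N0 b true k.
    have h2 := initial_spin_coef mc fair N0 b false k.
    apply: (@le_trans _ _ (2 * B * (N%:R^-1 + N%:R^-1))).
      by rewrite ler_wpM2l ?mulr_ge0 // lerD.
    by rewrite le_eqVlt; apply/orP; left; apply/eqP; ring.
  rewrite big_bool /= -!mulr_suml.
  have BN : 0 <= 4 * B / N%:R by rewrite divr_ge0 ?mulr_ge0.
  have := ler_wpM2r BN (hW N N0).
  have -> : 8 * B * W / N%:R = 2 * (W * (4 * B / N%:R)) by ring.
  lra.
have Vb s : 0 <= V s <= 8 * B * W by rewrite V0 VM.
have Ni : 0 <= N%:R^-1 :> R by rewrite invr_ge0.
have := @mean_growth R _ d Omega P _ sigma mc (@jump_rate_ge0 N) V mu K1 K2 (8 * B * W)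
  N%:R^-1 mu_gt0 K10 K20 Ni Vb Vgen t t0.
move=> hmean.
apply: (@le_trans _ _ (2 / c * mean P sigma t V)).
  rewrite -meanZ; apply: mean_le => s.
  have h i := field_energy_le_lyap tau1 tau2 N0 c0 pos s i.
  have h1 := h true; have h2 := h false.
  rewrite /total_energy (_ : 2 / c * V s = V s / c + V s / c); last by ring.
  exact: lerD.
have c2 : 0 <= 2 / c by rewrite divr_ge0 // ltW.
apply: (le_trans (ler_wpM2l c2 hmean)).
have h0 : mean P sigma 0 V + K1 / (2 * mu) * N%:R^-1 <=
    (8 * B * W + K1 / (2 * mu)) / N%:R by rewrite [leRHS]mulrDl lerD2r.
rewrite /KV; move: h0; set Z := (1 + _) ^+ 2; set k0 := 8 * B * W + _ => h0.
rewrite (_ : 2 / c * (Z * k0) / N%:R * _ = 2 / c * (Z * (k0 / N%:R) * expR (2 * mu * t)));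
  last by ring.
by rewrite ler_wpM2l // ler_wpM2r ?expR_ge0 // ler_wpM2l ?sqr_ge0.
Qed.

End EnergyBound.

(** * The unstable mode *)

Section UnstableMode.
Context {R : realType}.
Variables (beta1 beta2 tau1 tau2 lambda mu : R).
Hypotheses (beta1_gt0 : 0 < beta1) (beta2_gt0 : 0 < beta2)
  (tau1_gt0 : 0 < tau1) (tau2_gt0 : 0 < tau2) (lambda_gt0 : 0 < lambda)
  (mu_gt0 : 0 < mu).

Local Notation betaf := (betaf beta1 beta2).
Local Notation tauf := (tauf tau1 tau2).
Local Notation t1 := (couplingf beta1 beta2 lambda true).
Local Notation t2 := (couplingf beta1 beta2 lambda false).
Local Notation kc N i k := (@kcoef R tau1 tau2 N i k).
Local Notation phi_coef := (phi_coef tau1 tau2).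

(** The kernels are bounded, hence so are the local fields, uniformly in [N]. *)
Lemma rate_lower_bound : exists2 r0 : R, 0 < r0 & forall N (s : config N) i x,
  (0 < N)%N -> r0 <= rate beta1 beta2 tau1 tau2 lambda s i x.
Proof.
have [B B0 hB] : exists2 B, 0 <= B & forall i r, 0 <= theta (tauf i) r <= B.
  have [B B0 hB] := theta_bounded tau1_gt0; have [C C0 hC] := theta_bounded tau2_gt0.
  exists (B + C) => [|i r]; first exact: addr_ge0.
  by case: i; rewrite /=; [have /andP[h1 h2] := hB r|have /andP[h1 h2] := hC r];
    rewrite h1 /=; lra.
pose y := (beta1 + beta2) * (B + lambda).
exists ((1 - tanhR y) / 2); first by rewrite divr_gt0 // subr_gt0 tanhR_lt1.
move=> N s i x N0; rewrite /rate ler_wpM2r ?invr_ge0 // lerD2l lerN2.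
apply: (le_trans (ler_norm _)); rewrite normrM norm_spin mul1r.
set z := local_arg _ _ _ _ _ _ _ _.
have zy : `|z| <= y.
  have fB : `|field tau1 tau2 s i x| <= B.
    rewrite field_circulant // /circulant normrM ger0_norm ?invr_ge0 //.
    rewrite ler_pdivrMl ?ltr0n // [leRHS]mulr_natl.
    apply: (le_trans (ler_norm_sum _ _ _)).
    apply: (@le_trans _ _ (\sum_(j < N) B)); last by rewrite sumr_const card_ord.
    apply: ler_sum => j _; rewrite normrM norm_spin mul1r.
    by have /andP[h1 h2] := hB i (x%:R / N%:R - j%:R / N%:R); rewrite ger0_norm.
  have b0 : 0 <= betaf i by case: (i); exact: ltW.
  have bb : betaf i <= beta1 + beta2.
    by case: (i); rewrite /= ?lerDl ?lerDr ltW.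
  rewrite /z /local_arg; move: fB; move: (field tau1 tau2 s i x) => f fB.
  apply: (le_trans (ler_normD _ _)).
  have sg1 : `|signf i| = 1 :> R by case: (i); rewrite /= ?normrN normr1.
  rewrite !normrM sg1 norm_spin mulr1 (ger0_norm b0) (gtr0_norm lambda_gt0).
  rewrite mul1r -mulrDr /y; apply: ler_pM => //.
    by rewrite addr_ge0 // ltW.
  by rewrite lerD2r.
rewrite ler_norml; move: zy; rewrite ler_norml => /andP[z1 z2].
by apply/andP; split; rewrite -?tanhRN; exact: tanhR_nondecreasing.
Qed.

Variables l1 l2 : R.

(** For a left eigenvector [(l1, l2)] of the unstable eigenvalue, the cosine
    part of the coordinate that grows autonomously in the linearized system; a
    lower bound on this part is one on the norm. *)
Definition leading_mode N (s : config N) : R :=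
  l1 * spin_coef true true 1 s + l2 * spin_coef true false 1 s.

Local Notation Y := leading_mode.
Local Notation gen := (local_generator beta1 beta2 tau1 tau2 lambda).
Let l := `|l1| + `|l2|.
Let lf (i : bool) : R := if i then l1 else l2.

Let lf_le i : `|lf i| <= l.
Proof. by case: i; rewrite /l /= ?lerDl ?lerDr. Qed.

Lemma leading_mode_le N (s : config N) (D : R) :
  `|spin_coef true true 1 s| <= D -> `|spin_coef true false 1 s| <= D ->
  `|Y s| <= l * D.
Proof.
move=> h1 h2; apply: (le_trans (ler_normD _ _)); rewrite /l mulrDl.
by apply: lerD; rewrite normrM ler_wpM2l.
Qed.

Lemma leading_mode_flip N (s : config N) i x : Y (flip_at s i x) - Y s =
  - (2 * N%:R^-1 * spin (pop s i x) * cos (angle N 1 x)) * lf i.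
Proof.
have h j := spin_coef_flip true j i 1 s x.
rewrite /Y (_ : _ - _ =
  l1 * (spin_coef true true 1 (flip_at s i x) - spin_coef true true 1 s) +
  l2 * (spin_coef true false 1 (flip_at s i x) - spin_coef true false 1 s)); last by ring.
by rewrite !h; case: (i) => /=; ring.
Qed.

Lemma leading_mode_jump N (s u : config N) :
  jump_rate beta1 beta2 tau1 tau2 lambda s u != 0 -> `|Y u - Y s| <= 2 * l / N%:R.
Proof.
have [[i [x ->]] _|none] := pselect (exists i x, u = flip_at s i x).
  rewrite leading_mode_flip !normrM normrN !normrM norm_spin normr_nat mulr1.
  rewrite [`|N%:R^-1|]ger0_norm ?invr_ge0 //.
  rewrite [leRHS](_ : _ = 2 * N%:R^-1 * 1 * l); last by ring.
  by apply: ler_pM => //; rewrite ?mulr_ge0 // ler_wpM2l ?mulr_ge0 // cos_max.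
rewrite /jump_rate !big1 ?addr0 ?eqxx // => x /eqP ux; case: none;
  by [exists true, x|exists false, x].
Qed.

Let varE N (s : config N) :
  \sum_u jump_rate beta1 beta2 tau1 tau2 lambda s u * (Y u - Y s) ^+ 2 =
  \sum_(i : bool) \sum_x rate beta1 beta2 tau1 tau2 lambda s i x *
    (4 * N%:R^-1 ^+ 2 * lf i ^+ 2 * cos (angle N 1 x) ^+ 2).
Proof.
transitivity (generator (jump_rate beta1 beta2 tau1 tau2 lambda)
    (fun u => (Y u - Y s) ^+ 2) s).
  by apply: eq_bigr => u _; rewrite subrr expr0n subr0.
rewrite generator_local; apply: eq_bigr => i _; apply: eq_bigr => x _.
rewrite subrr expr0n subr0; congr (_ * _).
rewrite leading_mode_flip exprMn sqrrN !exprMn spin_sqr -natrX.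
by ring.
Qed.

Lemma leading_mode_var_le N (s : config N) : (0 < N)%N ->
  \sum_u jump_rate beta1 beta2 tau1 tau2 lambda s u * (Y u - Y s) ^+ 2 <=
  4 * (l1 ^+ 2 + l2 ^+ 2) / N%:R.
Proof.
move=> N0; rewrite varE; have Nn : N%:R != 0 :> R by rewrite pnatr_eq0 -lt0n.
apply: (@le_trans _ _ (\sum_(i : bool) \sum_(x < N) 4 * N%:R^-1 ^+ 2 * lf i ^+ 2)).
  apply: ler_sum => i _; apply: ler_sum => x _.
  have c0 : 0 <= 4 * N%:R^-1 ^+ 2 * lf i ^+ 2.
    by apply: mulr_ge0; [apply: mulr_ge0 => //; exact: sqr_ge0|exact: sqr_ge0].
  rewrite -[leRHS]mul1r; apply: ler_pM => //.
  - exact: rate_ge0.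
  - by apply: mulr_ge0 => //; exact: sqr_ge0.
  - exact: rate_le1.
  - by rewrite ler_piMr // -real_normK ?num_real // expr_le1 // cos_max.
rewrite big_bool /= !sumr_const !card_ord.
rewrite -[X in X + _]mulr_natr -[X in _ + X]mulr_natr.
by rewrite le_eqVlt; apply/orP; left; apply/eqP; field.
Qed.

(** The noise never degenerates: every spin flips at rate at least [r0], and the
    squared cosines of frequency 1 average to [1 / 2] over the sites. *)
Lemma leading_mode_var_ge N (s : config N) (r0 : R) : (3 <= N)%N ->
  (forall i x, r0 <= rate beta1 beta2 tau1 tau2 lambda s i x) ->
  2 * r0 * (l1 ^+ 2 + l2 ^+ 2) / N%:R <=
  \sum_u jump_rate beta1 beta2 tau1 tau2 lambda s u * (Y u - Y s) ^+ 2.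
Proof.
move=> N3 hr; rewrite varE.
have N0 : (0 < N)%N by rewrite (leq_trans _ N3).
have Nn : N%:R != 0 :> R by rewrite pnatr_eq0 -lt0n.
apply: (@le_trans _ _ (\sum_(i : bool) \sum_(x < N)
    r0 * (4 * N%:R^-1 ^+ 2 * lf i ^+ 2 * cos (angle N 1 x) ^+ 2))); last first.
  apply: ler_sum => i _; apply: ler_sum => x _; rewrite ler_wpM2r //.
  apply: mulr_ge0; last exact: sqr_ge0.
  by apply: mulr_ge0; [apply: mulr_ge0 => //; exact: sqr_ge0|exact: sqr_ge0].
rewrite big_bool /= -!mulr_sumr sum_sqr_cos //.
by rewrite le_eqVlt; apply/orP; left; apply/eqP; field.
Qed.

Hypotheses
  (left_eigen1 : l1 * (-1 + alpha beta1 lambda * phi_coef true 1) - l2 * t2 = mu * l1)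
  (left_eigen2 : l1 * t1 + l2 * (-1 + alpha beta2 lambda * phi_coef false 1) = mu * l2).

(** On a left eigenvector the linear drift is multiplication by [mu]; what
    remains is the discretization of the kernels and the quadratic error. *)
Lemma leading_mode_drift : exists2 E, 0 <= E & forall N (s : config N), (0 < N)%N ->
  `|gen (@Y N) s - mu * Y s| <= E * (N%:R^-1 + total_energy tau1 tau2 s).
Proof.
have [C C0 hC] := kcoef_error tau1_gt0 tau2_gt0 2.
have al0 i : 0 <= alpha (betaf i) lambda.
  by rewrite divr_ge0 ?sqr_ge0 //; case: (i); exact: ltW.
have l0 : 0 <= l by rewrite addr_ge0.
pose al := alpha beta1 lambda + alpha beta2 lambda.
have alp : 0 <= al by rewrite addr_ge0 //; [exact: (al0 true)|exact: (al0 false)].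
pose bb := 2 * (beta1 ^+ 2 + beta2 ^+ 2).
have bb0 : 0 <= bb by rewrite mulr_ge0 // addr_ge0 ?sqr_ge0.
exists (l * (al * C + bb)); first by rewrite mulr_ge0 // addr_ge0 // mulr_ge0.
move=> N s N0; have Ni : 0 <= N%:R^-1 :> R by rewrite invr_ge0.
pose e i := alpha (betaf i) lambda * (kc N i 1 - phi_coef i 1) * spin_coef true i 1 s +
  drift_error beta1 beta2 tau1 tau2 lambda true i 1 s.
set V := total_energy _ _ _.
have V0 i : field_energy tau1 tau2 s i <= V.
  by rewrite /V /total_energy; case: i; rewrite ?lerDl ?lerDr field_energy_ge0.
have Vp : 0 <= V by apply: le_trans (V0 true); exact: field_energy_ge0.
have ei i : `|e i| <= al * C * N%:R^-1 + bb * V.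
  apply: (le_trans (ler_normD _ _)); apply: lerD.
    rewrite normrM normrM (ger0_norm (al0 i)) -[leRHS]mulr1 -[al * C * _]mulrA.
    apply: ler_pM => //; [by rewrite mulr_ge0| |exact: spin_coef_le1].
    apply: ler_pM => //; last exact: hC.
    by rewrite /al; have := al0 true; have := al0 false; case: (i) => /= h1 h2;
      rewrite ?lerDl ?lerDr.
  apply: (le_trans (drift_error_le _ _ _ _ _ _ _ _ _)).
  apply: ler_pM; last exact: V0.
  - by apply: mulr_ge0 => //; exact: sqr_ge0.
  - exact: field_energy_ge0.
  - by apply: ler_wpM2l => //; case: (i); rewrite /= ?lerDl ?lerDr sqr_ge0.
have E : gen (@Y N) s - mu * Y s = l1 * e true + l2 * e false.
  have -> : gen (@Y N) s = l1 * gen (spin_coef true true 1) s +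
      l2 * gen (spin_coef true false 1) s.
    by rewrite -!local_generatorZ -local_generatorD.
  rewrite !gen_spin_coef // /Y /e /signf /=.
  set x1 := spin_coef true true 1 s; set x2 := spin_coef true false 1 s.
  rewrite (_ : mu * (l1 * x1 + l2 * x2) = (mu * l1) * x1 + (mu * l2) * x2);
    last by ring.
  by rewrite -left_eigen1 -left_eigen2; ring.
rewrite E; apply: (le_trans (ler_normD _ _)).
rewrite [`|l1 * _|]normrM [`|l2 * _|]normrM.
apply: (@le_trans _ _ (l * (al * C * N%:R^-1 + bb * V))).
  by rewrite /l mulrDl; apply: lerD; rewrite ler_wpM2l.
rewrite -[leRHS]mulrA ler_wpM2l // -subr_ge0.
rewrite (_ : _ - _ = al * C * V + bb * N%:R^-1); last by ring.
by apply: addr_ge0; [apply: mulr_ge0 => //; exact: mulr_ge0|exact: mulr_ge0].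
Qed.

Let a_ (m : nat) : R := -1 + alpha beta1 lambda * phi_coef true m.
Let d_ (m : nat) : R := -1 + alpha beta2 lambda * phi_coef false m.

Hypotheses (l_neq0 : 0 < l1 ^+ 2 + l2 ^+ 2)
  (growth : forall m : nat, exists p q r c, growth_form (a_ m) (d_ m) t1 t2 mu p q r c).

(** At this time [T] one has [exp(2 mu T) = N delta]. Take [K = sqrt delta] in
    [anticoncentration]: the squared width is at least [K delta], much larger than
    the square of [l delta], and for large [N] the two terms of the bound are of
    the order of [K ^ gexp] and [sqrt K], since [gscale T <= 2 K] cancels the
    factor [K ^ (- gexp)] in front of the drift error. *)
Lemma leading_mode_not_small (e : R) : 0 < e ->
  exists2 delta0 : R, 0 < delta0 & forall delta, 0 < delta < delta0 ->
  exists N0 : nat, forall N, (N0 <= N)%N ->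
  forall (d : measure_display) (Omega : measurableType d)
    (P : probability Omega R) (sigma : R -> Omega -> config N),
  spin_process beta1 beta2 tau1 tau2 lambda P sigma ->
  mean P sigma ((2 * mu)^-1 * ln (N%:R * delta))
    (fun s => ((Y s) ^+ 2 <= (l * delta) ^+ 2)%R%:R) <= e.
Proof.
move=> e0.
have [r0 r00 hr] := rate_lower_bound.
have [E E0 hE] := leading_mode_drift.
have [KV KV0 hKV] := mean_total_energy beta1_gt0 beta2_gt0 tau1_gt0 tau2_gt0
  lambda_gt0 mu_gt0 growth.
have l0 : 0 <= l by rewrite addr_ge0.
pose L := l1 ^+ 2 + l2 ^+ 2.
pose A := 2 * l; pose v0 := 2 * r0 * L; pose v1 := 4 * L.
have A0 : 0 <= A by rewrite mulr_ge0.
have v00 : 0 < v0 by rewrite mulr_gt0 // mulr_gt0.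
have v10 : 0 < v1 by rewrite mulr_gt0.
pose M := 4 * A ^+ 2 * mu + 4 * v1.
have AA : 0 <= 4 * A ^+ 2 * mu.
  by apply: mulr_ge0; [apply: mulr_ge0 => //; exact: sqr_ge0|exact: ltW].
have M0 : 0 < M by rewrite /M ltr_wpDl // mulr_gt0.
pose g := gexp v0 M; have g0 : 0 < g by rewrite /g /gexp divr_gt0 // mulr_gt0.
pose E' := 2 * E * (1 + KV) / mu.
have E'0 : 0 <= E' by rewrite divr_ge0 ?(ltW mu_gt0) // !mulr_ge0 // addr_ge0.
have Mmu : 0 < M / mu by rewrite divr_gt0.
pose G := E' * expR (1 + g * ln 2).
have G0 : 0 <= G by rewrite mulr_ge0 ?expR_ge0.
(* Bounds on [K]: below [k1] and [k2] each term of the estimate is at most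
   [e / 2], and below [k3] the target interval is inside the width. *)
pose k1 := M / mu * expR ((ln (e / 2) - 1) / g) / 2.
have k10 : 0 < k1 by rewrite divr_gt0 // mulr_gt0 ?expR_gt0.
pose k2 := (e / (2 * (G + 1))) ^+ 2.
have G1 : 0 < G + 1 by rewrite ltr_wpDl.
have k20 : 0 < k2 by rewrite exprn_gt0 // divr_gt0 // mulr_gt0.
pose k3 := (l ^+ 2 + 1)^-1.
have k30 : 0 < k3 by rewrite invr_gt0 ltr_wpDl ?sqr_ge0.
pose kap0 := Num.min k1 (Num.min k2 k3).
have kap00 : 0 < kap0 by rewrite !lt_min k10 k20 k30.
exists (kap0 ^+ 2); first by rewrite exprn_gt0.
move=> delta /andP[dl0 dlt].
pose K := Num.sqrt delta.
have K0 : 0 < K by rewrite sqrtr_gt0.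
have KK : K ^+ 2 = delta by rewrite sqr_sqrtr // ltW.
have Kkap : K < kap0.
  by rewrite -(ltr_pXn2r (n := 2)) ?nnegrE ?(ltW K0) ?(ltW kap00) // KK.
move: Kkap; rewrite /kap0 !lt_min => /and3P[Kk1 Kk2 Kk3].
(* [sum_sqr_cos] needs three sites; the other bound makes [gscale T <= 2 K] and
   [T >= 0]. *)
exists (maxn 3 (Num.truncn (M / mu / (delta * K) + delta^-1)).+1) => N.
rewrite geq_max => /andP[N3 NT] d Omega P sigma proc.
have N0 : (0 < N)%N by rewrite (leq_trans _ N3).
have [mc fair] := proc.
set n := N%:R : R.
have nT : M / mu / (delta * K) + delta^-1 <= n.
  apply/ltW; apply: (lt_le_trans (truncnS_gt _)); by rewrite ler_nat.
have dK : 0 < delta * K by rewrite mulr_gt0.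
have nT1 : M / mu / (delta * K) <= n.
  by apply: le_trans nT; rewrite lerDl invr_ge0 ltW.
have nT2 : delta^-1 <= n.
  by apply: le_trans nT; rewrite lerDr divr_ge0 ?(ltW Mmu) // ltW.
have n1 : 1 <= n by rewrite ler1n.
have n0 : 0 < n by rewrite ltr0n.
have nd1 : 1 <= n * delta by rewrite -ler_pdivrMr // div1r.
have nd0 : 0 < n * delta by rewrite mulr_gt0.
set T := (2 * mu)^-1 * ln (n * delta).
have T0 : 0 <= T by rewrite mulr_ge0 ?ln_ge0 // invr_ge0 mulr_ge0 // ltW.
have expT : expR (2 * mu * T) = n * delta.
  rewrite /T mulVKf ?gt_eqF ?mulr_gt0 // lnK ?posrE //.
have expT2 : expR (mu * T) = Num.sqrt (n * delta).
  rewrite -expT -mulrA expRM_natl sqrtr_sqr ger0_norm ?expR_ge0 //.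
have key := @anticoncentration R _ d Omega P _ sigma mc (@jump_rate_ge0 R beta1 beta2 tau1 tau2 lambda N)
  (@Y N) (@total_energy R tau1 tau2 N) mu n A v0 v1 E KV M K T mu_gt0 n1 A0 (ltW v00) E0 KV0
  M0 K0 T0.
have kY (s : config N) : `|Y s| <= A.
  apply: (le_trans (leading_mode_le (spin_coef_le1 _ _ _ _) (spin_coef_le1 _ _ _ _))).
  by rewrite /A mulr1 ler_peMl // ler1n.
have kgen (s : config N) : `|generator (jump_rate beta1 beta2 tau1 tau2 lambda) (@Y N) s - mu * Y s| <=
    E * (n^-1 + total_energy tau1 tau2 s) by rewrite generator_local hE.
have {}key := key kY (fun s u h => leading_mode_jump h)
  (fun s => leading_mode_var_ge N3 (fun i x => hr N s i x N0))
  (fun s => leading_mode_var_le s N0) kgen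
  (fun t t0 => hKV N d Omega P sigma N0 proc t t0).
have M1 : 4 * A ^+ 2 * mu <= M by rewrite lerDl mulr_ge0 // ltW.
have M2 : 4 * v1 <= M by rewrite lerDr.
have {}key := key M1 M2.
have wid : (l * delta) ^+ 2 <= gwidth mu n M K T.
  rewrite /gwidth expT ler_pdivlMr //.
  apply: (@le_trans _ _ (K * (n * delta))); last by rewrite lerDr ltW.
  rewrite exprMn (_ : K * (n * delta) = K * delta * n); last by ring.
  rewrite ler_wpM2r ?(ltW n0) // expr2 mulrA ler_wpM2r ?(ltW dl0) //.
  rewrite -KK expr2 mulrA ler_piMl ?(ltW K0) //.
  have l21 : 0 < l ^+ 2 + 1 by rewrite ltr_wpDl ?sqr_ge0.
  apply: (@le_trans _ _ ((l ^+ 2 + 1) * k3)); last by rewrite /k3 mulfV // gt_eqF.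
  by apply: ler_pM; rewrite ?sqr_ge0 ?(ltW K0) ?(ltW Kk3) // lerDl.
apply: (@le_trans _ _ (mean P sigma T (fun s => (Y s ^+ 2 <= gwidth mu n M K T)%R%:R))).
  apply: mean_le => s; have [h|//] := boolP (Y s ^+ 2 <= (l * delta) ^+ 2).
  by rewrite (le_trans h wid).
apply: (le_trans key).
have gs0 : 0 < gscale mu M K T by rewrite addr_gt0 // mulr_gt0 ?expR_gt0.
have gs : gscale mu M K T <= 2 * K.
  rewrite /gscale mulNr expRN expT.
  have : M / mu / (n * delta) <= K; last lra.
  rewrite ler_pdivrMr //; move: nT1; rewrite ler_pdivrMr //.
  by rewrite (_ : n * (delta * K) = K * (n * delta)) //; ring.
have lngs : ln (gscale mu M K T) <= ln (2 * K).
  by rewrite ler_ln ?posrE // mulr_gt0.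
have scal : Num.sqrt (n / K) / n * expR (mu * T) = Num.sqrt K.
  have nz : n != 0 by rewrite gt_eqF.
  rewrite expT2 mulrAC -sqrtrM ?divr_ge0 ?(ltW n0) ?(ltW K0) //.
  rewrite (_ : n / K * (n * delta) = n ^+ 2 * K); last first.
    by rewrite -KK; field; rewrite gt_eqF.
  by rewrite sqrtrM ?sqr_ge0 // sqrtr_sqr gtr0_norm // mulrAC divff // mul1r.
apply: (@le_trans _ _ (expR (1 + g * ln (2 * K)) *
  (expR (- g * ln (M / mu)) + E' * expR (- g * ln K) * Num.sqrt K))).
  apply: ler_pM; rewrite ?expR_ge0 //.
  - rewrite addr_ge0 ?expR_ge0 // mulr_ge0 ?expR_ge0 // mulr_ge0 //.
      by rewrite mulr_ge0 ?expR_ge0.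
    by rewrite divr_ge0 ?sqrtr_ge0 // ltW.
  - by rewrite ler_expR lerD2l ler_wpM2l // ltW.
  - by rewrite lerD2l -[leLHS]mulrA scal.
rewrite mulrDr -expRD.
have half : e = e / 2 + e / 2 by field.
rewrite [leRHS]half; apply: lerD.
  rewrite -[leRHS]lnK ?posrE ?divr_gt0 // ler_expR.
  have h : ln (2 * K) <= ln (M / mu) + (ln (e / 2) - 1) / g.
    rewrite -[X in _ + X]expRK -lnM ?posrE ?expR_gt0 //.
    rewrite ler_ln ?posrE ?mulr_gt0 ?invr_gt0 ?expR_gt0 //.
    by move: Kk1; rewrite /k1 ltr_pdivlMr // mulrC => /ltW.
  have := ler_wpM2l (ltW g0) h; rewrite mulrDr (mulrC g (_ / g)) divfK ?gt_eqF //.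
  by lra.
rewrite [leLHS](_ : _ = G * Num.sqrt K); last first.
  rewrite lnM ?posrE // /G mulrDr addrA expRD !mulNr [expR (- _)]expRN.
  have := expR_gt0 (g * ln K); set z := expR (g * ln K) => z0.
  by field; rewrite gt_eqF.
have sK : Num.sqrt K <= e / (2 * (G + 1)).
  have z0 : 0 <= e / (2 * (G + 1)) by rewrite divr_ge0 ?(ltW e0) // mulr_ge0 // ltW.
  rewrite -[leRHS](ger0_norm z0) -sqrtr_sqr.
  by apply: ler_wsqrtr; exact: ltW.
apply: (@le_trans _ _ ((G + 1) * (e / (2 * (G + 1))))).
  by apply: ler_pM; rewrite ?sqrtr_ge0 // lerDl.
by rewrite le_eqVlt; apply/orP; left; apply/eqP; field; rewrite gt_eqF.
Qed.

End UnstableMode.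

(** * From cosine coefficients to the norm of the modes *)

Section Modes.
Context {R : realType}.

Lemma mode_rect (N : nat) (s : {ffun 'I_N -> bool}) (k : int) :
  mode s k =
  ((N%:R^-1 * \sum_(x < N) spin (s x) * cos (- (2 * pi * k%:~R * (x%:R / N%:R)))) +i*
   (N%:R^-1 * \sum_(x < N) spin (s x) * sin (- (2 * pi * k%:~R * (x%:R / N%:R)))))%C :> R[i].
Proof.
have E (c : R) (z : R[i]) : c%:C%C * z = ((c * complex.Re z) +i* (c * complex.Im z))%C.
  by case: z => a b; rewrite /GRing.mul /=; congr (_ +i* _)%C; rewrite mul0r ?subr0 ?addr0.
have ReD (z w : R[i]) : complex.Re (z + w) = complex.Re z + complex.Re w.
  by case: z; case: w.
have Re_sum (I : Type) (r : seq I) (F : I -> R[i]) :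
    complex.Re (\sum_(i <- r) F i) = \sum_(i <- r) complex.Re (F i).
  by elim: r => [|i r IH]; rewrite ?big_nil ?big_cons // ReD IH.
have ImD (z w : R[i]) : complex.Im (z + w) = complex.Im z + complex.Im w.
  by case: z; case: w.
have Im_sum (I : Type) (r : seq I) (F : I -> R[i]) :
    complex.Im (\sum_(i <- r) F i) = \sum_(i <- r) complex.Im (F i).
  by elim: r => [|i r IH]; rewrite ?big_nil ?big_cons // ImD IH.
rewrite /mode E Re_sum Im_sum.
by congr ((_ * _) +i* (_ * _))%C; apply: eq_bigr => x _; rewrite E.
Qed.

(** The real part of the mode is the cosine coefficient, the same one for both
    signs of [k]. *)
Lemma norm_Re_mode_le (N : nat) (s : config N) (k : int) (i : bool) :
  k = 1 \/ k = - 1 -> `|spin_coef true i 1 s : R| <= norm2 (modes s k).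
Proof.
move=> hk.
have -> : spin_coef true i 1 s = complex.Re (mode (pop s i) k) :> R.
  rewrite mode_rect /spin_coef /tcoef /=; congr (_ * _); apply: eq_bigr => x _.
  rewrite /angle cosN; congr (_ * _); case: hk => -> //.
  by rewrite -[RHS]cosN; congr cos; rewrite mulrN1z; ring.
have Re_le (z : R[i]) : `|complex.Re z| <= Normc.normc z.
  case: z => a b /=; rewrite -sqrtr_sqr; apply: ler_wsqrtr.
  by rewrite lerDl sqr_ge0.
apply: (le_trans (Re_le _)).
have sq (a b : R) : 0 <= a -> a <= Num.sqrt (a ^+ 2 + b ^+ 2).
  by move=> a0; rewrite -{1}(ger0_norm a0) -sqrtr_sqr ler_wsqrtr // lerDl sqr_ge0.
have nc0 (z : R[i]) : 0 <= Normc.normc z by case: z => a b; exact: sqrtr_ge0.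
rewrite /norm2 /modes /=; case: i; rewrite /pop; first exact: sq.
by rewrite addrC; exact: sq.
Qed.

Lemma limn_einf_cvg1 (u : R -> nat -> \bar R) :
  (forall e : R, 0 < e -> exists2 delta0 : R, 0 < delta0 &
     forall delta, 0 < delta < delta0 -> exists n0 : nat, forall n, (n0 <= n)%N ->
     ((1 - e)%:E <= u delta n <= 1)%E) ->
  limn_einf (u delta) @[delta --> (0 : R)^'+] --> 1%E.
Proof.
move=> hu.
have near_bounds (e : R) : 0 < e -> \forall delta \near (0 : R)^'+,
    ((1 - e)%:E <= limn_einf (u delta) <= 1)%E.
  move=> /hu[delta0 d0 h]; near=> delta.
  have [|n0 hn] := h delta.
    apply/andP; split; first by near: delta; exact: nbhs_right_gt.
    by near: delta; exact: nbhs_right_lt.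
  rewrite limn_einf_lim; apply/andP; split.
    apply: lime_ge; first exact: is_cvg_einfs.
    exists n0 => // n /= n0n; apply: le_ereal_inf_tmp => _ [m /= nm <-].
    by have /andP[] := hn m (leq_trans n0n nm).
  apply: lime_le; first exact: is_cvg_einfs.
  exists n0 => // n /= n0n; have /andP[_] := hn n n0n; apply: le_trans.
  by apply: ereal_inf_lbound; exists n => //=.
have fin (x : \bar R) (e : R) : ((1 - e)%:E <= x <= 1)%E -> x \is a fin_num.
  by case: x => [x|/andP[_]|/andP[]].
apply/fine_cvgP; split.
  by near=> delta; apply: (fin _ 1); near: delta; exact: near_bounds.
apply/cvgrPdist_le => e e0; near=> delta.
have h1 : ((1 - e)%:E <= limn_einf (u delta) <= 1)%E by near: delta; exact: near_bounds.
have h3 := fin _ _ h1; move: h1; rewrite -(fineK h3) !lee_fin /= => /andP[h1 h2].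
by rewrite ger0_norm ?subr_ge0 //; lra.
Unshelve. all: by end_near. Qed.

End Modes.

Unset Implicit Arguments.

Theorem theorem2p7 (R : realType) (beta1 beta2 tau1 tau2 lambda mu : R)
  (d : nat -> measure_display)
  (Omega : forall N : nat, measurableType (d N))
  (P : forall N : nat, probability (Omega N) R)
  (sigma : forall N : nat, R -> Omega N -> config N) (k : int) :
  beta2 <= beta1 -> 0 < beta2 -> 0 < tau1 -> 0 < tau2 -> 0 < lambda ->
  instability_at_pm1 beta1 beta2 tau1 tau2 lambda ->
  0 < mu -> eigenvalue (linear_part beta1 beta2 tau1 tau2 lambda 1) mu ->
  (forall N : nat, (0 < N)%N ->
     spin_process beta1 beta2 tau1 tau2 lambda (P N) (sigma N)) ->
  k = 1 \/ k = - 1 ->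
  limn_einf (fun N : nat =>
    P N [set w | norm2 (rescaled_modes mu (sigma N) k
                          (1 - T_ mu delta / crit_time mu N) w) > delta])
    @[delta --> 0^'+] --> 1%E.
Proof.
move=> b21 b2 tau10 tau20 lam0 [hst hun] mu0 eig proc hk.
have b1 : 0 < beta1 by exact: lt_le_trans b21.
pose t1 := couplingf beta1 beta2 lambda true.
pose t2 := couplingf beta1 beta2 lambda false.
have t10 : 0 < t1 by apply: tanhR_gt0; rewrite mulr_gt0.
have t20 : 0 < t2 by apply: tanhR_gt0; rewrite mulr_gt0.
have tt : tanhR (lambda * beta1) * tanhR (lambda * beta2) = t1 * t2.
  by rewrite /t1 /t2 /couplingf /= ![lambda * _]mulrC.
pose a1 := -1 + alpha beta1 lambda * phi_coef tau1 tau2 true 1.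
pose d1 := -1 + alpha beta2 lambda * phi_coef tau1 tau2 false 1.
have phiE1 m : phi_hat tau1 (Posz m) = phi_coef tau1 tau2 true m by [].
have phiE2 m : phi_hat tau2 (Posz m) = phi_coef tau1 tau2 false m by [].
(* Eigenvectors of matrices are row vectors here, that is, left eigenvectors. *)
have [v vA v0] := eigenvalueP eig.
pose l1 := v 0 0; pose l2 := v 0 1.
have left1 : l1 * a1 - l2 * t2 = mu * l1.
  have := congr1 (fun M : 'rV[R]_2 => M 0 0) vA.
  rewrite !mxE !big_ord_recl big_ord0 /= addr0 !mxE /= => h.
  rewrite -[RHS]h; congr (_ + _); rewrite /l2 -mulrN; congr (_ * _).
  by congr (v _ _); apply/val_inj.
have left2 : l1 * t1 + l2 * d1 = mu * l2.
  have := congr1 (fun M : 'rV[R]_2 => M 0 1) vA.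
  rewrite !mxE !big_ord_recl big_ord0 /= addr0 !mxE /= => h.
  rewrite -[RHS]h; congr (_ + _); congr (_ * _).
  by rewrite /l2; congr (v _ _); apply/val_inj.
have lpos : 0 < l1 ^+ 2 + l2 ^+ 2.
  rewrite lt_def addr_ge0 ?sqr_ge0 // andbT paddr_eq0 ?sqr_ge0 // !sqrf_eq0.
  apply: contraNN v0 => /andP[/eqP e1 /eqP e2]; apply/eqP/rowP => j.
  rewrite mxE; case: j => [[|[|//]] jlt].
    by rewrite -[RHS]e1; congr (v _ _); apply/val_inj.
  by rewrite -[RHS]e2; congr (v _ _); apply/val_inj.
(* With [l1 = 0] the first equation gives [l2 = 0]; dividing by [l1] then yields
   the characteristic equation of the linear part. *)
have l1n : l1 != 0.
  apply: contraTneq lpos => e1; move: left1; rewrite e1 mul0r mulr0 sub0r => /eqP.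
  rewrite oppr_eq0 mulf_eq0 (gt_eqF t20) orbF => /eqP ->.
  by rewrite expr0n addr0 ltxx.
have charE : (mu - a1) * (mu - d1) = - (t1 * t2).
  apply: (mulfI l1n).
  rewrite [LHS](_ : _ = (mu * l1 - l1 * a1) * (mu - d1)); last by ring.
  rewrite -left1 [LHS](_ : _ = - t2 * (mu * l2 - l2 * d1)); last by ring.
  by rewrite -left2; ring.
have growth m : exists p q r c, growth_form
    (-1 + alpha beta1 lambda * phi_coef tau1 tau2 true m)
    (-1 + alpha beta2 lambda * phi_coef tau1 tau2 false m) t1 t2 mu p q r c.
  have [->|m1] := eqVneq m 1%N.
    apply: saddle_growth_form => //; first by rewrite gt_eqF.
    have := hun 1 (or_introl erefl); rewrite tt -/a1 -/d1 !phiE1 !phiE2 => h.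
    rewrite (_ : a1 * d1 = - ((alpha beta1 lambda * phi_coef tau1 tau2 true 1 - 1) *
      (1 - alpha beta2 lambda * phi_coef tau1 tau2 false 1))); last by rewrite /a1 /d1; ring.
    by rewrite addrC subr_lt0.
  have m1' : Posz m <> 1 by case=> /eqP; rewrite (negPf m1).
  have m1'' : Posz m <> -1.
    by move=> h; have : (0 : int) <= -1 by rewrite -h.
  have [] := hst (Posz m) m1' m1''.
  rewrite tt !phiE1 !phiE2 => h1 h2.
  apply: stable_growth_form => //; first by lra.
  move: h2; set x := alpha _ _ * _; set y := alpha _ _ * _ => h2.
  rewrite (_ : (-1 + x) * (-1 + y) = - ((x - 1) * (1 - y))); last by ring.
  by rewrite addrC subr_gt0.
apply: limn_einf_cvg1 => e e0.
have [delta0 d00 hd] := leading_mode_not_small b1 b2 tau10 tau20 lam0 mu0 left1 left2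
  lpos growth e0.
exists delta0 => // delta dlt; have [N0 hN] := hd delta dlt.
have dl0 : 0 < delta by case/andP: dlt.
exists (maxn N0 (maxn 2 (Num.truncn delta^-1).+1)) => N.
rewrite !geq_max => /and3P[NN0 N2 Nd].
have N_gt0 : (0 < N)%N by rewrite (leq_trans _ N2).
have := hN N NN0 _ _ (P N) (sigma N) (proc N N_gt0).
have [mc _] := proc N N_gt0.
have n0 : 0 < N%:R :> R by rewrite ltr0n.
(* The rescaled time [t_c - T_delta] in closed form. *)
have timeE : crit_time mu N * (1 - T_ mu delta / crit_time mu N) =
    (2 * mu)^-1 * ln (N%:R * delta).
  have c0 : crit_time mu N != 0.
    rewrite /crit_time mulf_neq0 ?invr_eq0 ?gt_eqF ?mulr_gt0 // ln_gt0 //.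
    by rewrite ltr1n.
  rewrite mulrBr mulr1 mulrCA divff // mulr1 /crit_time /T_ -mulrBr lnV ?posrE //.
  by rewrite opprK lnM ?posrE.
set T := (2 * mu)^-1 * _ in timeE *.
have T0 : 0 <= T.
  rewrite mulr_ge0 ?invr_ge0 ?mulr_ge0 ?(ltW mu0) // ln_ge0 //.
  rewrite -ler_pdivrMr // div1r; apply/ltW; apply: (lt_le_trans (truncnS_gt _)).
  by rewrite ler_nat.
rewrite /rescaled_modes timeE => hmean.
rewrite (probability_law mc (fun s => delta < norm2 (modes s k)) T0) !lee_fin.
apply/andP; split; last first.
  by rewrite -[leRHS](mean_cst mc 1 T0); apply: mean_le => s; case: (_ < _).
rewrite lerBlDr; apply: le_trans (lerD (lexx _) hmean).
rewrite -meanD -[leLHS](mean_cst mc 1 T0); apply: mean_le => s.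
have [dn|nd] := ltP delta (norm2 (modes s k)); first by rewrite lerDl.
rewrite add0r.
have m1 i := le_trans (norm_Re_mode_le s i hk) nd.
have := leading_mode_le l1 l2 (m1 true) (m1 false) => hY.
suff -> : leading_mode l1 l2 s ^+ 2 <= ((`|l1| + `|l2|) * delta) ^+ 2 by [].
rewrite -[leLHS]real_normK ?num_real //.
by apply: lerXn2r => //; rewrite nnegrE // (le_trans _ hY).
Qed.
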